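(* Let $W,W'\in\mathcal W$, let $C=\max\{1,\|W\|_\infty,\|W'\|_\infty\}$, and let $k\ge1$ be an integer. (a) If $F$ is a simple graph with $m$ edges, then $$|t(F,W)-t(F,W')|\le 4mC^{m-1}\delta_\square(W,W').$$ (b) If $|t(F,W)-t(F,W')|\le 3^{-k^2}$ for every simple graph $F$ on $k$ nodes, then $$\delta_\square(W,W')\le\frac{22C}{\sqrt{\log_2k}}$$ (for $k=1$ the right-hand side is read as $+\infty$).
   Context: $\mathcal W$ denotes the space of all bounded measurable functions $W:[0,1]^2\to\mathbb R$ with $W(x,y)=W(y,x)$ for all $x,y\in[0,1]$ (graphons); $\|W\|_\infty$ is the supremum norm. For a simple graph $F$ (finite, no loops or multiple edges) with $V(F)=\{1,\dots,k\}$, $$t(F,W)=\int_{[0,1]^k}\prod_{ij\in E(F)}W(x_i,x_j)\,dx_1\cdots dx_k.$$ The cut distance is $$\delta_\square(W,W')=\inf_{\mu\in\mathcal M}\ \sup_{S,T\subseteq[0,1]^2}\Bigl|\int_{(x,u)\in S,\ (y,v)\in T}\bigl(W(x,y)-W'(u,v)\bigr)\,d\mu(x,u)\,d\mu(y,v)\Bigr|,$$ where $\mathcal M$ is the set of probability measures on $[0,1]^2$ both of whose marginals are Lebesgue measure, and $S,T$ range over measurable sets. *)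

(* Defs.v *)
From HB Require Import structures.
From mathcomp Require Import all_boot all_order all_algebra.
From mathcomp Require Import all_classical all_reals all_analysis.

Set Implicit Arguments.
Unset Strict Implicit.
Unset Printing Implicit Defensive.

Import Order.TTheory GRing.Theory Num.Theory.
Import numFieldNormedType.Exports.

Local Open Scope classical_set_scope.
Local Open Scope ring_scope.

Section power_probability.
Context d (T : measurableType d) (R : realType).

Definition tuple_cons n (p : T * n.-tuple T) : n.+1.-tuple T :=
  [tuple of p.1 :: p.2].

Let measurable_tuple_cons n : measurable_fun setT (@tuple_cons n).
Proof. exact: (measurable_cons measurable_fst measurable_snd). Qed.

HB.instance Definition _ n :=
  isMeasurableFun.Build _ _ _ _ (@tuple_cons n) (@measurable_tuple_cons n).

(* The n-fold product of P; see power_probability_box. *)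
Fixpoint power_probability (P : probability T R) n :
    probability (n.-tuple T) R :=
  match n with
  | 0 => \d_ [tuple]
  | n'.+1 => distribution (P \x power_probability P n')%E (@tuple_cons n')
  end.

Lemma power_probability_box (P : probability T R) n (A : 'I_n -> set T) :
  (forall i, measurable (A i)) ->
  power_probability P n [set x | forall i, A i (tnth x i)] =
  (\prod_(i < n) P (A i))%E.
Proof.
elim: n A => [|n IHn] A mA /=.
  by rewrite big_ord0 diracE mem_set// => -[].
have mB : measurable
    [set x : n.-tuple T | forall i, A (lift ord0 i) (tnth x i)].
  rewrite (_ : mkset _ = \bigcap_(i in [set: 'I_n])
      ((fun x : n.-tuple T => tnth x i) @^-1` A (lift ord0 i))); last first.
    by apply/seteqP; split => x /= Ax i => [_|]; exact: Ax.
  apply: fin_bigcap_measurable => // i _; rewrite -[X in measurable X]setTI.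
  exact: measurable_tnth.
rewrite big_ord_recl -IHn; last by move=> i; exact: mA.
rewrite -product_measure1E//; congr (product_measure1 _ _ _).
apply/seteqP; split => -[x y] /=.
  move=> Axy; split; first exact: (Axy ord0).
  by move=> i; have := Axy (lift ord0 i); rewrite tnthS.
move=> [Ax Ay] i; case: (unliftP ord0 i) => [j ->|->//].
by rewrite tnthS; exact: Ay.
Qed.

End power_probability.

Section unit_interval.
Context {R : realType}.

Definition unit_square : set (R * R) := `[0, 1] `*` `[0, 1].

Definition unit_cube n : set (n.-tuple R) :=
  [set x | forall i, tnth x i \in `[0, 1]].

(* Lebesgue measure on [0, 1], as a measure on the line. *)
Definition unit_lebesgue (A : set R) : \bar R :=
  lebesgue_measure (A `&` `[0, 1]).

Let restr : {measure set (measurableTypeR R) -> \bar R} :=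
  mrestr lebesgue_measure (measurable_itv `[0, 1]).

Let unit_lebesgue0 : unit_lebesgue set0 = 0%E.
Proof. exact: (measure0 restr). Qed.

Let unit_lebesgue_ge0 A : (0 <= unit_lebesgue A)%E.
Proof. exact: (measure_ge0 restr). Qed.

Let unit_lebesgue_sigma_additive : semi_sigma_additive unit_lebesgue.
Proof. exact: (@measure_semi_sigma_additive _ _ _ restr). Qed.

HB.instance Definition _ := isMeasure.Build _ _ _ unit_lebesgue
  unit_lebesgue0 unit_lebesgue_ge0 unit_lebesgue_sigma_additive.

Let unit_lebesgueT : unit_lebesgue setT = 1%E.
Proof.
by rewrite /unit_lebesgue setTI lebesgue_measure_itv/= lte01 oppr0 adde0.
Qed.

HB.instance Definition _ :=
  Measure_isProbability.Build _ _ _ unit_lebesgue unit_lebesgueT.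

End unit_interval.
Arguments unit_square R : clear implicits.
Arguments unit_cube R n : clear implicits.
Arguments unit_lebesgue R : clear implicits.

(* A graphon is represented by a function on the plane of which only the
   values on the unit square matter. *)
Record graphon (R : realType) (W : R * R -> R) : Prop := Graphon {
  graphon_measurable : measurable_fun (unit_square R) W;
  graphon_bounded : [bounded W z | z in unit_square R];
  graphon_sym : forall x y, x \in `[0, 1] -> y \in `[0, 1] -> W (x, y) = W (y, x)
}.

Definition sup_norm (R : realType) (W : R * R -> R) : R :=
  sup [set `|W z| | z in unit_square R].

Record simple_graph n := SimpleGraph {
  adj : rel 'I_n;
  adj_sym : symmetric adj;
  adj_irr : irreflexive adj
}.

(* Each edge is listed once, with its smaller endpoint first. *)
Definition edges n (F : simple_graph n) : {set 'I_n * 'I_n} :=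
  [set ij : 'I_n * 'I_n | (ij.1 < ij.2)%N && adj F ij.1 ij.2].

Definition hom_density (R : realType) n (F : simple_graph n)
    (W : R * R -> R) : R :=
  \int[power_probability (unit_lebesgue R) n]_(x in unit_cube R n)
    \prod_(ij in edges F) W (tnth x ij.1, tnth x ij.2).

(* The marginal conditions force such a measure on the plane to be carried by
   the unit square. *)
Definition coupling (R : realType) (mu : probability (R * R)%type R) : Prop :=
  forall A : set R, measurable A ->
    mu (fst @^-1` A) = unit_lebesgue R A /\
    mu (snd @^-1` A) = unit_lebesgue R A.

Section cut_distance.
Context {R : realType}.
Local Open Scope ereal_scope.

Definition cut_discrepancy (W W' : R * R -> R)
    (mu : probability (R * R)%type R) (S T : set (R * R)) : \bar R :=
  `| \int[mu \x mu]_(p in S `*` T)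
       (W (p.1.1, p.2.1) - W' (p.1.2, p.2.2))%:E |.

Definition cut_distance (W W' : R * R -> R) : \bar R :=
  ereal_inf [set
    ereal_sup [set cut_discrepancy W W' mu ST.1 ST.2 | ST in
      [set ST : set (R * R) * set (R * R) |
        [/\ measurable ST.1, measurable ST.2,
            ST.1 `<=` unit_square R & ST.2 `<=` unit_square R]]]
    | mu in @coupling R].

End cut_distance.

Definition log2 (R : realType) (x : R) : R := ln x / ln 2.

(* Main.v *)
(* Both parts are proved for finite weighted sets: graphons are approximated in
   L1 by step functions with finitely many cells.

   (a) On the space of the coupling, the edges are replaced one at a time. Once
   the points other than x_i and x_j are fixed, the remaining factors split
   into a function of x_i times a function of x_j, each with values of both
   signs, so a replacement costs at most 4 times the cut norm.

   (b) If k < 8^40, the independent coupling already gives 2C. Otherwise let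
   8^q <= k < 8^(q+1) and rescale to C = 1. By weak regularity, W and W' are
   within 1/sqrt q in cut norm of averages W_c, W'_c over at most 4^q cells.
   Sample k points X and draw a sign for each pair with mean W(X_i, X_j). The
   probability of a sign pattern is a combination of the densities t(F, W), so
   the hypothesis makes the laws for W and W' close in total variation, and one
   sign pattern g is typical for both. Typical means that g is close to the
   sampled W in cut norm (exponential moments), that the sampled W - W_c has
   small cut norm (the best rows and columns are determined by a random sample
   of q of them), and that the cells are hit with the right frequencies. Hence
   W_c and W'_c are close on the k sample points, and matching X_i with X'_i
   defines a coupling of the cells, up to a small correction of its marginals. *)

From HB Require Import structures.
Require Import Defs.
From mathcomp Require Import all_boot all_order all_algebra.
From mathcomp Require Import all_classical all_reals all_analysis.
From mathcomp Require Import measurable_realfun ring lra zify.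

Set Implicit Arguments.
Unset Strict Implicit.
Unset Printing Implicit Defensive.

Import Order.TTheory GRing.Theory Num.Theory.
Import numFieldNormedType.Exports.

Local Open Scope classical_set_scope.
Local Open Scope ring_scope.

(** * Finite product expectations and the counting lemma *)

(** Edge probabilities would have to lie in [0, 1]; a rescaled graphon has values in [-1, 1], so it
    is read as the mean of a random sign. The samples [X] and [X'] have unrelated laws: only the
    pattern [g] is common to both, and its labels match the points. The number of cells and the
    number of guesses for the best rows and columns are each at most 4^q, while sampling variances
    are of order q/k; [8 ^ q <= k] leaves a factor 2^q that absorbs all polynomial losses, so the
    accuracy 1/sqrt q is of order 1/sqrt (log k). Exceptional events are handled through
    expectations: each family of them is summed into one nonnegative variable of small mean, and a
    value below 1 excludes the whole family. With y = 1/sqrt q and t = y/50, the errors in (b) are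
    2y from the regularity of W and W', 10y + 4t from the sampled residuals, 2t + 2/k from the signs
    and 16t from the cell frequencies, in total at most 25y/2. *)

Definition upd (K : eqType) (I : Type) (X : K -> I) (i : K) (y : I) : K -> I :=
  fun j => if j == i then y else X j.

Section product_expectation.
Context {R : realType} {K I : finType}.
Implicit Types (p : K -> I -> R) (Phi Psi : (K -> I) -> R).

(* The expectation of Phi at a family of independent points, the i-th of which
   is drawn from I with weights p i. *)
Definition Ex p Phi : R :=
  \sum_(X : {ffun K -> I}) (\prod_i p i (X i)) * Phi X.

Lemma Ex_eq p Phi Psi : Phi =1 Psi -> Ex p Phi = Ex p Psi.
Proof. by move=> e; apply: eq_bigr => X _; rewrite e. Qed.

Lemma Ex_prod p (f : K -> I -> R) :
  Ex p (fun X => \prod_i f i (X i)) = \prod_i \sum_x p i x * f i x.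
Proof.
rewrite bigA_distr_bigA /Ex; apply: eq_bigr => X _.
by rewrite big_split.
Qed.

Lemma ExZ p c Phi : Ex p (fun X => c * Phi X) = c * Ex p Phi.
Proof.
by rewrite /Ex big_distrr/=; apply: eq_bigr => X _; rewrite mulrCA.
Qed.

Lemma ExD p Phi Psi : Ex p (fun X => Phi X + Psi X) = Ex p Phi + Ex p Psi.
Proof. by rewrite /Ex -big_split/=; apply: eq_bigr => X _; rewrite mulrDr. Qed.

Lemma Ex_sum p (J : Type) (r : seq J) (P : pred J) (F : J -> (K -> I) -> R) :
  Ex p (fun X => \sum_(j <- r | P j) F j X) = \sum_(j <- r | P j) Ex p (F j).
Proof.
rewrite /Ex [RHS]exchange_big/=; apply: eq_bigr => X _.
by rewrite big_distrr.
Qed.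

Variable p : K -> I -> R.
Hypothesis p_ge0 : forall i x, 0 <= p i x.
Hypothesis p_sum1 : forall i, \sum_x p i x = 1.

Lemma Ex_const c : Ex p (fun=> c) = c.
Proof.
rewrite -[c in LHS]mulr1 ExZ.
suff -> : Ex p (fun=> 1) = 1 by rewrite mulr1.
have -> : Ex p (fun=> 1) = \prod_i \sum_x p i x * 1.
  by rewrite -(Ex_prod p (fun _ _ => 1)); apply: Ex_eq => X; rewrite big1_eq.
by rewrite big1// => i _; under eq_bigr do rewrite mulr1.
Qed.

Lemma Ex_ler Phi Psi : (forall X, Phi X <= Psi X) -> Ex p Phi <= Ex p Psi.
Proof.
by move=> le; apply: ler_sum => X _; apply: ler_wpM2l => //; exact: prodr_ge0.
Qed.

Lemma Ex_ge0 Phi : (forall X, 0 <= Phi X) -> 0 <= Ex p Phi.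
Proof. by move=> ge0; rewrite -[0](Ex_const 0); exact: Ex_ler. Qed.

Lemma Ex_norm Phi : `|Ex p Phi| <= Ex p (fun X => `|Phi X|).
Proof.
apply: (le_trans (ler_norm_sum _ _ _)); apply: ler_sum => X _.
by rewrite normrM (ger0_norm (prodr_ge0 _ _)).
Qed.

(* (X, y) |-> (upd X i y, X i) is a measure-preserving involution. *)
Lemma Ex_resample i Phi :
  Ex p Phi = Ex p (fun X => \sum_y p i y * Phi (upd X i y)).
Proof.
pose U (X : {ffun K -> I}) y : {ffun K -> I} := [ffun j => upd X i y j].
pose h (Z : {ffun K -> I} * I) := (U Z.1 Z.2, Z.1 i).
have hK : involutive h.
  move=> [X y]; rewrite /h /= ffunE /upd eqxx; congr (_, _).
  apply/ffunP => j; rewrite ffunE /upd; case: eqP => [->//|/eqP/negbTE ji].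
  by rewrite ffunE /upd ji.
have UE X y : U X y = upd X i y :> (K -> I).
  by apply/funext => j; rewrite ffunE.
transitivity (\sum_(Z : {ffun K -> I} * I)
    (\prod_j p j (Z.1 j)) * p i Z.2 * Phi Z.1).
  rewrite -(pair_bigA _ (fun (X : {ffun K -> I}) y => (\prod_j p j (X j)) * p i y * Phi X))/=.
  apply: eq_bigr => X _; rewrite -big_distrl/= -big_distrr/=.
  by rewrite p_sum1 mulr1.
rewrite (reindex_inj (inv_inj hK))/= /Ex.
under [RHS]eq_bigr do rewrite big_distrr/=.
rewrite pair_bigA/=; apply: eq_bigr => -[X y] _ /=.
rewrite UE (bigD1 i)//= [X in _ = X * _](bigD1 i)//= {1}/upd eqxx.
rewrite (eq_bigr (fun j => p j (X j))).
  by ring.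
by move=> j /negbTE ji; rewrite /upd ji.
Qed.

Lemma Ex_ortho i Phi :
  (forall X, \sum_y p i y * Phi (upd X i y) = 0) -> Ex p Phi = 0.
Proof.
by move=> h; rewrite (Ex_resample i) (Ex_eq _ h) Ex_const.
Qed.

Lemma Ex_coord i (f : I -> R) : Ex p (fun X => f (X i)) = \sum_x p i x * f x.
Proof.
rewrite (Ex_resample i); under Ex_eq do under eq_bigr do rewrite /upd eqxx.
by rewrite Ex_const.
Qed.

End product_expectation.

Section bilinear.
Context {R : realType} {I : finType}.
Implicit Types (M : I -> I -> R) (f g : I -> R).

Definition bform M f g : R := \sum_x \sum_y f x * g y * M x y.

Lemma bformC M f g : bform M f g = bform (fun x y => M y x) g f.
Proof.
rewrite /bform exchange_big/=; apply: eq_bigr => y _; apply: eq_bigr => x _.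
by rewrite [f x * _]mulrC.
Qed.

Lemma bformN M f g : bform (fun x y => - M x y) f g = - bform M f g.
Proof.
rewrite /bform -sumrN; apply: eq_bigr => x _.
by rewrite -sumrN; apply: eq_bigr => y _; rewrite mulrN.
Qed.

Lemma bformBl M f f' g :
  bform M (fun x => f x - f' x) g = bform M f g - bform M f' g.
Proof.
rewrite /bform -sumrB; apply: eq_bigr => x _.
by rewrite -sumrB; apply: eq_bigr => y _; rewrite -!mulrBl.
Qed.

Lemma bformBr M f g g' :
  bform M f (fun x => g x - g' x) = bform M f g - bform M f g'.
Proof. by rewrite bformC bformBl -!(bformC M). Qed.

Lemma bform_linear1 M f g : bform M f g = \sum_x f x * \sum_y g y * M x y.
Proof.
apply: eq_bigr => x _; rewrite big_distrr/=.
by apply: eq_bigr => y _; rewrite mulrA.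
Qed.

(** The form is linear in [f], so over the box 0 <= f <= a it is largest when [f] is [a] where its
    coefficient is positive and 0 elsewhere. *)
Let bform_setl M f g a : (forall x, 0 <= f x <= a) ->
  exists S : pred I, bform M f g <= a * bform M (fun x => (S x)%:R) g.
Proof.
move=> f0a; exists (fun x => 0 < \sum_y g y * M x y).
rewrite !bform_linear1 big_distrr/=; apply: ler_sum => x _.
have /andP[f0 fa] := f0a x.
case: ltP => h; first by rewrite mul1r ler_wpM2r// ltW.
by rewrite mul0r mulr0 mulr_ge0_le0.
Qed.

Let bform_sets M f g a b : 0 <= a ->
  (forall x, 0 <= f x <= a) -> (forall x, 0 <= g x <= b) ->
  exists S T : pred I,
    bform M f g <= a * b * bform M (fun x => (S x)%:R) (fun x => (T x)%:R).
Proof.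
move=> a0 f0a g0b; have [S leS] := bform_setl M g f0a.
have [T leT] := bform_setl (fun x y => M y x) (fun x => (S x)%:R) g0b.
exists S, T; apply: (le_trans leS).
by rewrite -mulrA ler_wpM2l// bformC (bformC M).
Qed.

(** The cut norm, with sets as boolean predicates; any weights of the points are already contained
    in [M]. *)
Definition cut_le M (e : R) := forall S T : pred I,
  `|bform M (fun x => (S x)%:R) (fun x => (T x)%:R)| <= e.

Lemma cut_le_nneg M e f g a b : cut_le M e -> 0 <= a -> 0 <= b ->
  (forall x, 0 <= f x <= a) -> (forall x, 0 <= g x <= b) ->
  `|bform M f g| <= a * b * e.
Proof.
move=> cM a0 b0 f0a g0b; rewrite ler_norml lerNl -bformN; apply/andP; split.
  have [S [T /le_trans]] := bform_sets (fun x y => - M x y) a0 f0a g0b.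
  apply; apply: ler_wpM2l; rewrite ?mulr_ge0// bformN lerNl.
  by have := cM S T; rewrite ler_norml => /andP[].
have [S [T /le_trans]] := bform_sets M a0 f0a g0b.
apply; apply: ler_wpM2l; rewrite ?mulr_ge0//.
by have := cM S T; rewrite ler_norml => /andP[].
Qed.

(** Positive and negative parts split the form into four forms with nonnegative arguments; hence the
    factor 4, which is that of part (a). *)
Lemma cut_le_norm M e f g a b : cut_le M e -> 0 <= a -> 0 <= b ->
  (forall x, `|f x| <= a) -> (forall x, `|g x| <= b) ->
  `|bform M f g| <= 4 * (a * b) * e.
Proof.
move=> cM a0 b0 fa gb.
have split_abs (h : I -> R) c : 0 <= c -> (forall x, `|h x| <= c) ->
    exists h1 h2, [/\ h = (fun x => h1 x - h2 x), forall x, 0 <= h1 x <= c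
      & forall x, 0 <= h2 x <= c].
  move=> c0 hc; exists (fun x => Num.max (h x) 0), (fun x => Num.max (- h x) 0).
  split=> [|x|x]; [apply/funext => x| |].
  - by case: (leP (h x) 0) => ?; case: (leP (- h x) 0) => ?; lra.
  - by have := hc x; rewrite ler_norml; case: (leP (h x) 0) => ? /andP[]; lra.
  - by have := hc x; rewrite ler_norml; case: (leP (-h x) 0) => ? /andP[]; lra.
have [f1 [f2 [-> f1a f2a]]] := split_abs f a a0 fa.
have [g1 [g2 [-> g1b g2b]]] := split_abs g b b0 gb.
rewrite bformBl !bformBr.
have h11 := cut_le_nneg cM a0 b0 f1a g1b.
have h12 := cut_le_nneg cM a0 b0 f1a g2b.
have h21 := cut_le_nneg cM a0 b0 f2a g1b.
have h22 := cut_le_nneg cM a0 b0 f2a g2b.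
move: h11 h12 h21 h22; rewrite !ler_norml => /andP[? ?] /andP[? ?] /andP[? ?].
by move=> /andP[? ?]; apply/andP; split; lra.
Qed.

End bilinear.

Lemma norm_prod_le {R : realType} (T : eqType) (l : seq T) (P : pred T)
    (u : T -> R) C :
  (forall e, e \in l -> `|u e| <= C) ->
  `|\prod_(e <- l | P e) u e| <= C ^+ count P l.
Proof.
elim: l => [|e l IHl] uC; first by rewrite big_nil normr1.
have {}IHl : `|\prod_(e <- l | P e) u e| <= C ^+ count P l.
  by apply: IHl => e' e'l; apply: uC; rewrite inE e'l orbT.
rewrite big_cons/=; case: ifP => // _; rewrite add1n exprS normrM.
by apply: ler_pM => //; apply: uC; rewrite inE eqxx.
Qed.

Section finite_counting.
Context {R : realType} {K V : finType}.
Variables (m : K -> R) (C : R).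
Hypothesis m_ge0 : forall x, 0 <= m x.
Hypothesis m_sum1 : \sum_x m x = 1.
Hypothesis C_ge0 : 0 <= C.
Implicit Types (a b : K -> K -> R) (l : seq (V * V)).

Let E := @Ex R V K (fun=> m).

Definition touches (i : V) (e : V * V) := (i == e.1) || (i == e.2).

Definition wcut_le a e := cut_le (fun x y => m x * m y * a x y) e.

Lemma counting_step (a : K -> K -> R) e (u : V * V -> K -> K -> R) l i j :
  wcut_le a e -> (forall e' x y, e' \in l -> `|u e' x y| <= C) -> i != j ->
  (forall e', e' \in l -> ~~ (touches i e' && touches j e')) ->
  `|E (fun X => a (X i) (X j) * \prod_(e' <- l) u e' (X e'.1) (X e'.2))|
    <= 4 * C ^+ size l * e.
Proof.
move=> ae uC ij lij; rewrite /E (Ex_resample (fun=> m_sum1) j).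
rewrite (Ex_resample (fun=> m_sum1) i).
rewrite -[leRHS](@Ex_const R V K (fun=> m) (fun=> m_sum1)).
apply: (le_trans (Ex_norm _ _)) => //; apply: Ex_ler => // X.
(* [f] collects the edges at [i], [g] all others, among them those that avoid both points. As no
   edge touches both [i] and [j], [f] does not see the point at [j] and [g] does not see the one at
   [i]. *)
pose f y := \prod_(e' <- l | touches i e') u e' (upd X i y e'.1) (upd X i y e'.2).
pose g z := \prod_(e' <- l | ~~ touches i e')
  u e' (upd X j z e'.1) (upd X j z e'.2).
rewrite (_ : \sum_y _ = bform (fun x y => m x * m y * a x y) f g); last first.
  apply: eq_bigr => y _; rewrite big_distrr/=; apply: eq_bigr => z _.
  rewrite (bigID (touches i))/=.
  rewrite {1 2}/upd eqxx (negbTE ij) {1}/upd eqxx.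
  have -> : \prod_(e' <- l | touches i e') u e' (upd (upd X i y) j z e'.1)
      (upd (upd X i y) j z e'.2) = f y.
    rewrite /f big_seq_cond [RHS]big_seq_cond; apply: eq_bigr => e' /andP[/lij].
    rewrite negb_and /touches => h ti; rewrite ti/= negb_or in h.
    case/andP: h => j1 j2; rewrite /upd ![_ == j]eq_sym.
    by rewrite (negbTE j1) (negbTE j2).
  have -> : \prod_(e' <- l | ~~ touches i e') u e' (upd (upd X i y) j z e'.1)
      (upd (upd X i y) j z e'.2) = g z.
    apply: eq_bigr => e'; rewrite negb_or => /andP[i1 i2]; rewrite /upd.
    by rewrite ![_ == i]eq_sym (negbTE i1) (negbTE i2).
  by ring.
have -> : C ^+ size l = C ^+ count (touches i) l * C ^+ count (predC (touches i)) l.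
  by rewrite -exprD count_predC.
apply: cut_le_norm; rewrite ?exprn_ge0// => x; apply: norm_prod_le => e' el;
  exact: uC.
Qed.

Definition wdensity (l : seq (V * V)) a :=
  E (fun X => \prod_(e <- l) a (X e.1) (X e.2)).

Lemma finite_counting a b e l :
  wcut_le (fun x y => a x y - b x y) e ->
  (forall x y, `|a x y| <= C) -> (forall x y, `|b x y| <= C) ->
  uniq l -> {in l, forall ij, ij.1 != ij.2} ->
  {in l &, forall ij ij', touches ij.1 ij' -> touches ij.2 ij' -> ij = ij'} ->
  `|wdensity l a - wdensity l b| <= 4 * (size l)%:R * C ^+ (size l - 1) * e.
Proof.
move=> abe aC bC.
have e0 : 0 <= e by apply: le_trans (abe pred0 pred0).
(* Hybrid products for the induction: the edges of [l] still carry [a], those of [r] already carry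
   [b], and the head of [l] moves to [r]. *)
suff H : forall r, uniq (l ++ r) -> {in l, forall ij, ij.1 != ij.2} ->
  {in l ++ r &, forall ij ij', touches ij.1 ij' -> touches ij.2 ij' -> ij = ij'} ->
  `|E (fun X => (\prod_(e <- l) a (X e.1) (X e.2)) *
                \prod_(e <- r) b (X e.1) (X e.2)) - wdensity (l ++ r) b| <=
   4 * (size l)%:R * C ^+ (size l + size r - 1) * e.
  move=> ul lne lsep; have := H [::]; rewrite cats0 addn0 => /(_ ul lne lsep).
  rewrite (_ : E _ = wdensity l a)//.
  by apply: Ex_eq => X; rewrite big_nil mulr1.
elim: l => [|[i j] l IHl] r ulr lne lsep.
  rewrite /= /wdensity (_ : E _ = E (fun X => \prod_(e <- r) b (X e.1) (X e.2))).
    by rewrite subrr normr0 mulr0 !mul0r.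
  by apply: Ex_eq => X; rewrite big_nil mul1r.
have perm : perm_eq (l ++ (i, j) :: r) (((i, j) :: l) ++ r).
  by rewrite -cat1s perm_catCA.
have memP := perm_mem perm.
have {}IHl : `|E (fun X => (\prod_(e <- l) a (X e.1) (X e.2)) *
    \prod_(e <- (i, j) :: r) b (X e.1) (X e.2)) - wdensity ((i, j) :: l ++ r) b|
    <= 4 * (size l)%:R * C ^+ (size l + size r) * e.
  have -> : wdensity ((i, j) :: l ++ r) b = wdensity (l ++ (i, j) :: r) b.
    by apply: Ex_eq => X; apply: perm_big; rewrite perm_sym.
  have := IHl ((i, j) :: r).
  rewrite /= addnS subn1/=; apply.
  - by rewrite (perm_uniq perm).
  - by move=> ij ijl; apply: lne; rewrite inE ijl orbT.
  - by move=> x y; rewrite !memP; exact: lsep.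
have step : `|E (fun X => (\prod_(e <- (i, j) :: l) a (X e.1) (X e.2)) *
      \prod_(e <- r) b (X e.1) (X e.2)) -
    E (fun X => (\prod_(e <- l) a (X e.1) (X e.2)) *
    \prod_(e <- (i, j) :: r) b (X e.1) (X e.2))| <=
    4 * C ^+ (size l + size r) * e.
  pose u (e' : V * V) := if e' \in l then a else b.
  have Eu : E (fun X => (\prod_(e <- (i, j) :: l) a (X e.1) (X e.2)) *
        \prod_(e <- r) b (X e.1) (X e.2)) -
      E (fun X => (\prod_(e <- l) a (X e.1) (X e.2)) *
        \prod_(e <- (i, j) :: r) b (X e.1) (X e.2)) =
      E (fun X => (a (X i) (X j) - b (X i) (X j)) *
        \prod_(e' <- l ++ r) u e' (X e'.1) (X e'.2)).
    rewrite -[- E _]mulN1r /E -ExZ -ExD; apply: Ex_eq => X.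
    rewrite !big_cons big_cat/=.
    rewrite [in RHS](eq_big_seq (fun e' => a (X e'.1) (X e'.2))).
      rewrite [X in _ = _ * (_ * X)](eq_big_seq (fun e' => b (X e'.1) (X e'.2))).
        by ring.
      move=> e' e'r; rewrite /u; case: ifP => // e'l.
      move: ulr; rewrite /= cat_uniq => /andP[_] /and3P[_ /hasPn/(_ _ e'r)].
      by rewrite e'l.
    by move=> e' e'l; rewrite /u e'l.
  rewrite Eu -size_cat.
  apply: (@counting_step (fun x y => a x y - b x y)) => //.
  - by move=> e' x y _; rewrite /u; case: ifP.
  - by have := lne (i, j); rewrite inE eqxx; apply.
  - move=> e' e'lr; apply/negP => /andP[ti tj].
    have := lsep (i, j) e'; rewrite /= !inE eqxx e'lr orbT => /(_ isT isT ti tj) ije'.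
    by move: ulr; rewrite /= ije' e'lr.
have := ler_normD (E (fun X => (\prod_(e <- (i, j) :: l) a (X e.1) (X e.2)) *
      \prod_(e <- r) b (X e.1) (X e.2)) -
    E (fun X => (\prod_(e <- l) a (X e.1) (X e.2)) *
    \prod_(e <- (i, j) :: r) b (X e.1) (X e.2))) (E (fun X => (\prod_(e <- l) a (X e.1) (X e.2)) *
    \prod_(e <- (i, j) :: r) b (X e.1) (X e.2)) - wdensity ((i, j) :: l ++ r) b).
rewrite addrA subrK => /le_trans; apply.
apply: (le_trans (lerD step IHl)).
by rewrite /= addSn subn1/= -natr1; lra.
Qed.
End finite_counting.

(** * Weak regularity and sampling *)

Section weak_regularity.
Context {R : realType} {I : finType}.
Variable p : I -> R.
Hypothesis p_ge0 : forall x, 0 <= p x.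
Hypothesis p_sum1 : \sum_x p x = 1.
Implicit Types (f w : I -> I -> R).

Lemma sqr_mean_le (a : I -> R) : (\sum_x p x * a x) ^+ 2 <= \sum_x p x * a x ^+ 2.
Proof.
set m := \sum_x p x * a x.
have : 0 <= \sum_x p x * (a x - m) ^+ 2.
  by apply: sumr_ge0 => x _; rewrite mulr_ge0// sqr_ge0.
rewrite (eq_bigr (fun x => p x * a x ^+ 2 + (- (2 * m) * (p x * a x) + m ^+ 2 * p x))).
  by rewrite big_split big_split/= -!big_distrr/= -/m p_sum1; lra.
by move=> x _; ring.
Qed.

Definition mean2 f : R := \sum_x p x * \sum_y p y * f x y.

Lemma mean2_sqr_le f : mean2 f ^+ 2 <= mean2 (fun x y => f x y ^+ 2).
Proof.
apply: (le_trans (sqr_mean_le _)); apply: ler_sum => x _.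
by apply: ler_wpM2l => //; exact: sqr_mean_le.
Qed.

Lemma mean2D f g : mean2 (fun x y => f x y + g x y) = mean2 f + mean2 g.
Proof.
rewrite /mean2 -big_split/=; apply: eq_bigr => x _; rewrite -mulrDr -big_split/=.
by congr (_ * _); apply: eq_bigr => y _; rewrite mulrDr.
Qed.

Lemma mean2Z a f : mean2 (fun x y => a * f x y) = a * mean2 f.
Proof.
rewrite /mean2 big_distrr/=; apply: eq_bigr => x _; rewrite [RHS]mulrCA.
by congr (_ * _); rewrite big_distrr/=; apply: eq_bigr => y _; rewrite mulrCA.
Qed.

Lemma eq_mean2 f g : (forall x y, f x y = g x y) -> mean2 f = mean2 g.
Proof.
by move=> fg; apply: eq_bigr => x _; congr (_ * _); apply: eq_bigr => y _; rewrite fg.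
Qed.

Lemma mean2_le f g : (forall x y, f x y <= g x y) -> mean2 f <= mean2 g.
Proof.
by move=> fg; do 2!(apply: ler_sum => ? _; apply: ler_wpM2l => //).
Qed.

Lemma mean2_const a : mean2 (fun _ _ => a) = a.
Proof. by rewrite /mean2 -big_distrl/= p_sum1 mul1r -big_distrl/= p_sum1 mul1r. Qed.

Lemma mean2_bform f (g h : I -> R) :
  mean2 (fun x y => f x y * (g x * h y)) = bform (fun x y => p x * p y * f x y) g h.
Proof.
apply: eq_bigr => x _; rewrite big_distrr/=; apply: eq_bigr => y _.
by ring.
Qed.

Section averages.
Context {J : finType}.
Variables (c : I -> J) (w : I -> I -> R).

Definition mass (j : J) : R := \sum_(x | c x == j) p x.

(** For a null cell the convention x / 0 = 0 gives the average 0; [cell_avgK] remains true because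
    [p] vanishes on that cell. *)
Definition cell_avg (j j' : J) : R :=
  (\sum_(x | c x == j) p x * \sum_(y | c y == j') p y * w x y) /
  (mass j * mass j').

Lemma mass_ge0 j : 0 <= mass j.
Proof. exact: sumr_ge0. Qed.

Lemma mass_eq0 x : mass (c x) = 0 -> p x = 0.
Proof.
move=> /eqP; rewrite psumr_eq0// => /allP/(_ x).
by rewrite mem_index_enum eqxx => /(_ isT)/eqP.
Qed.

Lemma sum_mass : \sum_j mass j = 1.
Proof. by rewrite -p_sum1 (partition_big c predT). Qed.

Lemma cell_avgK j j' : cell_avg j j' * (mass j * mass j') =
  \sum_(x | c x == j) p x * \sum_(y | c y == j') p y * w x y.
Proof.
have [/eqP|] := eqVneq (mass j * mass j') 0; last by move=> ?; rewrite divfK.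
rewrite mulf_eq0 => /orP[] /eqP m0; rewrite m0 ?mul0r ?mulr0.
  by rewrite big1// => x /eqP cx; rewrite (@mass_eq0 x) ?cx// mul0r.
rewrite big1// => x _; rewrite big1 ?mulr0// => y /eqP cy.
by rewrite (@mass_eq0 y) ?cy// mul0r.
Qed.

Lemma cell_avg_le a : 0 <= a -> (forall x y, `|w x y| <= a) ->
  forall j j', `|cell_avg j j'| <= a.
Proof.
move=> a0 wa j j'; rewrite normrM normfV (ger0_norm (mulr_ge0 _ _)) ?mass_ge0//.
have [->|m0] := eqVneq (mass j * mass j') 0; first by rewrite invr0 mulr0.
rewrite ler_pdivrMr ?lt_neqAle ?(eq_sym 0) ?m0 ?mulr_ge0 ?mass_ge0//.
apply: (le_trans (ler_norm_sum _ _ _)).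
rewrite /mass mulrCA big_distrl/=; apply: ler_sum => x _.
rewrite normrM ger0_norm// ler_wpM2l// mulrC big_distrl/=.
apply: (le_trans (ler_norm_sum _ _ _)); apply: ler_sum => y _.
by rewrite normrM ger0_norm// ler_wpM2l.
Qed.

Definition residual x y : R := w x y - cell_avg (c x) (c y).

(** [cell_avg] is a conditional expectation, that is, the orthogonal projection onto the functions
    constant on products of cells; on each such product the residual has integral zero. *)
Lemma residual_ortho (h : J -> J -> R) :
  mean2 (fun x y => residual x y * h (c x) (c y)) = 0.
Proof.
rewrite /mean2 (partition_big c predT)//= big1// => j _.
transitivity (\sum_j' \sum_(x | c x == j) p x *
    \sum_(y | c y == j') p y * (residual x y * h (c x) (c y))).
  rewrite exchange_big/=; apply: eq_bigr => x _.
  by rewrite -big_distrr/= (partition_big c predT).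
rewrite big1// => j' _.
have := cell_avgK j j'.
set s := \sum_(x | _) _ => sE.
transitivity (h j j' * (s - cell_avg j j' * (mass j * mass j'))); last first.
  by rewrite sE subrr mulr0.
rewrite {1}/mass mulrCA big_distrl/= /s -sumrB big_distrr/=.
apply: eq_bigr => x /eqP cx; rewrite -mulrBr mulrCA; congr (_ * _).
rewrite mulrC [X in _ - X]mulrC /mass big_distrl/= -sumrB big_distrl/=.
apply: eq_bigr => y /eqP cy; rewrite /residual cx cy; ring.
Qed.

Definition energy : R := mean2 (fun x y => cell_avg (c x) (c y) ^+ 2).

End averages.

(** Pythagoras: refining raises the energy by the squared norm of [D], the difference of the two
    projections. The indicator of S x T is constant on the finer cells, so [D] and the residual have
    the same integral against it, and Jensen's inequality bounds the gain from below. *)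
Lemma energy_refine (J J' : finType) (c : I -> J) (c' : I -> J') (rho : J' -> J)
    (S T : pred J') w : (forall x, c x = rho (c' x)) ->
  energy c w + bform (fun x y => p x * p y * residual c w x y)
     (fun x => (S (c' x))%:R) (fun y => (T (c' y))%:R) ^+ 2 <= energy c' w.
Proof.
move=> crho.
pose D x y := cell_avg c' w (c' x) (c' y) - cell_avg c w (c x) (c y).
have -> : energy c' w = energy c w + mean2 (fun x y => D x y ^+ 2).
  have o1 := residual_ortho c' w (fun j j' => cell_avg c w (rho j) (rho j')).
  have o2 := residual_ortho c w (fun j j' => cell_avg c w j j').
  transitivity (energy c w + mean2 (fun x y => D x y ^+ 2) +
    (2 * mean2 (fun x y => residual c w x y * cell_avg c w (c x) (c y)) +
     (- 2) * mean2 (fun x y => residual c' w x y *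
       cell_avg c w (rho (c' x)) (rho (c' y))))); last first.
    by rewrite o1 o2 !mulr0 !addr0.
  rewrite -!mean2Z /energy -!mean2D.
  by apply: eq_mean2 => x y; rewrite /D /residual !crho; ring.
rewrite lerD2l -mean2_bform.
have -> : mean2 (fun x y => residual c w x y * ((S (c' x))%:R * (T (c' y))%:R)) =
    mean2 (fun x y => D x y * ((S (c' x))%:R * (T (c' y))%:R)).
  have o1 := residual_ortho c' w (fun j j' => (S j)%:R * (T j')%:R).
  rewrite -[RHS]addr0 -o1 -mean2D.
  by apply: eq_mean2 => x y; rewrite /D /residual; ring.
apply: (le_trans (mean2_sqr_le _)); apply: mean2_le => x y.
rewrite exprMn ler_piMr ?sqr_ge0// exprMn.
by rewrite -!natrX -natrM lern1; case: (S _); case: (T _).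
Qed.

(** Energy increment: a pair S, T that violates the bound cuts every cell into four and raises the
    energy by more than 1/n. Since the energy never exceeds 1, this cannot happen n + 1 times. *)
Lemma weak_regularity w n : (0 < n)%N -> (forall x y, `|w x y| <= 1) ->
  exists (J : finType) (c : I -> J), (#|J| <= 4 ^ n)%N /\
    forall e, 0 <= e -> 1 <= n%:R * e ^+ 2 -> wcut_le p (residual c w) e.
Proof.
move=> n0 w1.
have en_le1 (J : finType) (c : I -> J) : energy c w <= 1.
  rewrite -(mean2_const 1); apply: mean2_le => x y.
  have := cell_avg_le c ler01 w1 (c x) (c y); rewrite ler_norml => /andP[? ?].
  by nra.
have [//|bad] := pselect (exists (J : finType) (c : I -> J), (#|J| <= 4 ^ n)%N /\
    forall e, 0 <= e -> 1 <= n%:R * e ^+ 2 -> wcut_le p (residual c w) e).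
exfalso.
have n0R : 0 < n%:R :> R by rewrite ltr0n.
have step (J : finType) (c : I -> J) : (#|J| <= 4 ^ n)%N ->
    exists (J' : finType) (c' : I -> J'),
      #|J'| = (4 * #|J|)%N /\ energy c w + n%:R^-1 < energy c' w.
  move=> Jn; apply: contrapT => no; apply: bad; exists J, c; split => // e e0 ne S T.
  rewrite leNgt; apply/negP => lt; apply: no.
  exists (J * (bool * bool))%type, (fun x => (c x, (S x, T x))).
  split; first by rewrite !card_prod card_bool mulnC.
  have := @energy_refine J _ c (fun x => (c x, (S x, T x))) fst
    (fun z => z.2.1) (fun z => z.2.2) w (fun=> erefl).
  apply: lt_le_trans; rewrite ltrD2l.
  rewrite -(ltr_pM2l n0R) mulfV ?gt_eqF//.
  apply: le_lt_trans ne _; rewrite ltr_pM2l//.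
  by rewrite -[ltRHS]real_normK ?num_real// ltrXn2r// ?nnegrE.
have climb j : (j <= n)%N -> exists (J : finType) (c : I -> J),
    (#|J| <= 4 ^ j)%N /\ j%:R / n%:R <= energy c w.
  elim: j => [_|j IHj jn].
    exists unit, (fun=> tt); rewrite card_unit mul0r; split => //.
    by rewrite -(mean2_const 0); apply: mean2_le => x y; rewrite sqr_ge0.
  have [J [c [Jj ec]]] := IHj (ltnW jn).
  have [|J' [c' [J'E ec']]] := step J c.
    by apply: (leq_trans Jj); rewrite leq_exp2l// ltnW.
  exists J', c'; rewrite J'E expnS leq_mul2l Jj; split => //.
  by rewrite -addn1 natrD mulrDl mul1r; apply/ltW/(le_lt_trans _ ec'); rewrite lerD2r.
have [J [c [Jn ec]]] := climb n (leqnn n).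
have [J' [c' [_]]] := step J c Jn.
apply/negP; rewrite -leNgt; apply: (le_trans (en_le1 _ c')).
rewrite divff ?gt_eqF// in ec; apply: (le_trans ec).
by rewrite lerDl invr_ge0 ltW.
Qed.

End weak_regularity.

Section variance.
Context {R : realType} {K I : finType}.
Variable p : I -> R.
Hypothesis p_sum1 : \sum_x p x = 1.

Lemma variance_sum_le (f : I -> R) :
  Ex (fun _ : K => p) (fun X => (\sum_a (f (X a) - \sum_x p x * f x)) ^+ 2) <=
  #|K|%:R * \sum_x p x * f x ^+ 2.
Proof.
set mu := \sum_x p x * f x.
rewrite (@Ex_eq _ _ _ _ _
  (fun X => \sum_a \sum_b (f (X a) - mu) * (f (X b) - mu))); last first.
  by move=> X; rewrite expr2 big_distrlr.
rewrite Ex_sum -sum1_card natr_sum big_distrl/=; apply: ler_sum => a _.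
rewrite Ex_sum (bigD1 a)//= [X in _ + X]big1 ?addr0 ?mul1r; last first.
  move=> b /negbTE ba; apply: (Ex_ortho (fun=> p_sum1) (i := b)) => X.
  rewrite /upd eqxx eq_sym ba.
  rewrite (eq_bigr (fun y => (f (X a) - mu) * (p y * f y) +
     (- (f (X a) - mu) * mu) * p y)); last by move=> y _; ring.
  by rewrite big_split/= -!big_distrr/= p_sum1 -/mu; ring.
rewrite (Ex_coord (fun=> p_sum1) a (fun x => (f x - mu) * (f x - mu))).
rewrite (eq_bigr (fun x => p x * f x ^+ 2 + (- (2 * mu) * (p x * f x) + mu ^+ 2 * p x))).
  rewrite big_split big_split/= -!big_distrr/= -/mu p_sum1.
  by rewrite gerDl; have := sqr_ge0 mu; nra.
by move=> x _; ring.
Qed.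

End variance.

Section sampled_rows.
Context {R : realType} {V : finType}.
Hypothesis V_gt0 : (0 < #|V|)%N.
Variables (B s : R) (q : nat).
Hypothesis s_gt0 : 0 < s.
Hypothesis q_gt0 : (0 < q)%N.
Hypothesis Bqs : B ^+ 2 <= q%:R * s ^+ 2.

Definition unif (_ : V) : R := #|V|%:R^-1.

Lemma unif_ge0 x : 0 <= unif x.
Proof. by rewrite invr_ge0 ler0n. Qed.

Lemma unif_sum1 : \sum_x unif x = 1.
Proof. by rewrite sumr_const -[RHS](@mulVf _ #|V|%:R) ?mulr_natr// pnatr_eq0 -lt0n. Qed.

Definition ubform (A : V -> V -> R) (S T : pred V) : R :=
  bform (fun i j => unif i * unif j * A i j) (fun i => (S i)%:R) (fun j => (T j)%:R).

(** [Q] lists q sampled columns and [r] guesses which of them belong to the column set. Whatever the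
    size of [V], each [Q] yields at most 2^q row sets; this makes a union bound affordable. *)
Definition good_rows (A : V -> V -> R) (Q : 'I_q -> V) (r : {ffun 'I_q -> bool}) : pred V :=
  fun i => 0 < \sum_a (r a)%:R * A i (Q a).

Let Eu := @Ex R 'I_q V (fun=> unif).

(* The best rows against a set T of columns are those with a positive sum over
   T, and this sum is estimated from the sampled columns that lie in T. *)
Lemma good_rows_le A (S T : pred V) : (forall i j, `|A i j| <= B) ->
  ubform A S T <= Eu (fun Q => ubform A (good_rows A Q [ffun a => T (Q a)]) T) + s.
Proof.
move=> AB; rewrite -lerBlDl.
(* [alpha] is the true row sum over [T] and [beta] its estimate from the sample; choosing a row by
   the sign of [beta] loses at most |alpha - beta| in that row. *)
pose alpha i := \sum_j unif j * ((T j)%:R * A i j).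
pose beta (Q : 'I_q -> V) i := q%:R^-1 * \sum_a (T (Q a))%:R * A i (Q a).
have ubE S' : ubform A S' T = \sum_i unif i * ((S' i)%:R * alpha i).
  rewrite /ubform bform_linear1; apply: eq_bigr => i _.
  rewrite mulrCA; congr (_ * _); rewrite /alpha big_distrr/=; apply: eq_bigr => j _.
  by ring.
have qR : 0 < q%:R :> R by rewrite ltr0n.
have dev i : Eu (fun Q => `|alpha i - beta Q i|) <= s.
  (* Young's inequality replaces the root of the variance; it is balanced at the target deviation
     [s]. *)
  have le Q : `|alpha i - beta Q i| <= (2 * s)^-1 * (alpha i - beta Q i) ^+ 2 + s / 2.
    set z := _ - _; rewrite -[z ^+ 2]real_normK ?num_real//.
    have [y0] : 0 <= `|z| by []. move: `|z| => y.
    rewrite -(ler_pM2l (_ : 0 < 2 * s)) ?mulr_gt0// mulrDr mulVKf ?gt_eqF ?mulr_gt0//.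
    by have := sqr_ge0 (y - s); nra.
  apply: (le_trans (Ex_ler (fun _ => unif_ge0) le)).
  rewrite ExD (Ex_const (fun=> unif_sum1)) ExZ.
  suff H : Eu (fun Q => (alpha i - beta Q i) ^+ 2) <= s ^+ 2.
    apply: (@le_trans _ _ ((2 * s)^-1 * s ^+ 2 + s / 2)).
      by rewrite lerD2r ler_wpM2l// invr_ge0 mulr_ge0// ltW.
    by rewrite le_eqVlt; apply/orP; left; apply/eqP; field; rewrite gt_eqF.
  have := variance_sum_le (K := 'I_q) unif_sum1 (fun j => (T j)%:R * A i j).
  rewrite -/(alpha i) card_ord => var.
  have -> : Eu (fun Q => (alpha i - beta Q i) ^+ 2) = (q%:R ^+ 2)^-1 * Eu (fun Q =>
      (\sum_a ((T (Q a))%:R * A i (Q a) - alpha i)) ^+ 2).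
    rewrite -ExZ; apply: Ex_eq => Q.
    rewrite big_split/= sumr_const card_ord -mulr_natl /beta.
    by field; rewrite gt_eqF.
  rewrite ler_pdivrMl ?exprn_gt0//; apply: (le_trans var).
  rewrite expr2 -!mulrA ler_pM2l//; apply: le_trans Bqs.
  rewrite [leRHS](_ : _ = \sum_j unif j * B ^+ 2); last first.
    by rewrite -big_distrl/= unif_sum1 mul1r.
  apply: ler_sum => j _.
  apply: ler_wpM2l; first exact: unif_ge0.
  have := AB i j; rewrite ler_norml => /andP[? ?].
  by case: (T j); rewrite /= ?mul1r ?mul0r; nra.
rewrite -(Ex_const (fun _ : 'I_q => unif_sum1) (ubform A S T)) -/Eu.
rewrite lerBlDl (_ : s = \sum_i unif i * s); last first.
  by rewrite -big_distrl/= unif_sum1 mul1r.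
rewrite (@le_trans _ _ (Eu (fun Q => ubform A (good_rows A Q [ffun a => T (Q a)]) T +
    \sum_i unif i * `|alpha i - beta Q i|)))//; last first.
  rewrite /Eu ExD lerD2l Ex_sum; apply: ler_sum => i _.
  by rewrite ExZ ler_wpM2l// unif_ge0.
apply: Ex_ler => [_|Q]; first exact: unif_ge0.
rewrite !ubE -big_split/=; apply: ler_sum => i _; rewrite -mulrDr.
apply: ler_wpM2l; first exact: unif_ge0.
have -> : good_rows A Q [ffun a => T (Q a)] i = (0 < beta Q i).
  rewrite /beta pmulr_rgt0 ?invr_gt0// /good_rows.
  by congr (_ < _); apply: eq_bigr => a _; rewrite ffunE.
have := ler_norm (alpha i - beta Q i); have := ler_norm (- (alpha i - beta Q i)).
rewrite normrN; case: ltP => b0; case: (S i); rewrite ?mul1r ?mul0r ?add0r => *; lra.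
Qed.

End sampled_rows.

Section sampled_cut.
Context {R : realType} {V : finType}.
Hypothesis V_gt0 : (0 < #|V|)%N.
Variables (B s : R) (q : nat).
Hypothesis s_gt0 : 0 < s.
Hypothesis q_gt0 : (0 < q)%N.
Hypothesis Bqs : B ^+ 2 <= q%:R * s ^+ 2.

Let Eu := @Ex R 'I_q V (fun=> unif).

(** [good_rows_le] is applied to the rows against [T], then to the columns against the row set just
    found. The bound [G] is uniform in the guesses [r] and [r'], so [S] and [T] disappear from the
    right-hand side. *)
Lemma ubform_sampled (A : V -> V -> R) (S T : pred V)
    (G : ('I_q -> V) -> ('I_q -> V) -> R) : (forall i j, `|A i j| <= B) ->
  (forall Q Q' r r', ubform A (good_rows A Q r)
     (good_rows (fun i j => A j i) Q' r') <= G Q Q') ->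
  ubform A S T <= Eu (fun Q => Eu (G Q)) + 2 * s.
Proof.
move=> AB AG.
have le1 := good_rows_le V_gt0 s_gt0 q_gt0 Bqs S T AB.
apply: (le_trans le1); rewrite mulr_natl mulr2n addrA lerD2r.
rewrite -(Ex_const (fun _ : 'I_q => @unif_sum1 R _ V_gt0) s) -ExD.
apply: Ex_ler => [_|Q]; first exact: unif_ge0.
set S' := good_rows _ _ _.
have ubC (S1 T1 : pred V) : ubform (fun i j => A j i) T1 S1 = ubform A S1 T1.
  rewrite /ubform bformC; apply: eq_bigr => i _; apply: eq_bigr => j _.
  by rewrite [unif i * _]mulrC.
have AB' i j : `|A j i| <= B by exact: AB.
have := good_rows_le V_gt0 s_gt0 q_gt0 Bqs T S' AB'.
rewrite ubC => /le_trans; apply; rewrite lerD2r.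
by apply: Ex_ler => [_|Q']; [exact: unif_ge0|rewrite ubC; exact: AG].
Qed.

End sampled_cut.

Section average.
Context {R : realType} {V : finType}.
Hypothesis V_gt0 : (0 < #|V|)%N.
Implicit Types F G : V -> R.

Definition avg F : R := \sum_i unif i * F i.

Lemma avgD F G : avg (fun i => F i + G i) = avg F + avg G.
Proof. by rewrite /avg -big_split; apply: eq_bigr => i _; rewrite mulrDr. Qed.

Lemma avgZ a F : avg (fun i => a * F i) = a * avg F.
Proof. by rewrite /avg big_distrr; apply: eq_bigr => i _; rewrite /= mulrCA. Qed.

Lemma avgZr a F : avg (fun i => F i * a) = avg F * a.
Proof. by rewrite /avg big_distrl; apply: eq_bigr => i _; rewrite /= mulrA. Qed.

Lemma avg_const a : avg (fun=> a) = a.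
Proof. by rewrite /avg -big_distrl/= unif_sum1// mul1r. Qed.

Lemma avg_le F G : (forall i, F i <= G i) -> avg F <= avg G.
Proof. by move=> FG; apply: ler_sum => i _; rewrite ler_wpM2l// unif_ge0. Qed.

Lemma avg_eq F G : F =1 G -> avg F = avg G.
Proof. by move=> FG; apply: eq_bigr => i _; rewrite FG. Qed.

Lemma avg_pick (x : V) : avg (fun i => (i == x)%:R) = #|V|%:R^-1.
Proof.
rewrite /avg (bigD1 x)//= eqxx mulr1 big1 ?addr0// => i /negbTE ->.
by rewrite mulr0.
Qed.

Lemma avg_sum (T : finType) (F : T -> V -> R) :
  avg (fun i => \sum_t F t i) = \sum_t avg (F t).
Proof.
by rewrite /avg exchange_big/=; apply: eq_bigr => i _; rewrite big_distrr.
Qed.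

Definition avg4 (F : V -> V -> V -> V -> R) : R :=
  avg (fun i => avg (fun j => avg (fun i' => avg (fun j' => F i j i' j')))).

Lemma avg4D (F G : V -> V -> V -> V -> R) :
  avg4 (fun i j i' j' => F i j i' j' + G i j i' j') = avg4 F + avg4 G.
Proof.
rewrite /avg4 -avgD; apply: avg_eq => i; rewrite -avgD; apply: avg_eq => j.
by rewrite -avgD; apply: avg_eq => i'; rewrite -avgD.
Qed.

Lemma avg4_sum (T : finType) (F : T -> V -> V -> V -> V -> R) :
  avg4 (fun i j i' j' => \sum_t F t i j i' j') = \sum_t avg4 (F t).
Proof.
rewrite /avg4 -avg_sum; apply: avg_eq => i; rewrite -avg_sum; apply: avg_eq => j.
by rewrite -avg_sum; apply: avg_eq => i'; rewrite -avg_sum.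
Qed.

Lemma avg4Z a (F : V -> V -> V -> V -> R) :
  avg4 (fun i j i' j' => a * F i j i' j') = a * avg4 F.
Proof.
rewrite /avg4 -avgZ; apply: avg_eq => i; rewrite -avgZ; apply: avg_eq => j.
by rewrite -avgZ; apply: avg_eq => i'; rewrite -avgZ.
Qed.

Lemma avg4_le (F G : V -> V -> V -> V -> R) :
  (forall i j i' j', F i j i' j' <= G i j i' j') -> avg4 F <= avg4 G.
Proof. by move=> FG; do 4!apply: avg_le => ?. Qed.

Lemma avg2_sqr (F : V -> V -> R) :
  avg (fun i => avg (F i)) ^+ 2 = avg4 (fun i j i' j' => F i j * F i' j').
Proof.
rewrite expr2 -avgZr; apply: avg_eq => i; rewrite -avgZr; apply: avg_eq => j.
by rewrite -avgZ; apply: avg_eq => i'; rewrite avgZ.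
Qed.

Lemma Ex_avg (K I : finType) (p : K -> I -> R) (F : V -> (K -> I) -> R) :
  Ex p (fun X => avg (fun i => F i X)) = avg (fun i => Ex p (F i)).
Proof. by rewrite /avg Ex_sum; apply: eq_bigr => i _; rewrite ExZ. Qed.

Lemma Ex_avg4 (K I : finType) (p : K -> I -> R)
    (F : V -> V -> V -> V -> (K -> I) -> R) :
  Ex p (fun X => avg4 (fun i j i' j' => F i j i' j' X)) =
  avg4 (fun i j i' j' => Ex p (F i j i' j')).
Proof.
rewrite /avg4 Ex_avg; apply: avg_eq => i; rewrite Ex_avg; apply: avg_eq => j.
by rewrite Ex_avg; apply: avg_eq => i'; rewrite Ex_avg.
Qed.

Variables (q : nat) (Q Q' : 'I_q -> V).

(* Dominates the indicator of: {i, j} meets {i', j'} or the samples Q, Q', or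
   i = j. *)
Definition collisions (i j i' j' : V) : R :=
  (i == j)%:R + (i == i')%:R + (i == j')%:R + (j == i')%:R + (j == j')%:R +
  \sum_a ((i == Q a)%:R + (i == Q' a)%:R + (j == Q a)%:R + (j == Q' a)%:R).

Lemma avg4_collisions : avg4 collisions = (5 + 4 * q)%:R / #|V|%:R.
Proof.
have pick' (x : V) : avg (fun i => (x == i)%:R) = #|V|%:R^-1.
  by rewrite -(avg_pick x); apply: avg_eq => i; rewrite eq_sym.
have a1 F : avg4 (fun i _ _ _ => F i) = avg F.
  by apply: avg_eq => i; rewrite !avg_const.
have a2 F : avg4 (fun _ j _ _ => F j) = avg F.
  by rewrite /avg4 avg_const; apply: avg_eq => j; rewrite !avg_const.
rewrite /collisions !avg4D avg4_sum.
have -> : avg4 (fun i j _ _ => (i == j)%:R) = #|V|%:R^-1.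
  rewrite -[RHS]avg_const; apply: avg_eq => i; rewrite -(pick' i).
  by apply: avg_eq => j; rewrite !avg_const.
have -> : avg4 (fun i _ i' _ => (i == i')%:R) = #|V|%:R^-1.
  rewrite -[RHS]avg_const; apply: avg_eq => i; rewrite avg_const -(pick' i).
  by apply: avg_eq => j; rewrite !avg_const.
have -> : avg4 (fun i _ _ j' => (i == j')%:R) = #|V|%:R^-1.
  by rewrite -[RHS]avg_const; apply: avg_eq => i; rewrite !avg_const.
have -> : avg4 (fun _ j i' _ => (j == i')%:R) = #|V|%:R^-1.
  rewrite /avg4 avg_const -[RHS]avg_const; apply: avg_eq => j; rewrite -(pick' j).
  by apply: avg_eq => i'; rewrite avg_const.
have -> : avg4 (fun _ j _ j' => (j == j')%:R) = #|V|%:R^-1.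
  rewrite /avg4 avg_const -[RHS]avg_const; apply: avg_eq => j.
  by rewrite avg_const.
rewrite (eq_bigr (fun=> 4 * #|V|%:R^-1)); last first.
  move=> a _; rewrite !avg4D.
  rewrite (a1 (fun i => (i == Q a)%:R)) (a1 (fun i => (i == Q' a)%:R)).
  rewrite (a2 (fun i => (i == Q a)%:R)) (a2 (fun i => (i == Q' a)%:R)).
  by rewrite !avg_pick; ring.
by rewrite sumr_const card_ord natrD natrM -mulr_natl; ring.
Qed.

End average.

Section sampled_deviation.
Context {R : realType} {V I : finType}.
Hypothesis V_gt0 : (0 < #|V|)%N.
Variable p : I -> R.
Hypothesis p_ge0 : forall x, 0 <= p x.
Hypothesis p_sum1 : \sum_x p x = 1.
Variables (U : I -> I -> R) (B : R).
Hypothesis UB : forall x y, `|U x y| <= B.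
Variables (q : nat) (Q Q' : 'I_q -> V) (r r' : {ffun 'I_q -> bool}).
Implicit Type X : V -> I.

Let E := @Ex R V I (fun=> p).

(** The rule of [good_rows], read on [I] instead of [V]. It depends on [X] only at the sampled
    indices [Q], so it is independent of all other points; likewise [colset] and [Q']. *)
Definition rowset X x := 0 < \sum_a (r a)%:R * U x (X (Q a)).
Definition colset X y := 0 < \sum_a (r' a)%:R * U (X (Q' a)) y.

Definition block_mean X : R := bform (fun x y => p x * p y * U x y)
  (fun x => (rowset X x)%:R) (fun y => (colset X y)%:R).

Definition block_dev X x y : R :=
  (rowset X x)%:R * (colset X y)%:R * U x y - block_mean X.

Definition sample_dev X : R :=
  ubform (fun i j => U (X i) (X j)) (fun i => rowset X (X i))
    (fun j => colset X (X j)) - block_mean X.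

Let indic_le (b c : bool) x y : `|b%:R * c%:R * U x y| <= B.
Proof.
have := UB x y; case: b; case: c; rewrite /= ?mulr1 ?mul1r ?mul0r ?mulr0 ?mul0r//.
all: by rewrite normr0; exact: le_trans.
Qed.

Lemma block_meanE X : block_mean X =
  \sum_y p y * \sum_z p z * ((rowset X y)%:R * (colset X z)%:R * U y z).
Proof.
apply: eq_bigr => x _; rewrite big_distrr/=; apply: eq_bigr => y _; ring.
Qed.

Lemma block_dev_le X x y : `|block_dev X x y| <= 2 * B.
Proof.
rewrite (le_trans (ler_normB _ _))// [2 * B]mulr_natl mulr2n lerD//.
rewrite block_meanE -(mean2_const p_sum1 B) (le_trans (ler_norm_sum _ _ _))//.
apply: ler_sum => z _; rewrite normrM ger0_norm// ler_wpM2l//.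
rewrite (le_trans (ler_norm_sum _ _ _))//; apply: ler_sum => t _.
by rewrite normrM ger0_norm// ler_wpM2l.
Qed.

Lemma sample_devE X :
  sample_dev X = avg (fun i => avg (fun j => block_dev X (X i) (X j))).
Proof.
have -> : (fun i => avg (fun j => block_dev X (X i) (X j))) = (fun i =>
    avg (fun j => (rowset X (X i))%:R * (colset X (X j))%:R * U (X i) (X j)) +
    - block_mean X).
  by apply/funext => i; rewrite avgD avg_const.
rewrite avgD avg_const//; congr (_ - _).
apply: eq_bigr => i _; rewrite big_distrr/=; apply: eq_bigr => j _; ring.
Qed.

(** Given the points at the other indices, the row and column sets and [Psi] are fixed while X_i and
    X_j are fresh, and [block_mean] is exactly the mean over two fresh points. *)
Lemma block_dev_ortho (i j : V) (Psi : (V -> I) -> R) : i != j ->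
  (forall a, [/\ Q a != i, Q' a != i, Q a != j & Q' a != j]) ->
  (forall X y z, Psi (upd (upd X i y) j z) = Psi X) ->
  E (fun X => block_dev X (X i) (X j) * Psi X) = 0.
Proof.
move=> ij Qij PsiE.
rewrite /E (Ex_resample (fun=> p_sum1) j) (Ex_resample (fun=> p_sum1) i).
rewrite -[RHS](@Ex_const R V I (fun=> p) (fun=> p_sum1)); apply: Ex_eq => X.
pose Xyz y z := upd (upd X i y) j z.
have rE y z : rowset (Xyz y z) = rowset X.
  apply/funext => x; rewrite /rowset; congr (_ < _); apply: eq_bigr => a _.
  have [/negbTE h1 _ /negbTE h2 _] := Qij a.
  by rewrite /Xyz /upd h1 h2.
have cE y z : colset (Xyz y z) = colset X.
  apply/funext => x; rewrite /colset; congr (_ < _); apply: eq_bigr => a _.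
  have [_ /negbTE h1 _ /negbTE h2] := Qij a.
  by rewrite /Xyz /upd h1 h2.
have mE y z : block_mean (Xyz y z) = block_mean X by rewrite /block_mean rE cE.
transitivity (Psi X * \sum_y p y * \sum_z p z * block_dev X y z).
  rewrite big_distrr/=; apply: eq_bigr => y _; rewrite [RHS]mulrCA; congr (_ * _).
  rewrite big_distrr/=; apply: eq_bigr => z _; rewrite [RHS]mulrCA; congr (_ * _).
  rewrite PsiE -/(Xyz y z) mulrC; congr (_ * _).
  rewrite {1}/block_dev rE cE mE /Xyz /upd eqxx (negbTE ij).
  by rewrite eqxx.
rewrite (_ : \sum_y _ = 0) ?mulr0//.
transitivity (mean2 p (fun y z => (rowset X y)%:R * (colset X z)%:R * U y z
  + (-1) * block_mean X)).
  apply: eq_bigr => y _; congr (_ * _); apply: eq_bigr => z _.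
  by rewrite mulN1r.
by rewrite mean2D mean2_const// {1}/mean2 -block_meanE mulN1r subrr.
Qed.

(** The square is an average over i, j, i', j'. A term vanishes when i and j are distinct and avoid
    i', j' and both samples, while i' and j' may coincide or be sampled; every other term is at most
    (2B)^2, and [collisions] bounds their proportion. *)
Lemma sample_dev_sqr_le :
  E (fun X => sample_dev X ^+ 2) <=
  (2 * B) ^+ 2 * ((5 + 4 * q)%:R / #|V|%:R).
Proof.
have -> : E (fun X => sample_dev X ^+ 2) = avg4 (fun i j i' j' =>
    E (fun X => block_dev X (X i) (X j) * block_dev X (X i') (X j'))).
  by rewrite -Ex_avg4; apply: Ex_eq => X; rewrite sample_devE avg2_sqr.
rewrite -(avg4_collisions V_gt0 Q Q') -avg4Z; apply: avg4_le => i j i' j'.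
have B2 : 0 <= (2 * B) ^+ 2 by rewrite sqr_ge0.
have sum_ge0 : 0 <= \sum_a ((i == Q a)%:R + (i == Q' a)%:R + (j == Q a)%:R + (j == Q' a)%:R) :> R.
  by apply: sumr_ge0 => a _; rewrite !addr_ge0.
have bound : E (fun X => block_dev X (X i) (X j) * block_dev X (X i') (X j')) <=
    (2 * B) ^+ 2.
  rewrite -[leRHS](@Ex_const R V I (fun=> p) (fun=> p_sum1)).
  apply: Ex_ler => // X; apply: (le_trans (ler_norm _)).
  by rewrite normrM expr2; apply: ler_pM => //; exact: block_dev_le.
have [c1|c0] := leP 1 (collisions Q Q' i j i' j' : R).
  by apply: (le_trans bound); rewrite ler_peMr.
have nn (b : bool) : 0 <= b%:R :> R by rewrite ler0n.
have lt1 (b : bool) : b%:R < 1 :> R -> ~~ b by case: b => //; rewrite ltxx.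
move: c0; rewrite /collisions => c0.
have [n1 n2 n3 n4 n5] := And5 (nn (i == j)) (nn (i == i')) (nn (i == j')) (nn (j == i')) (nn (j == j')).
have ij : i != j by apply: lt1; lra.
have ii' : i != i' by apply: lt1; lra.
have ij' : i != j' by apply: lt1; lra.
have ji' : j != i' by apply: lt1; lra.
have jj' : j != j' by apply: lt1; lra.
have Qij a : [/\ Q a != i, Q' a != i, Q a != j & Q' a != j].
  have : (i == Q a)%:R + (i == Q' a)%:R + (j == Q a)%:R + (j == Q' a)%:R < 1 :> R.
    apply: (@le_lt_trans _ _ (\sum_a ((i == Q a)%:R + (i == Q' a)%:R + (j == Q a)%:R + (j == Q' a)%:R))); last by lra.
    by rewrite (bigD1 a)//= lerDl; apply: sumr_ge0 => b _; rewrite !addr_ge0.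
  have [m1 m2 m3 m4] := And4 (nn (i == Q a)) (nn (i == Q' a)) (nn (j == Q a)) (nn (j == Q' a)).
  by move=> h; split; rewrite eq_sym; apply: lt1; lra.
rewrite block_dev_ortho//.
  by rewrite mulr_ge0//; rewrite !addr_ge0.
move=> X y z.
have rE : rowset (upd (upd X i y) j z) = rowset X.
  apply/funext => x; rewrite /rowset; congr (_ < _); apply: eq_bigr => a _.
  have [/negbTE h1 _ /negbTE h2 _] := Qij a.
  by rewrite /upd h1 h2.
have cE : colset (upd (upd X i y) j z) = colset X.
  apply/funext => x; rewrite /colset; congr (_ < _); apply: eq_bigr => a _.
  have [_ /negbTE h1 _ /negbTE h2] := Qij a.
  by rewrite /upd h1 h2.
rewrite /block_dev /block_mean rE cE /upd.
by rewrite ![_ == i]eq_sym ![_ == j]eq_sym !(negbTE ii', negbTE ij', negbTE ji', negbTE jj').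
Qed.

End sampled_deviation.

Lemma Ex_exchange {R : realType} (K K' I I' : finType) (p : K -> I -> R)
    (p' : K' -> I' -> R) (F : (K -> I) -> (K' -> I') -> R) :
  Ex p (fun X => Ex p' (F X)) = Ex p' (fun Y => Ex p (fun X => F X Y)).
Proof.
rewrite {1}/Ex; under eq_bigr do rewrite /Ex big_distrr/=.
rewrite exchange_big/=; apply: eq_bigr => Y _; rewrite big_distrr/=.
by apply: eq_bigr => X _; rewrite mulrCA.
Qed.

(** This is (x - 2t)^2 >= 0. It turns bounds on second moments into bounds on first powers without
    taking roots. *)
Lemma le_sqr_div {R : realType} (x t : R) : 0 < t -> x <= t + x ^+ 2 / (4 * t).
Proof.
move=> t0; have t4 : 0 < 4 * t by lra.
rewrite -(ler_pM2r t4) [leRHS]mulrDl divfK ?gt_eqF//.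
by have := sqr_ge0 (x - 2 * t); nra.
Qed.

Section sampling.
Context {R : realType} {V I : finType}.
Hypothesis V_gt0 : (0 < #|V|)%N.
Variable p : I -> R.
Hypothesis p_ge0 : forall x, 0 <= p x.
Hypothesis p_sum1 : \sum_x p x = 1.

Section excess.
Variables (U : I -> I -> R) (B s e : R) (q : nat).
Hypothesis UB : forall x y, `|U x y| <= B.
Hypothesis s_gt0 : 0 < s.
Hypothesis q_gt0 : (0 < q)%N.
Hypothesis Bqs : B ^+ 2 <= q%:R * s ^+ 2.
Hypothesis Ue : wcut_le p U e.

Let Eu := @Ex R 'I_q V (fun=> unif).

(** Summing over all 4^q pairs of guesses replaces a union bound: one variable, depending on [X]
    alone, controls the form for all S and T at once. *)
Definition excess (X : V -> I) : R := Eu (fun Q => Eu (fun Q' =>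
  \sum_(r : {ffun 'I_q -> bool}) \sum_(r' : {ffun 'I_q -> bool})
    sample_dev p U Q Q' r r' X ^+ 2)).

Lemma excess_ge0 X : 0 <= excess X.
Proof.
do 2!(apply: Ex_ge0 => [_ ?|_|?]; [exact: unif_ge0|exact: unif_sum1|]).
by do 2!(apply: sumr_ge0 => ? _); rewrite sqr_ge0.
Qed.

Lemma excess_mean : Ex (fun=> p) excess <=
  4 ^+ q * ((2 * B) ^+ 2 * ((5 + 4 * q)%:R / #|V|%:R)).
Proof.
rewrite /excess Ex_exchange.
rewrite -[leRHS](@Ex_const R 'I_q V (fun=> unif) (fun=> unif_sum1 V_gt0)).
apply: Ex_ler => [_ ?|Q]; first exact: unif_ge0.
rewrite Ex_exchange -[leRHS](@Ex_const R 'I_q V (fun=> unif) (fun=> unif_sum1 V_gt0)).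
apply: Ex_ler => [_ ?|Q']; first exact: unif_ge0.
have -> : 4 ^+ q = \sum_(r : {ffun 'I_q -> bool}) \sum_(r' : {ffun 'I_q -> bool}) 1 :> R.
  rewrite !sumr_const !card_ffun card_bool card_ord -mulrnA -expnMn.
  by rewrite natrX.
rewrite Ex_sum big_distrl/=; apply: ler_sum => r _.
rewrite Ex_sum big_distrl/=; apply: ler_sum => r' _; rewrite mul1r.
exact: sample_dev_sqr_le.
Qed.

(** [e] bounds [block_mean], the form of [U] itself on a pair of sets; [2 * s] pays for the sampled
    rows and columns; the rest bounds [sample_dev] by [le_sqr_div]. The bound is one-sided, and is
    later applied to a matrix and to its negative. *)
Lemma sample_cut_le X (S T : pred V) t : 0 < t ->
  ubform (fun i j => U (X i) (X j)) S T <= e + 2 * s + t + excess X / (4 * t).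
Proof.
move=> t0.
pose G (Q Q' : 'I_q -> V) := e + t + (4 * t)^-1 *
  \sum_(r : {ffun 'I_q -> bool}) \sum_(r' : {ffun 'I_q -> bool})
    sample_dev p U Q Q' r r' X ^+ 2.
have t4 : 0 <= (4 * t)^-1 by rewrite invr_ge0 mulr_ge0// ltW.
rewrite (le_trans (ubform_sampled V_gt0 s_gt0 q_gt0 Bqs (G := G) S T _ _))//.
  move=> Q Q' r r'.
  rewrite (_ : ubform _ _ _ = sample_dev p U Q Q' r r' X + block_mean p U Q Q' r r' X).
    rewrite /G addrC -addrA lerD//.
      exact: le_trans (ler_norm _) (Ue _ _).
    apply: (le_trans (le_sqr_div _ t0)); rewrite lerD2l mulrC ler_wpM2l//.
    rewrite (bigD1 r)//= (bigD1 r')//= -addrA lerDl addr_ge0//.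
      by apply: sumr_ge0 => ? _; rewrite sqr_ge0.
    by do 2!(apply: sumr_ge0 => ? _); rewrite sqr_ge0.
  by rewrite /sample_dev subrK.
rewrite [X in X + _ <= _](_ : _ = e + t + (4 * t)^-1 * excess X); last first.
  rewrite /excess -ExZ -[e + t in RHS](@Ex_const R 'I_q V (fun=> unif) (fun=> unif_sum1 V_gt0)).
  rewrite -ExD; apply: Ex_eq => Q.
  rewrite -ExZ -[e + t in RHS](@Ex_const R 'I_q V (fun=> unif) (fun=> unif_sum1 V_gt0)).
  by rewrite -ExD.
rewrite le_eqVlt; apply/orP; left; apply/eqP; ring.
Qed.

End excess.

Section frequencies.
Context {J : finType}.
Variable c : I -> J.

Definition freq (X : V -> I) (j : J) : R := avg (fun i => (c (X i) == j)%:R).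

Definition count_dev (X : V -> I) : R := \sum_j (freq X j - mass p c j) ^+ 2.

Lemma count_dev_ge0 X : 0 <= count_dev X.
Proof. by apply: sumr_ge0 => ? _; rewrite sqr_ge0. Qed.

Lemma count_dev_mean : Ex (fun=> p) count_dev <= #|V|%:R^-1.
Proof.
have V0 : 0 < #|V|%:R :> R by rewrite ltr0n.
rewrite /count_dev Ex_sum [leRHS](_ : _ = \sum_j mass p c j / #|V|%:R); last first.
  by rewrite -big_distrl/= sum_mass// mul1r.
apply: ler_sum => j _.
have mE : mass p c j = \sum_x p x * (c x == j)%:R.
  rewrite /mass big_mkcond/=; apply: eq_bigr => x _.
  by case: eqP; rewrite ?mulr1 ?mulr0.
have := variance_sum_le (K := V) p_sum1 (fun x => (c x == j)%:R).
rewrite -mE (_ : \sum_x p x * _ ^+ 2 = mass p c j); last first.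
  by rewrite mE; apply: eq_bigr => x _; rewrite -natrX; case: eqP.
rewrite (_ : Ex _ _ = #|V|%:R ^+ 2 * Ex (fun _ : V => p) (fun X => (freq X j - mass p c j) ^+ 2)).
  by rewrite expr2 -mulrA ler_pM2l// => h; rewrite ler_pdivlMr// mulrC.
rewrite -ExZ; apply: Ex_eq => X; rewrite -exprMn; congr (_ ^+ 2).
rewrite sumrB sumr_const -[mass p c j *+ _]mulr_natl mulrBr; congr (_ - _).
by rewrite /freq /avg big_distrr/=; apply: eq_bigr => i _; rewrite /unif mulVKf// gt_eqF.
Qed.

(** [le_sqr_div] for each cell, with [t] shared equally among them; the factor [#|J|] is the price
    of passing from squares to absolute values. *)
Lemma freq_dev_le X t : 0 < t ->
  \sum_j `|freq X j - mass p c j| <= t + #|J|%:R * count_dev X / (4 * t).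
Proof.
move=> t0.
have J0 : 0 < #|J|%:R :> R.
  rewrite ltr0n lt0n; apply/negP => /eqP J0.
  have := sum_mass p_sum1 c; rewrite big1 => [/eqP|j _]; first by rewrite eq_sym oner_eq0.
  by have := max_card (pred1 j); rewrite card1 J0.
have -> : t + #|J|%:R * count_dev X / (4 * t) = \sum_j (t / #|J|%:R +
    `|freq X j - mass p c j| ^+ 2 / (4 * (t / #|J|%:R))).
  rewrite big_split/= sumr_const -[(t / _) *+ _]mulr_natr divfK ?gt_eqF//.
  congr (_ + _); rewrite /count_dev mulrC !big_distrr/=.
  apply: eq_bigr => j _; rewrite real_normK ?num_real//.
  by field; rewrite !gt_eqF.
by apply: ler_sum => j _; apply: le_sqr_div; rewrite divr_gt0.
Qed.

End frequencies.
End sampling.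

(** After inversion, expR u >= 1 + u with u = 2x^2 - x suffices, because (1 + u)(1 + x) = 1 + x^2 (1
    + 2x). The last factor is nonnegative exactly for x >= -1/2. *)
Lemma expR_sub_sqr_le {R : realType} (x : R) : - (2^-1) <= x ->
  expR (x - 2 * x ^+ 2) <= 1 + x.
Proof.
move=> hx; have x0 : 0 < 1 + x by lra.
rewrite -[leRHS]invrK -[leLHS]invrK lef_pV2 ?posrE ?invr_gt0 ?expR_gt0//.
rewrite -expRN; apply: le_trans (expR_ge1Dx _).
rewrite -(ler_pM2r x0) mulVf ?gt_eqF//.
have := sqr_ge0 x; nra.
Qed.

(** * Random sign patterns *)

Section random_graph.
Context {R : realType} {I : finType} {k : nat}.
Implicit Types (w : I -> I -> R) (X : 'I_k -> I) (S T : pred 'I_k).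
Let pairs : finType := ('I_k * 'I_k)%type.
Implicit Types (e : pairs) (g : pairs -> bool).

Definition sg (b : bool) : R := if b then 1 else -1.

(** The value 0 at pairs out of order makes their signs fair coins, unrelated to [w], so that
    patterns can be indexed by all k^2 pairs. *)
Definition evalue w X e : R := if (e.1 < e.2)%N then w (X e.1) (X e.2) else 0.

(* The sign of the pair e has expectation evalue w X e. *)
Definition pg w X e (b : bool) : R := (1 + sg b * evalue w X e) / 2.

Definition sgraph g (i j : 'I_k) : R :=
  if (i < j)%N then sg (g (i, j)) else if (j < i)%N then sg (g (j, i)) else 0.

Lemma pg_sum1 w X e : \sum_b pg w X e b = 1.
Proof. by rewrite big_bool /pg /sg /=; field. Qed.

Lemma sum_pairs (F : 'I_k -> 'I_k -> R) : \sum_i \sum_j F i j =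
  \sum_(e : pairs) (if (e.1 < e.2)%N then F e.1 e.2 + F e.2 e.1 else 0) + \sum_i F i i.
Proof.
have -> : \sum_(e : pairs) (if (e.1 < e.2)%N then F e.1 e.2 + F e.2 e.1 else 0) =
    \sum_(i : 'I_k) \sum_(j : 'I_k) (if (i < j)%N then F i j else 0) +
    \sum_(i : 'I_k) \sum_(j : 'I_k) (if (j < i)%N then F i j else 0).
  rewrite [X in _ = _ + X]exchange_big/= -big_split/=.
  rewrite -(pair_bigA _ (fun i j : 'I_k => if (i < j)%N then F i j + F j i else 0))/=.
  apply: eq_bigr => i _; rewrite -big_split/=; apply: eq_bigr => j _.
  by case: ifP; rewrite ?addr0.
rewrite -!big_split/=; apply: eq_bigr => i _.
rewrite -big_split/= [RHS]addrC [X in _ + X](bigD1 i)//= [LHS](bigD1 i)//= !ltnn addr0 add0r.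
congr (_ + _); apply: eq_bigr => j ji.
case: ltngtP => [| |/val_inj ij]; rewrite ?addr0 ?add0r//.
by rewrite ij eqxx in ji.
Qed.

Section noise.
Variable w : I -> I -> R.
Hypothesis w_sym : forall x y, w x y = w y x.
Hypothesis w1 : forall x y, `|w x y| <= 1.

Lemma evalue_le X e : `|evalue w X e| <= 1.
Proof. by rewrite /evalue; case: ifP => // _; rewrite normr0. Qed.

Lemma pg_ge0 X e b : 0 <= pg w X e b.
Proof.
have := evalue_le X e; rewrite /pg /sg ler_norml => /andP[? ?].
by case: b; lra.
Qed.

(** What the pair [e], taken in both orders, contributes to k^2 times the form of w(X) - [sgraph g]
    over S and T. Its mean over the random sign is zero. *)
Definition noise_term S T X e (b : bool) : R :=
  if (e.1 < e.2)%N then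
    ((S e.1)%:R * (T e.2)%:R + (S e.2)%:R * (T e.1)%:R) * (evalue w X e - sg b)
  else 0.

Lemma noise_term_le S T X e b : `|noise_term S T X e b| <= 4.
Proof.
have := evalue_le X e; rewrite /noise_term ler_norml => /andP[? ?].
case: ifP => _; last by rewrite normr0.
rewrite normrM -[4%:R]/((2 + 2)%N%:R) (_ : (2 + 2)%N%:R = 2 * 2 :> R); last by lra.
apply: ler_pM => //.
  rewrite -!natrM -natrD ger0_norm ?ler0n// ler_nat.
  by case: (S _); case: (T _); case: (S _); case: (T _).
by rewrite /sg ler_norml; case: b; lra.
Qed.

(** A substitute for the exponential moment: the factors are independent with mean 1, so the product
    has mean exactly 1, and it dominates an exponential up to a quadratic loss. *)
Definition noise_prod t S T X g : R := \prod_(e : pairs) (1 + t * noise_term S T X e (g e)).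

Lemma noise_prod_mean t S T X : Ex (pg w X) (noise_prod t S T X) = 1.
Proof.
rewrite /noise_prod (Ex_prod _ (fun e b => 1 + t * noise_term S T X e b)).
by rewrite big1// => e _; rewrite big_bool /pg /noise_term /sg/=; case: ifP => _; field.
Qed.

(** Each factor is 1 + x with |x| <= 4|t| <= 1/2, where [expR_sub_sqr_le] loses at most 2 (4t)^2 =
    32 t^2; there are k^2 factors. *)
Lemma noise_prod_ge t S T X g : `|t| <= 8^-1 ->
  expR (t * (\sum_(e : pairs) noise_term S T X e (g e)) - 32 * t ^+ 2 * k%:R ^+ 2) <=
  noise_prod t S T X g.
Proof.
move=> t8.
have -> : t * (\sum_(e : pairs) noise_term S T X e (g e)) - 32 * t ^+ 2 * k%:R ^+ 2 =
    \sum_(e : pairs) (t * noise_term S T X e (g e) - 32 * t ^+ 2).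
  rewrite sumrB big_distrr/= sumr_const card_prod card_ord.
  by rewrite -[_ *+ (k * k)]mulr_natr natrM expr2.
rewrite expR_sum; apply: ler_prod => e _; rewrite expR_ge0/=.
have := noise_term_le S T X e (g e).
set x := noise_term _ _ _ _ _ => x4.
have tx : `|t * x| <= `|t| * 4 by rewrite normrM ler_wpM2l.
apply: le_trans (expR_sub_sqr_le _); last first.
  by move: tx; rewrite ler_norml => /andP[? _]; lra.
rewrite ler_expR lerD2l lerN2.
rewrite -(real_normK (num_real (t * x))) -(real_normK (num_real t)).
have := normr_ge0 (t * x); have := normr_ge0 t; nra.
Qed.

(** A union bound in one variable: all 4^k pairs of sets, and both signs of [t] because deviations
    in both directions matter. *)
Definition noise t X g : R :=
  \sum_(S : {ffun 'I_k -> bool}) \sum_(T : {ffun 'I_k -> bool})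
    (noise_prod t S T X g + noise_prod (- t) S T X g).

Lemma noise_mean t X : Ex (pg w X) (noise t X) = 2 * 4 ^+ k.
Proof.
have -> : 2 * 4 ^+ k = \sum_(S : {ffun 'I_k -> bool})
    \sum_(T : {ffun 'I_k -> bool}) 2 :> R.
  rewrite !sumr_const !card_ffun card_bool card_ord -mulrnA -expnMn.
  by rewrite -[_ *+ (_ ^ _)]mulr_natr natrX.
rewrite /noise Ex_sum; apply: eq_bigr => S _; rewrite Ex_sum.
by apply: eq_bigr => T _; rewrite ExD !noise_prod_mean.
Qed.

Lemma noise_prod_ge0 t S T X g : `|t| <= 8^-1 -> 0 <= noise_prod t S T X g.
Proof. by move=> t8; rewrite (le_trans _ (noise_prod_ge _ _ _ _ t8))// expR_ge0. Qed.

Lemma noise_ge0 t X g : `|t| <= 8^-1 -> 0 <= noise t X g.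
Proof.
by move=> t8; do 2!(apply: sumr_ge0 => ? _); rewrite addr_ge0 ?noise_prod_ge0 ?normrN.
Qed.

Lemma noise_cut t th X g S T : 0 < t -> t <= 8^-1 ->
  noise t X g < expR (k%:R ^+ 2 * (t * th - 32 * t ^+ 2)) ->
  `|\sum_(e : pairs) noise_term S T X e (g e)| <= th * k%:R ^+ 2.
Proof.
move=> t0 t8 small.
have tn8 : `|t| <= 8^-1 by rewrite gtr0_norm.
have tn8' : `|- t| <= 8^-1 by rewrite normrN.
pose S' := [ffun i => S i]; pose T' := [ffun i => T i].
have SE : S' =1 S by move=> i; rewrite ffunE.
have TE : T' =1 T by move=> i; rewrite ffunE.
have le1 : noise_prod t S' T' X g + noise_prod (- t) S' T' X g <= noise t X g.
  rewrite /noise (bigD1 S')//= (bigD1 T')//= -addrA lerDl addr_ge0//.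
    by apply: sumr_ge0 => ? _; rewrite addr_ge0 ?noise_prod_ge0.
  by do 2!(apply: sumr_ge0 => ? _); rewrite addr_ge0 ?noise_prod_ge0.
have sumE : \sum_(e : pairs) noise_term S' T' X e (g e) = \sum_(e : pairs) noise_term S T X e (g e).
  by apply: eq_bigr => e _; rewrite /noise_term !SE !TE.
have h t' : `|t'| <= 8^-1 -> noise_prod t' S' T' X g <= noise t X g ->
    t' * (\sum_(e : pairs) noise_term S T X e (g e)) - 32 * t' ^+ 2 * k%:R ^+ 2 <
    k%:R ^+ 2 * (t * th - 32 * t ^+ 2).
  move=> ht hn; rewrite -ltr_expR -sumE.
  exact: le_lt_trans (noise_prod_ge _ _ _ _ ht) (le_lt_trans hn small).
have /h := tn8; rewrite (le_trans _ le1) ?lerDl ?noise_prod_ge0// => /(_ isT) h1.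
have /h := tn8'; rewrite (le_trans _ le1) ?lerDr ?noise_prod_ge0// => /(_ isT) h2.
rewrite ler_norml; apply/andP; split; rewrite -(ler_pM2l t0); nra.
Qed.

(** The pairs i < j, counted in both orders, give the noise; the k diagonal entries, where [sgraph]
    is 0, have size at most 1 and weight k^-2 each, hence the term 1/k. *)
Lemma sgraph_cut_le th X g S T : (0 < k)%N ->
  `|\sum_(e : pairs) noise_term S T X e (g e)| <= th * k%:R ^+ 2 ->
  `|ubform (fun i j => w (X i) (X j) - sgraph g i j) S T| <= th + k%:R^-1.
Proof.
move=> k0 noise_le.
have kR : 0 < k%:R :> R by rewrite ltr0n.
have -> : ubform (fun i j => w (X i) (X j) - sgraph g i j) S T =
    k%:R^-1 ^+ 2 * (\sum_(e : pairs) noise_term S T X e (g e) +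
    \sum_i (S i)%:R * (T i)%:R * w (X i) (X i)).
  rewrite /ubform /bform sum_pairs mulrDr !big_distrr/=; congr (_ + _).
    apply: eq_bigr => -[i j] _ /=; rewrite /noise_term /evalue/=.
    case: ltngtP => // ij; rewrite ?mulr0// /sgraph ij ltnNge (ltnW ij)/=.
    by rewrite /unif card_ord (w_sym (X j)); ring.
  apply: eq_bigr => i _; rewrite /sgraph ltnn /unif card_ord subr0; ring.
rewrite normrM ger0_norm ?exprn_ge0 ?invr_ge0// exprVn ler_pdivrMl ?exprn_gt0//.
rewrite mulrDr; apply: (le_trans (ler_normD _ _)); apply: lerD; first by rewrite mulrC.
rewrite expr2 mulfK ?gt_eqF//; apply: (le_trans (ler_norm_sum _ _ _)).
rewrite -[leRHS]mulr1 -[k in leRHS]card_ord -sum1_card natr_sum big_distrl/=.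
apply: ler_sum => i _; rewrite mul1r.
have := w1 (X i) (X i).
by case: (S i); case: (T i); rewrite /= ?(mul0r, mul1r, mulr0) ?normr0.
Qed.

End noise.

Definition graph_weight (p : I -> R) w g : R :=
  Ex (fun=> p) (fun X => \prod_(e : pairs) pg w X e (g e)).

Definition set_density (p : I -> R) w (D : {set pairs}) : R :=
  Ex (fun=> p) (fun X => \prod_(e in D) w (X e.1) (X e.2)).

(** Each factor is 1/2 plus half a signed value; in the expansion, [D] selects the pairs that
    contribute the second part, and sets with a pair out of order vanish with [evalue]. *)
Lemma graph_weightE p w g : graph_weight p w g =
  \sum_(D : {set pairs} | [forall e in D, (e.1 < e.2)%N])
    2^-1 ^+ #|pairs| * (\prod_(e in D) sg (g e)) * set_density p w D.
Proof.
have prodE X : \prod_(e : pairs) pg w X e (g e) = \sum_(D : {set pairs})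
    2^-1 ^+ #|pairs| * (\prod_(e in D) sg (g e)) * \prod_(e in D) evalue w X e.
  rewrite (eq_bigr (fun e => sg (g e) * evalue w X e / 2 + 2^-1)); last first.
    by move=> e _; rewrite /pg; lra.
  rewrite bigA_distr; apply: eq_big => // D _.
  rewrite -mulrA -big_split/= -prodr_const big_mkcond [X in _ * X]big_mkcond/=.
  rewrite -big_split/=; apply: eq_bigr => e _.
  by case: ifP => _; rewrite ?mulr1// mulrC.
rewrite /graph_weight (Ex_eq _ prodE) Ex_sum (bigID (fun D : {set pairs} => [forall e in D, (e.1 < e.2)%N]))/=.
rewrite [X in _ + X]big1 ?addr0.
  apply: eq_bigr => D /forall_inP lt; rewrite -ExZ; apply: Ex_eq => X.
  by congr (_ * _); apply: eq_bigr => e /lt; rewrite /evalue => ->.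
move=> D; rewrite negb_forall => /existsP[e]; rewrite negb_imply => /andP[eD ltN].
rewrite ExZ (@Ex_eq _ _ _ _ _ (fun=> 0 * 0)).
  by rewrite ExZ mul0r mulr0.
by move=> X; rewrite (bigD1 e)//= /evalue (negbTE ltN) !mul0r.
Qed.

End random_graph.

(** For one pattern, at most 2^(k^2) sets [D], with coefficients of size 2^(-k^2), give an error of
    at most [d]; there are 2^(k^2) patterns. *)
Lemma graph_weight_dist {R : realType} {I I' : finType} {k : nat} (p : I -> R)
    (p' : I' -> R) (w : I -> I -> R) (w' : I' -> I' -> R) (d : R) :
  (forall D : {set 'I_k * 'I_k}, [forall e in D, (e.1 < e.2)%N] ->
    `|set_density p w D - set_density p' w' D| <= d) ->
  \sum_(g : {ffun 'I_k * 'I_k -> bool})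
    `|graph_weight p w g - graph_weight p' w' g| <= 2 ^+ (k * k) * d.
Proof.
move=> close; have d0 : 0 <= d.
  apply: le_trans (close finset.set0 _); first exact: normr_ge0.
  by apply/forall_inP => e; rewrite finset.in_set0.
rewrite [leRHS](_ : _ = \sum_(g : {ffun 'I_k * 'I_k -> bool}) d); last first.
  by rewrite sumr_const card_ffun card_bool card_prod card_ord -[RHS]mulr_natl natrX.
apply: ler_sum => g _; rewrite !graph_weightE -sumrB.
apply: (le_trans (ler_norm_sum _ _ _)).
set N := #|_|.
have sgN (D : {set 'I_k * 'I_k}) : `|\prod_(e in D) sg (g e)| = 1 :> R.
  by rewrite normr_prod big1// => e _; rewrite /sg; case: (g e); rewrite ?normrN normr1.
apply: (@le_trans _ _ (\sum_(D : {set 'I_k * 'I_k}) 2^-1 ^+ N * d)).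
  rewrite [leLHS]big_mkcond/=; apply: ler_sum => D _; case: ifP => [lt|_].
    rewrite -mulrBr !normrM sgN mulr1 ger0_norm ?exprn_ge0 ?invr_ge0//.
    by rewrite ler_wpM2l ?exprn_ge0 ?invr_ge0// close.
  by rewrite mulr_ge0 ?exprn_ge0 ?invr_ge0.
rewrite sumr_const -cardsT -powersetT card_powerset cardsT -/N.
by rewrite -[_ *+ (_ ^ _)]mulr_natl natrX mulrA -exprMn mulfV ?pnatr_eq0// expr1n mul1r.
Qed.

(** * Couplings of finite weighted sets *)

Section pushforward.
Context {R : realType} {A B : finType}.

Definition push (phi : A -> B) (s : A -> R) (y : B) : R := \sum_(z | phi z == y) s z.

Lemma sum_push phi s (G : B -> R) : \sum_y push phi s y * G y = \sum_z s z * G (phi z).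
Proof.
rewrite [RHS](partition_big phi predT)//=; apply: eq_bigr => y _.
by rewrite big_distrl/=; apply: eq_bigr => z /eqP ->.
Qed.

Lemma bform_push (M : B -> B -> R) phi s t :
  bform (fun z z' => M (phi z) (phi z')) s t = bform M (push phi s) (push phi t).
Proof.
rewrite !bform_linear1 (sum_push phi s (fun y => \sum_y' push phi t y' * M y y')).
by apply: eq_bigr => z _; rewrite (sum_push phi t (M (phi z))).
Qed.

Lemma push_ge0 phi s : (forall z, 0 <= s z) -> forall y, 0 <= push phi s y.
Proof. by move=> s0 y; exact: sumr_ge0. Qed.

Lemma push_sum phi s : \sum_y push phi s y = \sum_z s z.
Proof. by rewrite [RHS](partition_big phi predT). Qed.

End pushforward.

Section bform_more.
Context {R : realType} {A : finType}.
Implicit Types (M : A -> A -> R) (f g : A -> R).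

Lemma eq_bform M M' f f' g g' : (forall x y, M x y = M' x y) -> f =1 f' -> g =1 g' ->
  bform M f g = bform M' f' g'.
Proof.
by move=> MM ff gg; do 2!(apply: eq_bigr => ? _); rewrite MM ff gg.
Qed.

Lemma bformD_mx M M' f g :
  bform (fun x y => M x y + M' x y) f g = bform M f g + bform M' f g.
Proof. by do 2!(rewrite -big_split/=; apply: eq_bigr => ? _); rewrite mulrDr. Qed.

Lemma bform_norm_le M f g a : 0 <= a -> (forall x y, `|M x y| <= a) ->
  (forall x, 0 <= f x) -> (forall x, 0 <= g x) ->
  `|bform M f g| <= a * (\sum_x f x) * \sum_y g y.
Proof.
move=> a0 Ma f0 g0; rewrite [leRHS](_ : _ = \sum_x \sum_y f x * g y * a).
  apply: (le_trans (ler_norm_sum _ _ _)); apply: ler_sum => x _.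
  apply: (le_trans (ler_norm_sum _ _ _)); apply: ler_sum => y _.
  by rewrite !normrM (ger0_norm (f0 x)) (ger0_norm (g0 y)) ler_wpM2l// mulr_ge0.
rewrite -mulrA big_distrlr/= big_distrr/=; apply: eq_bigr => x _.
by rewrite big_distrr/=; apply: eq_bigr => y _; rewrite mulrC.
Qed.

(** A weight between 0 and [p] is [p] times a fractional set, and zero where [p] is; the cut norm
    controls fractional sets as it does sets. *)
Lemma wcut_le_sub (p : A -> R) M e f g : wcut_le p M e ->
  (forall x, 0 <= f x <= p x) -> (forall x, 0 <= g x <= p x) -> `|bform M f g| <= e.
Proof.
move=> cM fp gp.
have frac (h : A -> R) : (forall x, 0 <= h x <= p x) ->
    (forall x, 0 <= h x / p x <= 1) /\ forall x, h x = p x * (h x / p x).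
  move=> hp; split => x; have /andP[h0 hpx] := hp x.
    have [->|px] := eqVneq (p x) 0; first by rewrite invr0 mulr0 lexx ler01.
    have p0 : 0 < p x by rewrite lt_neqAle eq_sym px (le_trans h0).
    by rewrite divr_ge0 ?(ltW p0)//= ler_pdivrMr// mul1r.
  have [p0|px] := eqVneq (p x) 0; last by rewrite mulrC divfK.
  by rewrite p0 mul0r; apply/eqP; rewrite eq_le h0 -p0 hpx.
have [f01 fE] := frac f fp; have [g01 gE] := frac g gp.
have -> : bform M f g = bform (fun x y => p x * p y * M x y)
    (fun x => f x / p x) (fun x => g x / p x).
  by apply: eq_bigr => x _; apply: eq_bigr => y _; rewrite {1}fE {1}gE; ring.
by have := cut_le_nneg cM ler01 ler01 f01 g01; rewrite !mul1r.
Qed.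

End bform_more.

Section coupling_adjust.
Context {R : realType} {J J' : finType}.
Variables (n : J -> J' -> R) (P : J -> R) (P' : J' -> R).
Hypothesis n0 : forall j j', 0 <= n j j'.
Hypothesis P0 : forall j, 0 <= P j.
Hypothesis P'0 : forall j', 0 <= P' j'.
Hypothesis P1 : \sum_j P j = 1.
Hypothesis P'1 : \sum_j' P' j' = 1.
Hypothesis n1 : \sum_j \sum_j' n j j' = 1.

Let shrink (r P : R) := Num.min 1 (P / r).

Let shrinkP r p : 0 <= r -> 0 <= p ->
  [/\ 0 <= shrink r p, shrink r p <= 1, shrink r p * r <= p
    & (1 - shrink r p) * r <= `|r - p|].
Proof.
move=> r0 p0; rewrite /shrink.
have [->|rN0] := eqVneq r 0.
  by rewrite !mulr0 invr0 mulr0 normr_ge0; split; rewrite // ?le_min ?ge_min ?ler01 ?lexx.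
have rp : 0 < r by rewrite lt_neqAle eq_sym rN0.
have pr : p / r * r = p by rewrite divfK.
have pr0 : 0 <= p / r by rewrite divr_ge0.
have := ler_norm (r - p); have := normr_ge0 (r - p).
case: (leP 1 (p / r)) => h; split => //; rewrite ?ler01 ?(ltW h)//; nra.
Qed.

(** Rows and columns in excess of their targets are scaled down, which gives [m1]. The deficits [b]
    and [b'] then have the same total [rho], and their product divided by [rho] is the [m2] that
    fills both marginals. *)
Lemma coupling_adjust : exists m1 m2 : J -> J' -> R,
  [/\ forall j j', 0 <= m1 j j' <= n j j', forall j j', 0 <= m2 j j',
      forall j, \sum_j' (m1 j j' + m2 j j') = P j,
      forall j', \sum_j (m1 j j' + m2 j j') = P' j'
    & \sum_j \sum_j' m2 j j' <=
      \sum_j `|\sum_j' n j j' - P j| + \sum_j' `|\sum_j n j j' - P' j'|].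
Proof.
pose r j := \sum_j' n j j'; pose r' j' := \sum_j n j j'.
have r0 j : 0 <= r j by exact: sumr_ge0.
have r'0 j' : 0 <= r' j' by exact: sumr_ge0.
pose a j := shrink (r j) (P j); pose a' j' := shrink (r' j') (P' j').
have aP j : [/\ 0 <= a j, a j <= 1, a j * r j <= P j & (1 - a j) * r j <= `|r j - P j|].
  exact: shrinkP.
have a'P j : [/\ 0 <= a' j, a' j <= 1, a' j * r' j <= P' j
    & (1 - a' j) * r' j <= `|r' j - P' j|].
  exact: shrinkP.
pose m1 j j' := a j * a' j' * n j j'.
have m10 j j' : 0 <= m1 j j' <= n j j'.
  have [? ? _ _] := aP j; have [? ? _ _] := a'P j'.
  rewrite mulr_ge0 ?mulr_ge0//= ler_piMl// -[leRHS]mulr1 ler_pM//.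
pose b j := P j - \sum_j' m1 j j'; pose b' j' := P' j' - \sum_j m1 j j'.
pose rho := 1 - \sum_j \sum_j' m1 j j'.
have b0 j : 0 <= b j.
  rewrite subr_ge0; have [? ? le _] := aP j; apply: le_trans le.
  rewrite big_distrr/=; apply: ler_sum => j' _; have [? ? _ _] := a'P j'.
  by rewrite /m1 ler_wpM2r// ler_piMr.
have b'0 j' : 0 <= b' j'.
  rewrite subr_ge0; have [? ? le _] := a'P j'; apply: le_trans le.
  rewrite big_distrr/=; apply: ler_sum => j _; have [? ? _ _] := aP j.
  by rewrite /m1 ler_wpM2r// ler_piMl.
have sb : \sum_j b j = rho by rewrite sumrB P1.
have sb' : \sum_j' b' j' = rho by rewrite sumrB P'1 exchange_big.
have rho0 : 0 <= rho by rewrite -sb sumr_ge0.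
(* For [rho] = 0 every deficit is 0, so x / 0 = 0 gives the right value. *)
have divrho (x : R) : 0 <= x -> x <= rho -> x * rho / rho = x.
  move=> x0 xr; have [rho_eq0|?] := eqVneq rho 0; last by rewrite mulfK.
  by rewrite rho_eq0 mulr0 mul0r; apply/eqP; rewrite eq_le x0 -rho_eq0 xr.
have brho j : b j <= rho by rewrite -sb (bigD1 j)//= lerDl sumr_ge0.
have b'rho j : b' j <= rho by rewrite -sb' (bigD1 j)//= lerDl sumr_ge0.
exists m1, (fun j j' => b j * b' j' / rho); split => //.
- by move=> j j'; rewrite divr_ge0// mulr_ge0.
- move=> j; rewrite big_split/= -big_distrl/= -big_distrr/= sb' divrho//.
  by rewrite addrC subrK.
- move=> j; rewrite big_split/= -big_distrl/= -big_distrl/= sb mulrC [rho * _]mulrC mulrC divrho//.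
  by rewrite addrC subrK.
rewrite (_ : \sum_j \sum_j' _ = rho); last first.
  under eq_bigr do rewrite -big_distrl/= -big_distrr/= sb' divrho//.
  exact: sb.
apply: (@le_trans _ _ (\sum_j (1 - a j) * r j + \sum_j' (1 - a' j') * r' j')); last first.
  by apply: lerD; apply: ler_sum => j _; [have [] := aP j|have [] := a'P j].
rewrite /rho -[X in X - _]n1 -sumrB; under [X in _ + X]eq_bigr do rewrite big_distrr/=.
rewrite [X in _ + X]exchange_big/= -big_split/=; apply: ler_sum => j _.
rewrite -sumrB big_distrr/= -big_split/=; apply: ler_sum => j' _.
have [? ? _ _] := aP j; have [? ? _ _] := a'P j'.
(* 1 - a a' <= (1 - a) + (1 - a') charges the lost mass to rows and columns separately. *)
rewrite /m1 -subr_ge0 (_ : _ - _ = (1 - a j) * (1 - a' j') * n j j'); last by ring.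
by rewrite !mulr_ge0// subr_ge0.
Qed.

End coupling_adjust.

Section sample_coupling.
Context {R : realType} {V I I' J J' : finType}.
Hypothesis V_gt0 : (0 < #|V|)%N.
Variables (p : I -> R) (p' : I' -> R) (c : I -> J) (c' : I' -> J').
Hypothesis p_ge0 : forall x, 0 <= p x.
Hypothesis p_sum1 : \sum_x p x = 1.
Hypothesis p'_ge0 : forall x, 0 <= p' x.
Hypothesis p'_sum1 : \sum_x p' x = 1.
Variables (cw : J -> J -> R) (cw' : J' -> J' -> R).
Hypothesis cw1 : forall j l, `|cw j l| <= 1.
Hypothesis cw'1 : forall j l, `|cw' j l| <= 1.

Let D (z z' : J * J') : R := cw z.1 z'.1 - cw' z.2 z'.2.

(** The pairs of cells hit by X_i and X'_i form an empirical coupling [n], whose marginals are only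
    approximately right and get adjusted. The parts of [f] and [h] under [m1] live on the sample
    points; the rest has mass at most d + d', and as |D| <= 2 its two cross terms cost 2 (d + d')
    each. *)
Lemma sample_coupling (X : V -> I) (X' : V -> I') (a d d' : R) :
  (forall S T, `|ubform (fun i j => D (c (X i), c' (X' i)) (c (X j), c' (X' j))) S T| <= a) ->
  \sum_j `|freq c X j - mass p c j| <= d ->
  \sum_j `|freq c' X' j - mass p' c' j| <= d' ->
  exists m : J -> J' -> R,
  [/\ forall j j', 0 <= m j j', forall j, \sum_j' m j j' = mass p c j,
      forall j', \sum_j m j j' = mass p' c' j'
    & forall f h : J * J' -> R, (forall z, 0 <= f z <= m z.1 z.2) ->
        (forall z, 0 <= h z <= m z.1 z.2) -> `|bform D f h| <= a + 4 * (d + d')].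
Proof.
move=> Da cd cd'; pose phi i := (c (X i), c' (X' i)).
pose n j j' : R := push phi unif (j, j').
have n0 j j' : 0 <= n j j' by apply: push_ge0 => i; exact: unif_ge0.
have row j : \sum_j' n j j' = freq c X j.
  rewrite /freq /avg -(sum_push phi unif (fun z => (z.1 == j)%:R)).
  rewrite -(pair_bigA _ (fun l l' => push phi unif (l, l') * (l == j)%:R))/=.
  rewrite (bigD1 j)//= eqxx [X in _ = _ + X]big1 ?addr0.
    by apply: eq_bigr => j' _; rewrite mulr1.
  by move=> l /negbTE ->; rewrite big1// => l' _; rewrite mulr0.
have col j' : \sum_j n j j' = freq c' X' j'.
  rewrite /freq /avg -(sum_push phi unif (fun z => (z.2 == j')%:R)).
  rewrite -(pair_bigA _ (fun l l' => push phi unif (l, l') * (l' == j')%:R))/=.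
  rewrite exchange_big/= (bigD1 j')//= eqxx [X in _ = _ + X]big1 ?addr0.
    by apply: eq_bigr => j _; rewrite mulr1.
  by move=> l /negbTE ->; rewrite big1// => l' _; rewrite mulr0.
have n1 : \sum_j \sum_j' n j j' = 1.
  rewrite pair_bigA/= (eq_bigr (push phi unif)); last by case.
  by rewrite push_sum unif_sum1.
have [m1 [m2 [m1n m20 mrow mcol m2le]]] := coupling_adjust n0 (mass_ge0 p_ge0 c)
  (mass_ge0 p'_ge0 c') (sum_mass p_sum1 c) (sum_mass p'_sum1 c') n1.
have m10 j j' : 0 <= m1 j j' by have /andP[] := m1n j j'.
exists (fun j j' => m1 j j' + m2 j j'); split => //.
  by move=> j j'; rewrite addr_ge0.
have D2 z z' : `|D z z'| <= 2.
  by apply: (le_trans (ler_normB _ _)); have := cw1 z.1 z'.1; have := cw'1 z.2 z'.2; lra.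
have m2d : \sum_(z : J * J') m2 z.1 z.2 <= d + d'.
  rewrite -(pair_bigA _ m2)/=; apply: (le_trans m2le).
  by under eq_bigr do rewrite row; under [X in _ + X]eq_bigr do rewrite col; exact: lerD.
have msum : \sum_(z : J * J') (m1 z.1 z.2 + m2 z.1 z.2) = 1.
  rewrite -(pair_bigA _ (fun j j' => m1 j j' + m2 j j'))/=.
  by under eq_bigr do rewrite mrow; exact: sum_mass.
pose cut (f : J * J' -> R) z := Num.min (f z) (m1 z.1 z.2).
have cutP f : (forall z, 0 <= f z <= m1 z.1 z.2 + m2 z.1 z.2) -> forall z,
    [/\ 0 <= cut f z, cut f z <= m1 z.1 z.2, 0 <= f z - cut f z &
        f z - cut f z <= m2 z.1 z.2].
  move=> fm z; have /andP[f0 fle] := fm z; rewrite /cut; split.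
  - by rewrite le_min f0 m10.
  - by rewrite ge_min lexx orbT.
  - by rewrite subr_ge0 ge_min lexx.
  - by rewrite lerBlDl; case: (leP (f z) (m1 z.1 z.2)) => // _; rewrite lerDl.
have main f h : (forall z, 0 <= f z <= m1 z.1 z.2) ->
    (forall z, 0 <= h z <= m1 z.1 z.2) -> `|bform D f h| <= a.
  (* Mass at most [n] on pairs of cells comes from a fractional set of sample points: each point
     takes the fraction f0 / n of its own pair of cells. *)
  have lift (f0 : J * J' -> R) : (forall z, 0 <= f0 z <= m1 z.1 z.2) ->
      exists F : V -> R, (forall i, 0 <= F i <= 1) /\
        push phi (fun i => unif i * F i) =1 f0.
    move=> f0m; exists (fun i => f0 (phi i) / n (phi i).1 (phi i).2); split.
      move=> i; have /andP[f00 f0le] := f0m (phi i).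
      have /andP[_ mn] := m1n (phi i).1 (phi i).2.
      have [->|nn] := eqVneq (n (phi i).1 (phi i).2) 0.
        by rewrite invr0 mulr0 lexx ler01.
      have np : 0 < n (phi i).1 (phi i).2 by rewrite lt_neqAle eq_sym nn n0.
      by rewrite divr_ge0//= ler_pdivrMr// mul1r (le_trans f0le).
    move=> z; transitivity (n z.1 z.2 * (f0 z / n z.1 z.2)).
      rewrite [X in _ = X * _](_ : _ = push phi unif z); last by case: (z).
      by rewrite /push big_distrl; apply: eq_bigr => i /eqP ->.
    have [n_eq0|nn] := eqVneq (n z.1 z.2) 0; last by rewrite mulrC divfK.
    rewrite n_eq0 mul0r; have /andP[f00 f0le] := f0m z.
    have /andP[_ mn] := m1n z.1 z.2.
    by apply/eqP; rewrite eq_le f00 -n_eq0 (le_trans f0le).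
  move=> fm hm; have [F [F01 FE]] := lift f fm; have [H [H01 HE]] := lift h hm.
  rewrite -(eq_bform (fun _ _ => erefl) FE HE) -bform_push.
  rewrite (_ : bform _ _ _ = bform (fun i j => unif i * unif j * D (phi i) (phi j)) F H).
    by have := cut_le_nneg Da ler01 ler01 F01 H01; rewrite !mul1r.
  by apply: eq_bigr => i _; apply: eq_bigr => j _; ring.
move=> f h fm hm; have fP := cutP f fm; have hP := cutP h hm.
have -> : bform D f h = bform D (cut f) (cut h) +
    bform D (fun z => f z - cut f z) (cut h) + bform D f (fun z => h z - cut h z).
  by rewrite bformBl bformBr; ring.
have b1 : `|bform D (cut f) (cut h)| <= a.
  by apply: main => z; apply/andP; split; [have [] := fP z|have [] := fP z|have [] := hP z|have [] := hP z].
have small (u v : J * J' -> R) : (forall z, 0 <= u z <= m1 z.1 z.2 + m2 z.1 z.2) ->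
    (forall z, 0 <= v z <= m2 z.1 z.2) ->
    (\sum_z u z) * (\sum_z v z) <= d + d'.
  move=> u01 v01; apply: le_trans m2d; rewrite -[leRHS]mul1r -[X in _ <= X * _]msum.
  have u0 z : 0 <= u z by have /andP[] := u01 z.
  have v0 z : 0 <= v z by have /andP[] := v01 z.
  by apply: ler_pM; rewrite ?sumr_ge0//; apply: ler_sum => z _; [have /andP[] := u01 z|have /andP[] := v01 z].
have b2 : `|bform D (fun z => f z - cut f z) (cut h)| <= 2 * (d + d').
  apply: le_trans (bform_norm_le (ler0n _ 2) D2 _ _) _.
  - by move=> z; have [] := fP z.
  - by move=> z; have [] := hP z.
  rewrite -mulrA ler_pM2l// mulrC; apply: small => z.
    by have [-> h1 _ _] := hP z; rewrite (le_trans h1)// lerDl m20.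
  by have [_ _ -> ->] := fP z.
have b3 : `|bform D f (fun z => h z - cut h z)| <= 2 * (d + d').
  apply: le_trans (bform_norm_le (ler0n _ 2) D2 _ _) _.
  - by move=> z; have /andP[] := fm z.
  - by move=> z; have [] := hP z.
  rewrite -mulrA ler_pM2l//; apply: small => z; first exact: fm.
  by have [_ _ -> ->] := hP z.
apply: (le_trans (ler_normD _ _)); apply: (le_trans (lerD (ler_normD _ _) (lexx _))).
lra.
Qed.

(** w - w' is the residual of w, plus the difference of the cell averages, minus the residual of w',
    and each of the three forms sees only a pushforward of [s] and [t]. Subject to the marginal
    bounds, the mass may therefore be spread inside the cells in any way. *)
Lemma fine_cut (w : I -> I -> R) (w' : I' -> I' -> R) (e e' a : R) (m : J -> J' -> R)
    (s t : I * I' -> R) :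
  wcut_le p (fun x y => w x y - cw (c x) (c y)) e ->
  wcut_le p' (fun x y => w' x y - cw' (c' x) (c' y)) e' ->
  (forall f h : J * J' -> R, (forall z, 0 <= f z <= m z.1 z.2) ->
        (forall z, 0 <= h z <= m z.1 z.2) -> `|bform D f h| <= a) ->
  (forall z, 0 <= s z) -> (forall z, 0 <= t z) ->
  (forall x, push fst s x <= p x) -> (forall x, push fst t x <= p x) ->
  (forall x, push snd s x <= p' x) -> (forall x, push snd t x <= p' x) ->
  (forall z, push (fun y => (c y.1, c' y.2)) s z <= m z.1 z.2) ->
  (forall z, push (fun y => (c y.1, c' y.2)) t z <= m z.1 z.2) ->
  `|bform (fun z z' => w z.1 z'.1 - w' z.2 z'.2) s t| <= e + e' + a.
Proof.
move=> we we' Da s0 t0 s1 t1 s2 t2 sm tm.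
pose U x y := w x y - cw (c x) (c y); pose U' x y := w' x y - cw' (c' x) (c' y).
pose psi (y : I * I') := (c y.1, c' y.2).
have -> : bform (fun z z' => w z.1 z'.1 - w' z.2 z'.2) s t =
    bform (fun z z' => U z.1 z'.1) s t + bform (fun z z' => D (psi z) (psi z')) s t
    - bform (fun z z' => U' z.2 z'.2) s t.
  rewrite -bformN -!bformD_mx; apply: eq_bform => // z z'; rewrite /U /U' /D /psi/=; ring.
rewrite (bform_push U fst) (bform_push U' snd) (bform_push D psi).
have b1 : `|bform U (push fst s) (push fst t)| <= e.
  by apply: (wcut_le_sub we) => x; rewrite push_ge0//=.
have b2 : `|bform U' (push snd s) (push snd t)| <= e'.
  by apply: (wcut_le_sub we') => x; rewrite push_ge0//=.
have b3 : `|bform D (push psi s) (push psi t)| <= a.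
  by apply: Da => z; rewrite push_ge0//=.
apply: (le_trans (ler_normB _ _)); apply: (le_trans (lerD (ler_normD _ _) (lexx _))).
lra.
Qed.

End sample_coupling.

Section common_graph.
Context {R : realType} {I I' : finType} {k : nat}.
Variables (p : I -> R) (p' : I' -> R) (w : I -> I -> R) (w' : I' -> I' -> R).
Hypothesis p_ge0 : forall x, 0 <= p x.
Hypothesis p_sum1 : \sum_x p x = 1.
Hypothesis p'_ge0 : forall x, 0 <= p' x.
Hypothesis p'_sum1 : \sum_x p' x = 1.
Hypothesis w1 : forall x y, `|w x y| <= 1.
Hypothesis w'1 : forall x y, `|w' x y| <= 1.
Let graph := {ffun 'I_k * 'I_k -> bool}.

Lemma Ex_graph (J : finType) (r : J -> R) (u : J -> J -> R) (G : ('I_k * 'I_k -> bool) -> R) :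
  Ex (fun _ : 'I_k => r) (fun X => Ex (pg u X) G) =
  \sum_(g : graph) graph_weight r u g * G g.
Proof.
rewrite /Ex; under eq_bigr do rewrite big_distrr/=.
rewrite exchange_big/=; apply: eq_bigr => g _; rewrite /graph_weight /Ex big_distrl/=.
by apply: eq_bigr => X _; rewrite mulrA.
Qed.

(** Call [g] bad if [1 <= Z X g] for all X. By Markov's inequality the bad patterns have w-weight at
    most 1/4. If there were no common pattern, all others would be bad for [Z'], so of w'-weight at
    most 1/4 and of w-weight at most 1/2; the total weight 1 would be at most 3/4. *)
Lemma common_graph (Z : ('I_k -> I) -> ('I_k * 'I_k -> bool) -> R)
    (Z' : ('I_k -> I') -> ('I_k * 'I_k -> bool) -> R) :
  (forall X g, 0 <= Z X g) -> (forall X g, 0 <= Z' X g) ->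
  Ex (fun=> p) (fun X => Ex (pg w X) (Z X)) <= 4^-1 ->
  Ex (fun=> p') (fun X => Ex (pg w' X) (Z' X)) <= 4^-1 ->
  \sum_(g : graph) `|graph_weight p w g - graph_weight p' w' g| <= 4^-1 ->
  exists X X' g, Z X g < 1 /\ Z' X' g < 1.
Proof.
move=> Z0 Z'0 EZ EZ' dist; apply: contrapT => no.
have alt (g : graph) : (forall X, 1 <= Z X g) \/ (forall X, 1 <= Z' X g).
  have [?|/existsNP[X /negP ZX]] := pselect (forall X, 1 <= Z X g); [by left|right => X'].
  rewrite leNgt; apply/negP => Z'X'; apply: no.
  by exists X, X', g; rewrite ltNge.
pose Gam (g : 'I_k * 'I_k -> bool) : R := `[< forall X, 1 <= Z X g >]%:R.
have sum1 : \sum_(g : graph) graph_weight p w g = 1.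
  transitivity (\sum_(g : graph) graph_weight p w g * 1).
    by apply: eq_bigr => g _; rewrite mulr1.
  rewrite -(Ex_graph p w (fun=> 1)) (@Ex_eq _ _ _ _ _ (fun=> 1)).
    by rewrite (Ex_const (fun=> p_sum1)).
  by move=> X; rewrite (Ex_const (pg_sum1 w X)).
have b1 : \sum_(g : graph) graph_weight p w g * Gam g <= 4^-1.
  rewrite -Ex_graph; apply: le_trans EZ.
  apply: Ex_ler => [_|X]; first exact: p_ge0.
  apply: ler_sum => g _; apply: ler_wpM2l.
    by apply: prodr_ge0 => e _; apply: pg_ge0.
  by rewrite /Gam; case: asboolP => [|_]; [exact|exact: Z0].
have b2 : \sum_(g : graph) graph_weight p' w' g * (1 - Gam g) <= 4^-1.
  rewrite -(Ex_graph p' w' (fun g => 1 - Gam g)); apply: le_trans EZ'.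
  apply: Ex_ler => [_|X]; first exact: p'_ge0.
  apply: ler_sum => g _; apply: ler_wpM2l.
    by apply: prodr_ge0 => e _; apply: pg_ge0.
  rewrite /Gam; case: asboolP => [_|h]; first by rewrite subrr Z'0.
  by rewrite subr0; case: (alt g).
have b3 : \sum_(g : graph) (graph_weight p w g - graph_weight p' w' g) * (1 - Gam g) <= 4^-1.
  apply: le_trans dist; apply: ler_sum => g _.
  rewrite /Gam; case: asboolP => _; rewrite ?subrr ?mulr0 ?normr_ge0//.
  by rewrite subr0 mulr1 ler_norm.
have : \sum_(g : graph) graph_weight p w g = \sum_(g : graph) graph_weight p w g * Gam g +
   (\sum_(g : graph) graph_weight p' w' g * (1 - Gam g) +
   \sum_(g : graph) (graph_weight p w g - graph_weight p' w' g) * (1 - Gam g)).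
  by rewrite -!big_split/=; apply: eq_bigr => g _; ring.
by rewrite sum1 => ?; lra.
Qed.

End common_graph.

(** * Numerical bounds and part (b) for finite weighted sets *)

Section numerics.
Context {R : realType} (q k : nat) (y : R).
Hypothesis q40 : (40 <= q)%N.
Hypothesis k8q : (8 ^ q <= k)%N.
Hypothesis y_gt0 : 0 < y.
Hypothesis qy : q%:R * y ^+ 2 = 1.

Let t : R := y / 50.

(** 2^q is the factor by which 8^q exceeds 4^q; the left-hand side is what [excess_small] demands,
    as t^2 / 4 = 1 / (10^4 q). *)
Lemma pow2_ge : 16 * 10 ^+ 4 * q%:R * (5 + 4 * q%:R) <= 2 ^+ q :> R.
Proof.
suff H n : 16 * 10 ^+ 4 * (40 + n%:R) * (5 + 4 * (40 + n%:R)) <= 2 ^+ (40 + n) :> R.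
  by have := H (q - 40)%N; rewrite subnKC// natrB// addrC subrK.
elim: n => [|n IHn].
  by rewrite addn0 addr0; lra.
rewrite addnS [2 ^+ _.+1]exprS -[n.+1%:R]natr1; move: IHn (ler0n R n).
by move: (2 ^+ _) n%:R => A x IHn x0; have := sqr_ge0 x; lra.
Qed.

Let q_ge40 : 40 <= q%:R :> R. Proof. by rewrite ler_nat. Qed.

Lemma order_ge : 4 ^+ q * (16 * 10 ^+ 4 * q%:R * (5 + 4 * q%:R)) <= k%:R :> R.
Proof.
apply: (@le_trans _ _ (4 ^+ q * 2 ^+ q)).
  by rewrite ler_wpM2l ?exprn_ge0// pow2_ge.
by rewrite -exprMn -natrM -natrX ler_nat.
Qed.

Let four_pow_ge1 : 1 <= 4 ^+ q :> R. Proof. by rewrite exprn_ege1// ler1n. Qed.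

Lemma order_ge_lin : 26 * 10 ^+ 6 * q%:R <= k%:R :> R.
Proof.
apply: le_trans order_ge; apply: (@le_trans _ _ (16 * 10 ^+ 4 * q%:R * (5 + 4 * q%:R))).
  by move: q_ge40; move: q%:R => x ?; nra.
by rewrite ler_peMl// !mulr_ge0// addr_ge0// mulr_ge0.
Qed.

Let k_gt0 : 0 < k%:R :> R.
Proof. by apply: lt_le_trans order_ge_lin; have := q_ge40; lra. Qed.

Let y2E : y ^+ 2 = q%:R^-1.
Proof.
have q0 : q%:R != 0 :> R by rewrite gt_eqF//; have := q_ge40; lra.
by apply: (mulfI q0); rewrite qy mulfV.
Qed.

Lemma excess_small : 4 ^+ q * ((2 * 2) ^+ 2 * ((5 + 4 * q)%:R / k%:R)) <= t ^+ 2 / 4.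
Proof.
have q0 : 0 < q%:R :> R by have := q_ge40; lra.
rewrite /t [(y / 50) ^+ 2]exprMn y2E natrD natrM.
rewrite (_ : _ * (_ * _) = (4 ^+ q * (16 * (5 + 4 * q%:R))) / k%:R); last by field; rewrite gt_eqF.
rewrite ler_pdivrMr// (_ : q%:R^-1 * _ / 4 * _ = k%:R / (10 ^+ 4 * q%:R)); last first.
  by field; rewrite gt_eqF.
rewrite ler_pdivlMr ?mulr_gt0//; apply: le_trans order_ge.
by rewrite le_eqVlt; apply/orP; left; apply/eqP; ring.
Qed.

Lemma count_small : 4 ^+ q / k%:R <= t ^+ 2 / 4.
Proof.
apply: le_trans excess_small; rewrite ler_wpM2l ?exprn_ge0// natrD natrM mulrA.
by rewrite ler_peMl ?invr_ge0 ?(ltW k_gt0)//; have := q_ge40; lra.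
Qed.

(** The tilt t / 64 maximises s t - 32 s^2 over s, with maximum t^2 / 128. The exponent is then of
    order k^2 / q, against 16 * 2 * 4^k = 2^(2k + 5). *)
Lemma noise_small : 2 * 4 ^+ k <=
  expR (k%:R ^+ 2 * (t / 64 * t - 32 * (t / 64) ^+ 2)) / 16 :> R.
Proof.
have e2 : 2 <= expR 1 :> R by have := @expR_ge1Dx R 1; lra.
have q0 : 0 < q%:R :> R by have := q_ge40; lra.
rewrite ler_pdivlMr//.
apply: (@le_trans _ _ (expR 1 ^+ (2 * k + 5))).
  apply: (@le_trans _ _ (2 ^+ (2 * k + 5))); last by rewrite lerXn2r// nnegrE; lra.
  rewrite exprD exprM (_ : 2 ^+ 2 = 4); last by ring.
  by rewrite le_eqVlt; apply/orP; left; apply/eqP; ring.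
rewrite -expRM_natl mulr1 ler_expR natrD natrM.
rewrite (_ : _ * (_ - _) = k%:R ^+ 2 * y ^+ 2 / (32 * 10 ^+ 4)); last by rewrite /t; field.
rewrite y2E (_ : _ / _ / _ = k%:R ^+ 2 / (32 * 10 ^+ 4 * q%:R)); last first.
  by field; rewrite gt_eqF.
rewrite ler_pdivlMr ?mulr_gt0 ?exprn_gt0//.
by have := order_ge_lin; have := q_ge40; nra.
Qed.

Lemma tail_small : k%:R^-1 <= 3 / 100 * y.
Proof.
have q0 : 0 < q%:R :> R by have := q_ge40; lra.
have y1 : y <= 1.
  by rewrite -(@expr_le1 _ 2)// ?(ltW y_gt0)// y2E invf_le1//; have := q_ge40; lra.
have yq : 1 <= q%:R * y.
  have : q%:R * y ^+ 2 <= q%:R * y by rewrite ler_pM2l// expr2 ler_piMl// ltW.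
  by rewrite qy.
rewrite -(ler_pM2r k_gt0) mulVf ?gt_eqF//.
by have := order_ge_lin; have := q_ge40; nra.
Qed.

End numerics.

Section good_sample.
Context {R : realType} {I J : finType} {k q : nat}.
Variables (p : I -> R) (w : I -> I -> R) (c : I -> J) (y : R).
Hypothesis p_ge0 : forall x, 0 <= p x.
Hypothesis p_sum1 : \sum_x p x = 1.
Hypothesis w_sym : forall x z, w x z = w z x.
Hypothesis w1 : forall x z, `|w x z| <= 1.
Hypothesis q40 : (40 <= q)%N.
Hypothesis k8q : (8 ^ q <= k)%N.
Hypothesis y_gt0 : 0 < y.
Hypothesis qy : q%:R * y ^+ 2 = 1.
Hypothesis cJ : (#|J| <= 4 ^ q)%N.
Let U := residual p c w.
Hypothesis cut_U : wcut_le p U y.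
Let t : R := y / 50.

(** [Z] adds four nonnegative variables of mean at most 1/16 each: the excess of the residual, that
    of its negative, the deviation of the cell frequencies and the sign noise. If the sum is below
    1, so is each of them, and each then gives its share of the conclusion. *)
Lemma good_sample : exists Z : ('I_k -> I) -> ('I_k * 'I_k -> bool) -> R,
  [/\ forall X g, 0 <= Z X g,
      Ex (fun=> p) (fun X => Ex (pg w X) (Z X)) <= 4^-1
    & forall X g, Z X g < 1 ->
      [/\ forall S T, `|ubform (fun i j => U (X i) (X j)) S T| <= 5 * y + 2 * t,
          forall S T, `|ubform (fun i j => w (X i) (X j) - sgraph g i j) S T| <=
            t + k%:R^-1
        & \sum_j `|freq c X j - mass p c j| <= 2 * t]].
Proof.
have k_gt0 : (0 < k)%N by apply: leq_trans k8q; rewrite expn_gt0.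
have V0 : (0 < #|'I_k|)%N by rewrite card_ord.
have q_gt0 : (0 < q)%N by apply: leq_trans q40.
have t_gt0 : 0 < t by rewrite divr_gt0.
have t4_gt0 : 0 < 4 * t ^+ 2 by rewrite mulr_gt0// exprn_gt0.
have t64_gt0 : 0 < t / 64 by rewrite divr_gt0.
have y_le1 : y <= 1.
  rewrite -(@expr_le1 _ 2)// ?(ltW y_gt0)// -qy ler_peMl ?sqr_ge0//.
  by rewrite ler1n.
have t8 : t / 64 <= 8^-1 by rewrite /t; lra.
have t8' : `|t / 64| <= 8^-1 by rewrite gtr0_norm.
pose gam : R := expR (k%:R ^+ 2 * (t / 64 * t - 32 * (t / 64) ^+ 2)).
have gam_gt0 : 0 < gam by exact: expR_gt0.
pose U' x z := - U x z.
have U2 x z : `|U x z| <= 2.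
  apply: (le_trans (ler_normB _ _)).
  by have := w1 x z; have := cell_avg_le p_ge0 c ler01 w1 (c x) (c z); lra.
have U'2 x z : `|U' x z| <= 2 by rewrite normrN.
have cut_U' : wcut_le p U' y.
  move=> S T; rewrite (_ : bform _ _ _ = - bform (fun x z => p x * p z * U x z)
    (fun x => (S x)%:R) (fun x => (T x)%:R)) ?normrN//.
  by rewrite -bformN; apply: eq_bform => // x z; rewrite /U' mulrN.
(* Residuals have size at most 2, so the sampled rows need 2^2 <= q s^2, that is s = 2y; the sampled
   cut bound then starts from y + 2s = 5y. *)
have s_gt0 : 0 < 2 * y by rewrite mulr_gt0.
have Bqs : 2 ^+ 2 <= q%:R * (2 * y) ^+ 2.
  by rewrite exprMn mulrCA qy mulr1.
pose Z (X : 'I_k -> I) (g : 'I_k * 'I_k -> bool) : R := excess p U q X / (4 * t ^+ 2) + excess p U' q X / (4 * t ^+ 2) +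
  #|J|%:R * count_dev p c X / (4 * t ^+ 2) + noise w (t / 64) X g / gam.
have Z1 (X : 'I_k -> I) : 0 <= excess p U q X / (4 * t ^+ 2) by apply: divr_ge0; [exact: (excess_ge0 V0)|exact: (ltW t4_gt0)].
have Z2 (X : 'I_k -> I) : 0 <= excess p U' q X / (4 * t ^+ 2) by apply: divr_ge0; [exact: (excess_ge0 V0)|exact: (ltW t4_gt0)].
have Z3 (X : 'I_k -> I) : 0 <= #|J|%:R * count_dev p c X / (4 * t ^+ 2).
  by apply: divr_ge0 (ltW t4_gt0); rewrite mulr_ge0 ?count_dev_ge0.
have Z4 (X : 'I_k -> I) g : 0 <= noise w (t / 64) X g / gam.
  by rewrite divr_ge0 ?(ltW gam_gt0)// noise_ge0.
exists Z; split.
- by move=> X g; rewrite /Z !addr_ge0.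
- have Eg (X : 'I_k -> I) : Ex (pg w X) (Z X) = (4 * t ^+ 2)^-1 * excess p U q X +
      (4 * t ^+ 2)^-1 * excess p U' q X + #|J|%:R / (4 * t ^+ 2) * count_dev p c X +
      2 * 4 ^+ k / gam.
    transitivity (Ex (pg w X) (fun g => ((4 * t ^+ 2)^-1 * excess p U q X +
      (4 * t ^+ 2)^-1 * excess p U' q X + #|J|%:R / (4 * t ^+ 2) * count_dev p c X) +
      gam^-1 * noise w (t / 64) X g)).
      by apply: Ex_eq => g; rewrite /Z; ring.
    by rewrite ExD ExZ (Ex_const (pg_sum1 w X)) noise_mean [_ / gam]mulrC.
  rewrite (Ex_eq _ Eg) !ExD !ExZ (Ex_const (fun _ : 'I_k => p_sum1)).
  have e1 : (4 * t ^+ 2)^-1 * Ex (fun=> p) (excess (V := 'I_k) p U q) <= 16^-1.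
    rewrite ler_pdivrMl//; apply: (le_trans (excess_mean V0 p_ge0 p_sum1 q U2)).
    by rewrite card_ord; apply: (le_trans (excess_small q40 k8q qy)); rewrite -/t; lra.
  have e2 : (4 * t ^+ 2)^-1 * Ex (fun=> p) (excess (V := 'I_k) p U' q) <= 16^-1.
    rewrite ler_pdivrMl//; apply: (le_trans (excess_mean V0 p_ge0 p_sum1 q U'2)).
    by rewrite card_ord; apply: (le_trans (excess_small q40 k8q qy)); rewrite -/t; lra.
  have e3 : #|J|%:R / (4 * t ^+ 2) * Ex (fun _ : 'I_k => p) (count_dev p c) <= 16^-1.
    rewrite mulrAC ler_pdivrMr//.
    apply: (@le_trans _ _ (4 ^+ q / k%:R)).
      apply: ler_pM; rewrite ?ler0n//.
      - by apply: Ex_ge0 => // X; exact: count_dev_ge0.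
      - by rewrite -natrX ler_nat.
      - by have := count_dev_mean V0 p_sum1 c; rewrite card_ord.
    by apply: (le_trans (count_small q40 k8q qy)); rewrite -/t; lra.
  have e4 : 2 * 4 ^+ k / gam <= 16^-1.
    by rewrite ler_pdivrMr// [16^-1 * _]mulrC; exact: (noise_small q40 k8q qy).
  by lra.
move=> X g ZX.
have [z1 z2 z3 z4] : [/\ excess p U q X / (4 * t ^+ 2) < 1,
    excess p U' q X / (4 * t ^+ 2) < 1,
    #|J|%:R * count_dev p c X / (4 * t ^+ 2) < 1 & noise w (t / 64) X g / gam < 1].
  move: ZX (Z1 X) (Z2 X) (Z3 X) (Z4 X g); rewrite /Z.
  by move: (_ / _) (_ / _) (_ / _) (_ / _) => a1 a2 a3 a4 *; split; lra.
have small x : x / (4 * t ^+ 2) < 1 -> x / (4 * t) <= t.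
  rewrite ltr_pdivrMr// mul1r => /ltW h.
  have t4'_gt0 : 0 < 4 * t by rewrite mulr_gt0.
  by rewrite ler_pdivrMr// mulrCA -expr2.
split.
- move=> S T; rewrite ler_norml; apply/andP; split.
    rewrite lerNl (_ : - _ = ubform (fun i j => U' (X i) (X j)) S T).
      apply: (le_trans (sample_cut_le V0 U'2 s_gt0 q_gt0 Bqs cut_U' X S T t_gt0)).
      by have := small _ z2; lra.
    by rewrite /ubform -bformN; apply: eq_bform => // i j; rewrite /U' mulrN.
  apply: (le_trans (sample_cut_le V0 U2 s_gt0 q_gt0 Bqs cut_U X S T t_gt0)).
  by have := small _ z1; lra.
- move=> S T; apply: sgraph_cut_le => //.
  apply: (noise_cut w1 S T t64_gt0 t8).
  by move: z4; rewrite ltr_pdivrMr// mul1r.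
- apply: (le_trans (freq_dev_le p_sum1 c X t_gt0)).
  by have := small _ z3; lra.
Qed.

End good_sample.

Section finite_inverse_counting.
Context {R : realType} {I I' : finType} {k q : nat}.
Variables (p : I -> R) (p' : I' -> R) (w : I -> I -> R) (w' : I' -> I' -> R).
Variables (y d : R).
Hypothesis p_ge0 : forall x, 0 <= p x.
Hypothesis p_sum1 : \sum_x p x = 1.
Hypothesis p'_ge0 : forall x, 0 <= p' x.
Hypothesis p'_sum1 : \sum_x p' x = 1.
Hypothesis w_sym : forall x z, w x z = w z x.
Hypothesis w'_sym : forall x z, w' x z = w' z x.
Hypothesis w1 : forall x z, `|w x z| <= 1.
Hypothesis w'1 : forall x z, `|w' x z| <= 1.
Hypothesis q40 : (40 <= q)%N.
Hypothesis k8q : (8 ^ q <= k)%N.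
Hypothesis y_gt0 : 0 < y.
Hypothesis qy : q%:R * y ^+ 2 = 1.
Hypothesis close : forall D : {set 'I_k * 'I_k}, [forall e in D, (e.1 < e.2)%N] ->
  `|set_density p w D - set_density p' w' D| <= d.
Hypothesis d_small : 2 ^+ (k * k) * d <= 4^-1.

(** The coupling is given on the cells only; the bound holds for all [s] and [t] compatible with it,
    and two sets in a coupled pair of graphons supply such weights. *)
Lemma finite_inverse_counting : exists (J J' : finType) (c : I -> J) (c' : I' -> J')
    (m : J -> J' -> R),
  [/\ forall j j', 0 <= m j j', forall j, \sum_j' m j j' = mass p c j,
      forall j', \sum_j m j j' = mass p' c' j'
    & forall s t : I * I' -> R,
      (forall z, 0 <= s z) -> (forall z, 0 <= t z) ->
      (forall x, push fst s x <= p x) -> (forall x, push fst t x <= p x) ->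
      (forall x, push snd s x <= p' x) -> (forall x, push snd t x <= p' x) ->
      (forall z, push (fun y => (c y.1, c' y.2)) s z <= m z.1 z.2) ->
      (forall z, push (fun y => (c y.1, c' y.2)) t z <= m z.1 z.2) ->
      `|bform (fun z z' => w z.1 z'.1 - w' z.2 z'.2) s t| <= 25 / 2 * y].
Proof.
have q_gt0 : (0 < q)%N by apply: leq_trans q40.
have k_gt0 : (0 < k)%N by apply: leq_trans k8q; rewrite expn_gt0.
have V0 : (0 < #|'I_k|)%N by rewrite card_ord.
have qy1 : 1 <= q%:R * y ^+ 2 by rewrite qy.
have [J [c [cJ /(_ y (ltW y_gt0) qy1) cutU]]] := weak_regularity p_ge0 p_sum1 q_gt0 w1.
have [J' [c' [cJ' /(_ y (ltW y_gt0) qy1) cutU']]] :=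
  weak_regularity p'_ge0 p'_sum1 q_gt0 w'1.
have [Z [Z0 EZ goodZ]] := good_sample p_ge0 p_sum1 w_sym w1 q40 k8q y_gt0 qy cJ cutU.
have [Z' [Z'0 EZ' goodZ']] :=
  good_sample p'_ge0 p'_sum1 w'_sym w'1 q40 k8q y_gt0 qy cJ' cutU'.
have dist := le_trans (graph_weight_dist close) d_small.
have [X [X' [g [ZX ZX']]]] :=
  common_graph p_ge0 p_sum1 p'_ge0 w1 w'1 Z0 Z'0 EZ EZ' dist.
have [sU sG sF] := goodZ X g ZX; have [sU' sG' sF'] := goodZ' X' g ZX'.
pose cw := cell_avg p c w; pose cw' := cell_avg p' c' w'.
have cw1 j l : `|cw j l| <= 1 by exact: cell_avg_le.
have cw'1 j l : `|cw' j l| <= 1 by exact: cell_avg_le.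
set t := y / 50 in sU sG sF sU' sG' sF'.
(* [a] adds up the four comparisons that lead from [cw] to w(X), to [g], to w'(X') and to [cw']. *)
pose a := 2 * (5 * y + 2 * t) + 2 * (t + k%:R^-1).
have sD S T : `|ubform (fun i j => cw (c (X i)) (c (X j)) -
    cw' (c' (X' i)) (c' (X' j))) S T| <= a.
  have -> : ubform (fun i j => cw (c (X i)) (c (X j)) - cw' (c' (X' i)) (c' (X' j))) S T
    = - ubform (fun i j => residual p c w (X i) (X j)) S T
      + ubform (fun i j => w (X i) (X j) - sgraph g i j) S T
      - ubform (fun i j => w' (X' i) (X' j) - sgraph g i j) S T
      + ubform (fun i j => residual p' c' w' (X' i) (X' j)) S T.
    rewrite /ubform -!bformN -!bformD_mx; apply: eq_bform => // i j.
    by rewrite /residual -/cw -/cw'; ring.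
  move: (sU S T) (sG S T) (sU' S T) (sG' S T); rewrite /a !ler_norml.
  by move=> /andP[? ?] /andP[? ?] /andP[? ?] /andP[? ?]; apply/andP; split; lra.
have [m [m0 row col mcut]] := sample_coupling V0 p_ge0 p_sum1 p'_ge0 p'_sum1 cw1 cw'1
  sD sF sF'.
exists J, J', c, c', m; split => // s u s0 u0 s1 u1 s2 u2 sm um.
apply: (le_trans (fine_cut cutU cutU' mcut s0 u0 s1 u1 s2 u2 sm um)).
by have := tail_small q40 k8q y_gt0 qy; rewrite /a /t; lra.
Qed.

End finite_inverse_counting.

(** * Step functions and graphons *)

Section finite_partition.
Context d (T : measurableType d) (R : realType) (Phi : finType) (rho : T -> Phi).
Hypothesis mrho : forall i, measurable (rho @^-1` [set i]).

Lemma measurable_fin_preimage (B : set Phi) : measurable (rho @^-1` B).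
Proof.
rewrite (_ : _ @^-1` _ = \bigcup_(i in B) rho @^-1` [set i]).
  exact: fin_bigcup_measurable.
by apply/seteqP; split => [x Bx|x [i Bi /= ->]//]; exists (rho x).
Qed.

Lemma measurable_fun_fin d' (U : measurableType d') (G : Phi -> U) (D : set T) :
  measurable_fun D (fun x => G (rho x)).
Proof.
move=> mD Y _; apply: measurableI => //.
exact: (measurable_fin_preimage (G @^-1` Y)).
Qed.

End finite_partition.

Section step_approximation.
Context d (T : measurableType d) (R : realType) (P : probability T R).
Implicit Types f g : T * T -> R.

Definition cells (I : finType) (pi : T -> I) := forall i, measurable (pi @^-1` [set i]).

Lemma cells_pair (I J : finType) (pi : T -> I) (pi' : T -> J) :
  cells pi -> cells pi' -> cells (fun x => (pi x, pi' x)).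
Proof.
move=> c c' [i j]; rewrite (_ : _ @^-1` _ = pi @^-1` [set i] `&` pi' @^-1` [set j]).
  exact: measurableI.
by apply/seteqP; split => x /= [-> ->].
Qed.

Lemma measurable_cells2 (I : finType) (pi : T -> I) : cells pi ->
  forall ij, measurable ((fun z : T * T => (pi z.1, pi z.2)) @^-1` [set ij]).
Proof.
move=> c [i j]; rewrite (_ : _ @^-1` _ = pi @^-1` [set i] `*` pi @^-1` [set j]).
  exact: measurableX.
by apply/seteqP; split => -[x y] /= [-> ->].
Qed.

Definition step2 (I : finType) (pi : T -> I) (h : I -> I -> R) (z : T * T) : R :=
  h (pi z.1) (pi z.2).

Lemma measurable_step2 (I : finType) (pi : T -> I) (h : I -> I -> R) :
  cells pi -> measurable_fun setT (step2 pi h).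
Proof.
move=> c.
exact: (measurable_fun_fin (measurable_cells2 c) (fun ij => h ij.1 ij.2)).
Qed.

Definition dist1 f g : \bar R := (\int[P \x P]_z `|f z - g z|%:E)%E.

Let measurable_dist f g : measurable_fun setT f -> measurable_fun setT g ->
  measurable_fun setT (fun z => (`|f z - g z| : R)%:E).
Proof.
by move=> mf mg; apply/measurable_EFinP/measurableT_comp => //; exact: measurable_funB.
Qed.

Lemma dist1_leD f g f1 g1 f2 g2 (K : R) : 0 <= K ->
  measurable_fun setT f -> measurable_fun setT g ->
  measurable_fun setT f1 -> measurable_fun setT g1 ->
  measurable_fun setT f2 -> measurable_fun setT g2 ->
  (forall z, `|f z - g z| <= K * (`|f1 z - g1 z| + `|f2 z - g2 z|)) ->
  (dist1 f g <= K%:E * (dist1 f1 g1 + dist1 f2 g2))%E.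
Proof.
move=> K0 mf mg mf1 mg1 mf2 mg2 le.
rewrite /dist1 -ge0_integralD//; last 2 first.
- exact: measurable_dist.
- exact: measurable_dist.
rewrite -ge0_integralZl//; last 2 first.
- by apply: emeasurable_funD; exact: measurable_dist.
- by move=> z _; rewrite -EFinD lee_fin addr_ge0.
apply: ge0_le_integral => //.
- exact: measurable_dist.
- apply: measurable_funeM; apply: emeasurable_funD; exact: measurable_dist.
- by move=> z _; rewrite -EFinD -EFinM lee_fin.
Qed.

Lemma dist1_triangle f g h : measurable_fun setT f -> measurable_fun setT g ->
  measurable_fun setT h -> (dist1 f h <= dist1 f g + dist1 g h)%E.
Proof.
move=> mf mg mh; rewrite -[leRHS]mul1e; apply: dist1_leD => // z.
by rewrite mul1r; apply: le_trans (ler_normD _ _); rewrite addrA subrK.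
Qed.

Lemma dist1_cst_le f g (e : R) : measurable_fun setT f -> measurable_fun setT g ->
  (forall z, `|f z - g z| <= e) -> (dist1 f g <= e%:E)%E.
Proof.
move=> mf mg le.
apply: (@le_trans _ _ (\int[P \x P]_z (cst e%:E z))%E).
  apply: ge0_le_integral => //.
  - exact: measurable_dist.
  - by move=> z _; rewrite lee_fin.
by rewrite integral_cst// [X in (_ * X)%E]probability_setT mule1.
Qed.

Definition approximable f := forall e : R, 0 < e ->
  exists (I : finType) (pi : T -> I) (h : I -> I -> R),
    cells pi /\ (dist1 f (step2 pi h) <= e%:E)%E.

Lemma approximable_comp2 f g (phi : R -> R -> R) (K : R) : 0 < K ->
  measurable_fun setT f -> measurable_fun setT g ->
  measurable_fun setT (fun z => phi (f z) (g z)) ->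
  (forall a b a' b', `|phi a b - phi a' b'| <= K * (`|a - a'| + `|b - b'|)) ->
  approximable f -> approximable g -> approximable (fun z => phi (f z) (g z)).
Proof.
move=> K0 mf mg mphi lip af ag e e0.
have e2 : 0 < e / 2 / K by rewrite !divr_gt0.
have [I [pi [h [c fh]]]] := af _ e2; have [J [pi' [h' [c' gh']]]] := ag _ e2.
exists (I * J)%type, (fun x => (pi x, pi' x)),
  (fun i j => phi (h i.1 j.1) (h' i.2 j.2)); split; first exact: cells_pair.
apply: (le_trans (dist1_leD (ltW K0) mphi (measurable_step2 _ (cells_pair c c'))
  mf (measurable_step2 h c) mg (measurable_step2 h' c') _)).
  by move=> z; exact: lip.
rewrite -lee_pdivlMl// (le_trans (leeD fh gh'))// -EFinD lee_fin.
by rewrite le_eqVlt; apply/orP; left; apply/eqP; field; rewrite gt_eqF.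
Qed.

Lemma approximable_lim f : measurable_fun setT f ->
  (forall e : R, 0 < e -> exists g, [/\ measurable_fun setT g, approximable g
     & (dist1 f g <= e%:E)%E]) -> approximable f.
Proof.
move=> mf lim e e0; have e2 : 0 < e / 2 by rewrite divr_gt0.
have [g [mg ag fg]] := lim _ e2; have [I [pi [h [c gh]]]] := ag _ e2.
exists I, pi, h; split => //.
apply: (le_trans (dist1_triangle mf mg (measurable_step2 h c))).
by apply: (le_trans (leeD fg gh)); rewrite -EFinD lee_fin -splitr.
Qed.

Lemma approximable_step (I : finType) (pi : T -> I) (h : I -> I -> R) :
  cells pi -> approximable (step2 pi h).
Proof.
move=> c e e0; exists I, pi, h; split => //.
by apply: dist1_cst_le => [||z]; rewrite ?subrr ?normr0 ?ltW//; exact: measurable_step2.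
Qed.

Lemma approximable_cst a : approximable (fun=> a).
Proof.
apply: (@approximable_step unit (fun=> tt) (fun _ _ => a)) => i.
rewrite (_ : _ @^-1` _ = setT)//.
by apply/seteqP; split => x //= _; case: i.
Qed.

(** The sets with approximable indicator contain the measurable rectangles and are closed under
    complements and countable unions: finite unions use the maximum of two indicators, countable
    ones continuity of the measure from above. *)
Lemma approximable_indic (A : set (T * T)) : measurable A -> approximable (\1_A : T * T -> R).
Proof.
suff : (@measurable _ (T * T)%type) `<=`
    [set A | measurable A /\ approximable (\1_A : T * T -> R)].
  by move=> sub /sub[].
clear A.
rewrite [X in X `<=` _]measurable_prod_measurableType; apply: smallest_sub; last first.
  move=> _ [A mA [B mB <-]]; split; first exact: measurableX.
  pose pi x := (x \in A, x \in B).
  have mpi (C : set T) : measurable C -> cells (fun x => x \in C).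
    move=> mC [].
      rewrite (_ : _ @^-1` _ = C)//; apply/seteqP.
      by split => x /= => [/set_mem|/mem_set].
    rewrite (_ : _ @^-1` _ = ~` C); first exact: measurableC.
    apply/seteqP; split => x /=; first by move=> /negbT; rewrite notin_setE.
    by move=> Cx; apply/negbTE; rewrite notin_setE.
  rewrite (_ : \1_(A `*` B) = step2 pi (fun a b => (a.1 && b.2)%:R)).
    by apply: approximable_step; apply: cells_pair; exact: mpi.
  by apply/funext => -[x y]; rewrite indicE in_setX.
split.
- split; first exact: measurable0.
  by rewrite indic0; exact: approximable_cst.
- move=> A [mA aA]; split; first exact: measurableD.
  rewrite (_ : \1_(setT `\` A) = fun z => (1 - \1_A z) : R); last first.
    by apply/funext => z; rewrite !indicE in_setD in_setT/=; case: (z \in A); rewrite /= ?subrr ?subr0.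
  have m1 : measurable_fun setT (\1_A : T * T -> R) by exact: measurable_indic.
  apply: (@approximable_comp2 (\1_A) (\1_A) (fun a _ => 1 - a) 1) => //.
    exact: measurable_funB.
  move=> a b a' b'; rewrite mul1r (_ : 1 - a - (1 - a') = - (a - a')); last by ring.
  by rewrite normrN lerDl.
- move=> A mA.
  have mU n : measurable (\big[setU/set0]_(i < n) A i).
    by apply: bigsetU_measurable => i _; have [] := mA i.
  have mUA : measurable (\bigcup_k A k) by apply: bigcupT_measurable => i; have [] := mA i.
  have mind (B : set (T * T)) : measurable B -> measurable_fun setT (\1_B : T * T -> R).
    by move=> mB; exact: measurable_indic.
  have aU n : approximable (\1_(\big[setU/set0]_(i < n) A i) : T * T -> R).
    elim: n => [|n IHn]; first by rewrite big_ord0 indic0; exact: approximable_cst.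
    rewrite big_ord_recr/=.
    set B := \big[setU/set0]_(i < n) A i in IHn *.
    rewrite (_ : \1_(B `|` A n) = fun z => Num.max (\1_B z) (\1_(A n) z) : R); last first.
      apply/funext => z; rewrite !indicE in_setU.
      by case: (z \in B); case: (z \in A n); rewrite /= /Order.max ?ltxx ?ltr01 ?ltr10.
    have mB : measurable B by exact: mU.
    have [mAn aAn] := mA n.
    apply: (@approximable_comp2 (\1_B) (\1_(A n)) Num.max 1) => //; try exact: mind.
      by apply: measurable_maxr; exact: mind.
    move=> a b a' b'; rewrite mul1r.
    have := ler_norm (a - a'); have := ler_norm (- (a - a')).
    have := ler_norm (b - b'); have := ler_norm (- (b - b')); rewrite !normrN.
    have := normr_ge0 (a - a'); have := normr_ge0 (b - b').
    by rewrite ler_norml; case: (leP a b); case: (leP a' b') => *; apply/andP; split; lra.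
  split => //; apply: approximable_lim => [|e e0]; first exact: mind.
  set U := \bigcup_k A k in mUA *.
  pose D n := U `\` \big[setU/set0]_(i < n) A i.
  have mD n : measurable (D n) by exact: measurableD.
  have D0 : \bigcap_n D n = set0.
    apply/seteqP; split => // z Dz; have [[k _ Akz] _] := Dz 0%N I.
    have [_] := Dz k.+1 I; apply.
    by rewrite -bigcup_mkord; exists k => //=.
  have cvgD : (P \x P)%E \o D @ \oo --> (P \x P)%E (\bigcap_n D n).
    apply: nonincreasing_cvg_mu => //.
    - apply: (@le_lt_trans _ _ ((P \x P)%E setT)); first by rewrite le_measure ?inE.
      by rewrite [X in (X < _)%E]probability_setT ltry.
    - by rewrite D0.
    - move=> n n' nn'; apply/subsetPset; apply: setDS.
      exact: subset_bigsetU.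
  have [n Dn] : exists n, ((P \x P)%E (D n) <= e%:E)%E.
    apply: contrapT => no; have : (e%:E <= (P \x P)%E (\bigcap_n D n))%E.
      apply: (cvge_to_ge cvgD); apply: nearW => n; rewrite leNgt; apply/negP => lt.
      by apply: no; exists n; exact: ltW.
    by rewrite D0 measure0 lee_fin leNgt e0.
  exists (\1_(\big[setU/set0]_(i < n) A i)); split; [exact: (mind _ (mU n))|exact: aU|].
  rewrite /dist1 (_ : (fun z => _) = (fun z => (\1_(D n) z)%:E)).
    by rewrite integral_indic// setIT.
  apply/funext => z; congr (_%:E); rewrite !indicE /D in_setD.
  have sub : \big[setU/set0]_(i < n) A i `<=` U by exact: bigsetU_bigcup.
  case: (boolP (z \in \big[setU/set0]_(i < n) A i)) => [zU|zU].
    by rewrite (mem_set (sub _ (set_mem zU))) subrr normr0.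
  by rewrite subr0 andbT ger0_norm.
Qed.

(** f is within [e] of the simple function with values e m - C on the level sets [A m]; [N] exceeds
    every level, as u <= 2C / e. *)
Lemma approximable_bounded f (C : R) : measurable_fun setT f ->
  (forall z, `|f z| <= C) -> approximable f.
Proof.
move=> mf fC; apply: approximable_lim => // e e0.
have C0 : 0 <= C by exact: le_trans (fC (point, point)).
pose N := (Num.truncn (2 * C / e)).+1.
pose u z := (f z + C) / e.
have u0 z : 0 <= u z.
  by have := fC z; rewrite ler_norml => /andP[? _]; rewrite divr_ge0 ?(ltW e0)//; lra.
pose A (m : nat) := [set z | m%:R <= u z < m.+1%:R].
have mA m : measurable (A m).
  rewrite (_ : A m = u @^-1` `[m%:R, m.+1%:R[%classic); last first.
    by apply/seteqP; split => z /=; rewrite in_itv.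
  rewrite -[X in measurable X]setTI.
  apply: (_ : measurable_fun setT u) => //.
  by apply: measurable_funM => //; exact: measurable_funD.
pose S n z : R := \sum_(m < n) m%:R * \1_(A m) z.
have mS n : measurable_fun setT (S n).
  by apply: measurable_sum => m; apply: measurable_funM.
have aS n : approximable (S n).
  elim: n => [|n IHn].
    rewrite (_ : S 0%N = fun=> 0); first exact: approximable_cst.
    by apply/funext => z; rewrite /S big_ord0.
  rewrite (_ : S n.+1 = fun z => S n z + n%:R * \1_(A n) z); last first.
    by apply/funext => z; rewrite /S big_ord_recr.
  have K1 : 0 < 1 + n%:R :> R by rewrite ltr_pwDl.
  have mI : measurable_fun setT (\1_(A n) : T * T -> R) by exact: measurable_indic.
  have mphi : measurable_fun setT (fun z => S n z + n%:R * \1_(A n) z).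
    by apply: measurable_funD => //; exact: measurable_funM.
  apply: (approximable_comp2 (phi := fun a b => a + n%:R * b) K1 (mS n) mI mphi _ IHn
    (approximable_indic (mA n))) => a b a' b'.
  rewrite (_ : _ - _ = (a - a') + n%:R * (b - b')); last by ring.
  apply: (le_trans (ler_normD _ _)); rewrite normrM normr_nat.
  have := ler0n R n; have := normr_ge0 (a - a'); have := normr_ge0 (b - b'); nra.
exists (fun z => e * S N z - C); split.
- by apply: measurable_funB => //; exact: measurable_funM.
- apply: (@approximable_comp2 (S N) (S N) (fun a _ => e * a - C) e) => //.
    by apply: measurable_funB => //; exact: measurable_funM.
  move=> a b a' b'; rewrite (_ : _ - _ = e * (a - a')); last by ring.
  by rewrite normrM gtr0_norm// ler_wpM2l ?(ltW e0)// lerDl.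
apply: dist1_cst_le => //.
  by apply: measurable_funB => //; exact: measurable_funM.
move=> z; pose t := Num.truncn (u z).
have /andP[tu ut] : t%:R <= u z < t.+1%:R by exact: truncn_itv.
have tN : (t < N)%N.
  rewrite -(ltr_nat R); apply: (le_lt_trans tu).
  have /truncn_itv/andP[_] : 0 <= 2 * C / e by rewrite divr_ge0 ?mulr_ge0 ?(ltW e0).
  apply: le_lt_trans; rewrite ler_pM2r ?invr_gt0//.
  by have := fC z; rewrite ler_norml => /andP[_ ?]; lra.
have -> : S N z = t%:R.
  rewrite /S (bigD1 (Ordinal tN))//= indicE mem_set/= ?mulr1; last by rewrite /A/= tu ut.
  rewrite big1 ?addr0// => m /negP mt; rewrite indicE memNset ?mulr0//.
  move=> /andP[mu um]; apply: mt; apply/eqP/val_inj/eqP => /=.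
  rewrite eqn_leq; apply/andP; split; rewrite -ltnS -(ltr_nat R).
    exact: le_lt_trans mu ut.
  exact: le_lt_trans tu um.
have -> : f z - (e * t%:R - C) = e * (u z - t%:R).
  by rewrite /u; field; rewrite gt_eqF.
rewrite normrM gtr0_norm// ler_piMr ?(ltW e0)//.
by move: ut; rewrite -natr1 ger0_norm ?subr_ge0// => ?; lra.
Qed.

End step_approximation.

Section product_laws.
Context d (T : measurableType d) (R : realType) (P : probability T R).

(** A product measure is determined by its values on rectangles. This serves for exchanging
    coordinates, for two coordinates of the cube and for both projections of a squared coupling. *)
Lemma pushforward_prod d' (X : measurableType d') (mu : probability X R) (phi : X -> T * T)
    (mphi : measurable_fun setT phi) (f : T * T -> \bar R) :
  (forall A B, measurable A -> measurable B -> mu (phi @^-1` (A `*` B)) = (P A * P B)%E) ->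
  measurable_fun setT f -> (forall z, 0 <= f z)%E ->
  (\int[mu]_x f (phi x) = \int[P \x P]_z f z)%E.
Proof.
move=> law mf f0.
have := @ge0_integral_pushforward _ _ _ _ R phi mphi mu setT f measurableT mf (fun z _ => f0 z).
rewrite preimage_setT => <-; apply: eq_measure_integral => A mA _.
pose phi_mfun : {mfun X >-> (T * T)%type} := HB.pack phi (isMeasurableFun.Build _ _ _ _ phi mphi).
by apply/esym; apply: (product_measure_unique (m' := pushforward mu phi_mfun)).
Qed.

Lemma integral_swap (f : T * T -> \bar R) : measurable_fun setT f -> (forall z, 0 <= f z)%E ->
  (\int[P \x P]_z f (z.2, z.1) = \int[P \x P]_z f z)%E.
Proof.
move=> mf f0; apply: (pushforward_prod (phi := fun z => (z.2, z.1))) => //.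
  by apply: measurable_fun_pair.
move=> A B mA mB; rewrite (_ : _ @^-1` _ = B `*` A).
  by rewrite muleC; exact: product_measure1E.
by apply/seteqP; split => -[x y] [].
Qed.

Lemma integral_tnth2 n (i j : 'I_n) (f : T * T -> \bar R) : i != j ->
  measurable_fun setT f -> (forall z, 0 <= f z)%E ->
  (\int[power_probability P n]_x f (tnth x i, tnth x j) = \int[P \x P]_z f z)%E.
Proof.
move=> ij mf f0.
apply: (pushforward_prod (phi := fun x : n.-tuple T => (tnth x i, tnth x j))) => //.
  by apply: measurable_fun_pair; exact: measurable_tnth.
move=> A B mA mB.
pose F l := if l == i then A else if l == j then B else setT.
have mF l : measurable (F l) by rewrite /F; case: ifP => // _; case: ifP.
rewrite (_ : _ @^-1` _ = [set x : n.-tuple T | forall l, F l (tnth x l)]).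
  rewrite power_probability_box// (bigD1 i)//= (bigD1 j)//= 1?eq_sym//.
  rewrite /F eqxx eq_sym (negbTE ij) eqxx big1 ?mule1// => l /andP[/negbTE -> /negbTE ->].
  by rewrite probability_setT.
apply/seteqP; split => x /=.
  by move=> [Ax Bx] l; rewrite /F; case: eqP => [->//|_]; case: eqP => [->|].
move=> Fx; split; first by have := Fx i; rewrite /F eqxx.
by have := Fx j; rewrite /F eq_sym (negbTE ij) eqxx.
Qed.

End product_laws.

Section graphon_steps.
Context {R : realType}.
Implicit Types (W : R * R -> R).

Lemma measurable_unit_square : measurable (unit_square R).
Proof. by apply: measurableX. Qed.

Lemma measurable_unit_cube n : measurable (unit_cube R n).
Proof.
rewrite (_ : unit_cube R n = \bigcap_(i in [set: 'I_n])
  ((fun x : n.-tuple R => tnth x i) @^-1` `[0, 1])); last first.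
  by apply/seteqP; split => x /= xI i => [_|]; exact: xI.
apply: fin_bigcap_measurable => // i _; rewrite -[X in measurable X]setTI.
exact: measurable_tnth.
Qed.

(** Extension by 0 gives a function measurable and bounded on the whole plane; a graphon is
    unconstrained off the unit square. *)
Definition restr W : R * R -> R := W \_ (unit_square R).

Lemma restrE W x y : x \in `[0, 1] -> y \in `[0, 1] -> restr W (x, y) = W (x, y).
Proof.
move=> x01 y01; rewrite /restr patchE mem_set//.
Qed.

Lemma measurable_restr W : graphon W -> measurable_fun setT (restr W).
Proof.
move=> gW; apply/(measurable_restrictT _ measurable_unit_square).
exact: graphon_measurable.
Qed.

Lemma restr_le W (C : R) : graphon W -> sup_norm W <= C -> 0 <= C ->
  forall z, `|restr W z| <= C.
Proof.
move=> gW WC C0 z; rewrite /restr patchE; case: ifPn => [|_]; last by rewrite normr0.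
rewrite inE => zI; apply: le_trans WC; apply: sup_ubound; last by exists z.
have [M [_ hM]] := graphon_bounded gW.
by exists (`|M| + 1) => _ [x xI <-]; apply: (hM (`|M| + 1)) => //; rewrite ltr_pwDr// ler_norm.
Qed.

Lemma restr_sym W z : graphon W -> restr W (z.2, z.1) = restr W z.
Proof.
case: z => x y gW; rewrite /restr !patchE /=.
have sw : ((y, x) \in unit_square R) = ((x, y) \in unit_square R).
  by rewrite !in_setX andbC.
rewrite sw; case: ifPn => //; rewrite in_setX => /andP[/set_mem xI /set_mem yI].
exact: graphon_sym.
Qed.

(** An arbitrary step approximation is symmetrised and truncated to [-C, C]. Neither operation
    increases the bound on the L1 distance, because the graphon itself is symmetric and bounded by
    C. *)
Lemma graphon_step W (C e : R) : graphon W -> sup_norm W <= C -> 0 <= C -> 0 < e ->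
  exists (I : finType) (pi : R -> I) (w : I -> I -> R),
    [/\ cells pi, forall a b, w a b = w b a, forall a b, `|w a b| <= C
      & (dist1 (unit_lebesgue R) (restr W) (step2 pi w) <= e%:E)%E].
Proof.
move=> gW WC C0 e0; have mW := measurable_restr gW; have bW := restr_le gW WC C0.
have [I [pi [h [c hW]]]] := approximable_bounded (unit_lebesgue R) mW bW e0.
pose w0 a b := (h a b + h b a) / 2.
pose w a b := Num.max (- C) (Num.min C (w0 a b)).
exists I, pi, w; split => //.
- by move=> a b; rewrite /w /w0 addrC.
- move=> a b; rewrite ler_norml /w.
  by rewrite le_max lexx /= ge_max ge_min lexx andbT; lra.
have hT : (dist1 (unit_lebesgue R) (restr W) (step2 pi (fun a b => h b a)) <= e%:E)%E.
  apply: le_trans hW; rewrite /dist1.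
  rewrite -(integral_swap (unit_lebesgue R) (f := fun z => `|restr W z - step2 pi h z|%:E))//.
    apply: ge0_le_integral => //.
    - apply/measurable_EFinP/measurableT_comp => //.
      by apply: measurable_funB => //; exact: measurable_step2.
    - apply/measurable_EFinP/measurableT_comp => //.
      apply: (measurableT_comp (f := fun z => restr W z - step2 pi h z)
        (g := fun z => (z.2, z.1))); last exact: measurable_fun_pair.
      by apply: measurable_funB => //; exact: measurable_step2.
    - by move=> z _; rewrite lee_fin restr_sym.
  apply/measurable_EFinP/measurableT_comp => //.
  by apply: measurable_funB => //; exact: measurable_step2.
apply: (@le_trans _ _ ((2^-1)%:E * (dist1 (unit_lebesgue R) (restr W) (step2 pi h) +
  dist1 (unit_lebesgue R) (restr W) (step2 pi (fun a b => h b a))))%E).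
  apply: dist1_leD => //; try exact: measurable_step2.
  move=> z; rewrite /step2.
  have := bW z; rewrite ler_norml => /andP[W1 W2].
  set a := pi z.1; set b := pi z.2; set x := restr W z in W1 W2 *.
  apply: (@le_trans _ _ `|x - w0 a b|).
    rewrite /w; set v := w0 a b; have := ler_norm (x - v); have := ler_norm (- (x - v)).
    rewrite normrN => v1 v2; rewrite ler_norml.
    by case: (leP C v) => vC; case: (leP (- C) _) => Cv; apply/andP; split; lra.
  rewrite (_ : x - w0 a b = 2^-1 * ((x - h a b) + (x - h b a))); last by rewrite /w0; field.
  by rewrite normrM ger0_norm ?invr_ge0// ler_wpM2l ?invr_ge0// ler_normD.
apply: (@le_trans _ _ ((2^-1)%:E * (e%:E + e%:E))%E).
  by rewrite lee_pmul2l// leeD.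
by rewrite -EFinD -EFinM lee_fin; lra.
Qed.

Lemma norm_prodB_le (T : eqType) (l : seq T) (a b : T -> R) (C : R) : 0 <= C ->
  (forall e, `|a e| <= C) -> (forall e, `|b e| <= C) ->
  `|\prod_(e <- l) a e - \prod_(e <- l) b e| <=
  C ^+ (size l - 1) * \sum_(e <- l) `|a e - b e|.
Proof.
move=> C0 aC bC; elim: l => [|e l IHl]; first by rewrite !big_nil subrr normr0 mulr0.
rewrite !big_cons /= subn1/=.
rewrite (_ : _ - _ = (a e - b e) * \prod_(e <- l) a e +
    b e * (\prod_(e <- l) a e - \prod_(e <- l) b e)); last by ring.
apply: (le_trans (ler_normD _ _)); rewrite [leRHS]mulrDr !normrM; apply: lerD.
  rewrite mulrC ler_wpM2r// (_ : C ^+ size l = C ^+ count predT l); last by rewrite count_predT.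
  by apply: norm_prod_le => e' _; exact: aC.
case: l IHl => [|e' l] IHl; first by rewrite !big_nil subrr normr0 !mulr0.
rewrite /= subn1/= in IHl *.
by rewrite exprS -mulrA; apply: ler_pM.
Qed.

(** Telescoping the product over the edges leaves one difference per edge; as an edge has distinct
    endpoints, its two coordinates have the product law and the difference integrates to at most
    [e]. *)
Lemma hom_density_dist n (F : simple_graph n) W (C e : R) (I : finType) (pi : R -> I)
    (w : I -> I -> R) : graphon W -> sup_norm W <= C -> 0 <= C -> cells pi ->
  (forall a b, `|w a b| <= C) -> 0 <= e ->
  (dist1 (unit_lebesgue R) (restr W) (step2 pi w) <= e%:E)%E ->
  `|hom_density F W - hom_density F (step2 pi w)| <=
    C ^+ (#|edges F| - 1) * (#|edges F|%:R * e).
Proof.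
move=> gW WC C0 c wC e0 dW.
have mW := measurable_restr gW; have bW := restr_le gW WC C0.
have mw := measurable_step2 w c.
pose L := enum (edges F).
pose mu := power_probability (unit_lebesgue R) n.
pose prodL (V : R * R -> R) (x : n.-tuple R) := \prod_(ij <- L) V (tnth x ij.1, tnth x ij.2).
have mprod (V : R * R -> R) : measurable_fun setT V -> measurable_fun setT (prodL V).
  move=> mV; apply: measurable_prod => ij _.
  apply: (measurableT_comp (f := V) (g := fun x : n.-tuple R => (tnth x ij.1, tnth x ij.2))) => //.
  by apply: measurable_fun_pair; exact: measurable_tnth.
have bprod (V : R * R -> R) x : (forall z, `|V z| <= C) -> `|prodL V x| <= C ^+ size L.
  move=> VC; rewrite -(count_predT L); apply: norm_prod_le => ij _; exact: VC.
have iprod (V : R * R -> R) : measurable_fun setT V -> (forall z, `|V z| <= C) ->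
    mu.-integrable (unit_cube R n) (EFin \o prodL V).
  move=> mV VC; apply: measurable_bounded_integrable.
  - exact: measurable_unit_cube.
  - by apply: (@le_lt_trans _ _ 1%E); [apply: probability_le1; exact: measurable_unit_cube|exact: ltry].
  - by apply: measurable_funTS; exact: mprod.
  - exists (C ^+ size L); split; first exact: num_real.
    by move=> M CM x _; apply: (le_trans (bprod V x VC)); exact: ltW.
have homE (V V' : R * R -> R) : (forall x y, x \in `[0, 1] -> y \in `[0, 1] -> V (x, y) = V' (x, y)) ->
    hom_density F V = \int[mu]_(x in unit_cube R n) prodL V' x.
  move=> VV'; apply: eq_Rintegral => x /set_mem xI; rewrite -big_enum.
  by apply: eq_bigr => ij _; exact: VV'.
have swC z : `|step2 pi w z| <= C by exact: wC.
rewrite (homE W (restr W)) ?(homE (step2 pi w) (step2 pi w))//; last first.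
  by move=> x y x01 y01; rewrite restrE.
rewrite -RintegralB//; [|exact: measurable_unit_cube|exact: iprod|exact: iprod].
have idiff := integrableB (@measurable_unit_cube n) (iprod _ mW bW) (iprod _ mw swC).
apply: (le_trans (le_normr_Rintegral (@measurable_unit_cube n) idiff)).
rewrite -lee_fin fineK; last first.
  apply: integrable_fin_num; first exact: measurable_unit_cube.
  exact: (integrable_norm idiff).
pose D (z : R * R) := `|restr W z - step2 pi w z|%:E.
have mD : measurable_fun setT D.
  by apply/measurable_EFinP/measurableT_comp => //; exact: measurable_funB.
have mDx (ij : 'I_n * 'I_n) :
    measurable_fun setT (fun x : n.-tuple R => D (tnth x ij.1, tnth x ij.2)).
  apply: (measurableT_comp (f := D) (g := fun x : n.-tuple R => (tnth x ij.1, tnth x ij.2))) => //.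
  by apply: measurable_fun_pair; exact: measurable_tnth.
have mS : measurable_fun setT (fun x : n.-tuple R =>
    (C ^+ (size L - 1))%:E * \sum_(ij <- L) D (tnth x ij.1, tnth x ij.2))%E.
  by apply: measurable_funeM; apply: emeasurable_sum => ij; exact: mDx.
apply: (@le_trans _ _ (\int[mu]_x ((C ^+ (size L - 1))%:E *
    \sum_(ij <- L) D (tnth x ij.1, tnth x ij.2)))%E).
  apply: (@le_trans _ _ (\int[mu]_(x in unit_cube R n) ((C ^+ (size L - 1))%:E *
    \sum_(ij <- L) D (tnth x ij.1, tnth x ij.2)))%E).
    apply: ge0_le_integral => //; first exact: measurable_unit_cube.
    - apply: measurable_funTS; apply/measurable_EFinP/measurableT_comp => //.
      by apply: measurable_funB; exact: mprod.
    - exact: measurable_funTS.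
    - move=> x _; rewrite sumEFin -EFinM lee_fin.
      exact: (norm_prodB_le L C0 (fun ij => bW (tnth x ij.1, tnth x ij.2))
        (fun ij => swC (tnth x ij.1, tnth x ij.2))).
  apply: ge0_subset_integral => //; first exact: measurable_unit_cube.
  move=> x _; rewrite mule_ge0 ?lee_fin ?exprn_ge0//.
  by apply: sume_ge0 => ij _; rewrite lee_fin.
rewrite ge0_integralZl//; last 2 first.
- by move=> x _; apply: sume_ge0 => ij _; rewrite lee_fin.
- by rewrite lee_fin exprn_ge0.
rewrite ge0_integral_sum//.
have sL : size L = #|edges F| by rewrite cardE.
rewrite -sL EFinM lee_wpmul2l ?lee_fin ?exprn_ge0//.
apply: (@le_trans _ _ (\sum_(ij <- L) e%:E)%E); last first.
  by rewrite sumEFin big_const_seq count_predT iter_addr_0 mulr_natl.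
rewrite big_seq [leRHS]big_seq; apply: lee_sum => ij.
rewrite mem_enum inE => /andP[ltij _].
have nij : ij.1 != ij.2 by apply/eqP => e12; rewrite e12 ltnn in ltij.
have D0 z : (0 <= D z)%E by rewrite lee_fin.
by rewrite (integral_tnth2 _ nij mD D0).
- by move=> ij x _; rewrite lee_fin.
- by apply: emeasurable_sum => ij; exact: mDx.
Qed.

End graphon_steps.

Section finite_integrals.
Context d (T : measurableType d) (R : realType) (mu : probability T R).
Context (Phi : finType) (rho : T -> Phi).
Hypothesis mrho : forall i, measurable (rho @^-1` [set i]).

Lemma integral_fin (D : set T) (G : Phi -> R) : measurable D ->
  (\int[mu]_(x in D) (G (rho x))%:E =
   (\sum_i G i * fine (mu (D `&` rho @^-1` [set i])))%:E)%E.
Proof.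
move=> mD.
rewrite (eq_integral (fun x => \sum_i (G i)%:E * (\1_(rho @^-1` [set i]) x)%:E)%E); last first.
  move=> x _; rewrite (bigD1 (rho x))//= indicE mem_set// mule1 big1 ?adde0// => i /eqP ix.
  by rewrite indicE memNset ?mule0// => /= rx; apply: ix.
have fin A : measurable A -> mu A \is a fin_num by move=> mA; exact: fin_num_measure.
have int i : mu.-integrable D (fun x => (\1_(rho @^-1` [set i]) x)%:E).
  by apply: (integrableS measurableT) => //; exact: integrable_indic.
rewrite integral_sum//; last by move=> i; exact: integrableZl.
rewrite -sumEFin; apply: eq_bigr => i _; rewrite integralZl// integral_indic//.
by rewrite setIC EFinM fineK// fin//; exact: measurableI.
Qed.

End finite_integrals.

(** * Graphons and couplings reduced to finite weights *)

Section finite_weights.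
Context {R : realType}.
Local Notation leb := (unit_lebesgue R).

Definition cell_weight (I : finType) (pi : R -> I) (i : I) : R :=
  fine (leb (pi @^-1` [set i])).

Section weights.
Context (I : finType) (pi : R -> I).
Hypothesis c : cells pi.

Lemma cell_weight_ge0 i : 0 <= cell_weight pi i.
Proof. by rewrite fine_ge0. Qed.

Lemma cell_weightE i : leb (pi @^-1` [set i]) = (cell_weight pi i)%:E.
Proof. by rewrite fineK// fin_num_measure//; exact: c. Qed.

Lemma cell_weight_sum1 : \sum_i cell_weight pi i = 1.
Proof.
have := integral_fin leb c (fun=> 1) measurableT.
rewrite integral_cst// [X in (_ * X)%E]probability_setT mule1 => -[->].
by apply: eq_bigr => i _; rewrite setTI mul1r.
Qed.

Lemma hom_density_step n (F : simple_graph n) (w : I -> I -> R) :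
  hom_density F (step2 pi w) = Ex (fun=> cell_weight pi)
    (fun X => \prod_(ij in edges F) w (X ij.1) (X ij.2)).
Proof.
pose rho (x : n.-tuple R) := [ffun l => pi (tnth x l)].
pose B (X : {ffun 'I_n -> I}) l := `[0, 1] `&` pi @^-1` [set X l].
have mB X l : measurable (B X l) by apply: measurableI => //; exact: c.
have fiber X : unit_cube R n `&` rho @^-1` [set X] =
    [set x : n.-tuple R | forall l, B X l (tnth x l)].
  apply/seteqP; split => x /=.
    by move=> [xI xX] l; split; [exact: xI|rewrite /= -xX ffunE].
  move=> xB; split; first by move=> l; have [] := xB l.
  by apply/ffunP => l; rewrite ffunE; have [] := xB l.
have mrho X : measurable (rho @^-1` [set X]).
  rewrite (_ : _ @^-1` _ = \bigcap_(l in [set: 'I_n])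
    ((fun x : n.-tuple R => tnth x l) @^-1` (pi @^-1` [set X l]))).
    apply: fin_bigcap_measurable => // l _; rewrite -[X in measurable X]setTI.
    by apply: measurable_tnth => //; exact: c.
  apply/seteqP; split => x /=; first by move=> <- l _ /=; rewrite ffunE.
  by move=> h; apply/ffunP => l; rewrite ffunE; exact: h.
rewrite /hom_density /Rintegral.
rewrite (eq_integral (fun x => ((fun X : {ffun 'I_n -> I} =>
    \prod_(ij in edges F) w (X ij.1) (X ij.2)) (rho x))%:E)); last first.
  move=> x _; congr (_%:E); apply: eq_bigr => ij _.
  by rewrite /step2/= !ffunE.
rewrite (integral_fin (power_probability leb n) mrho (fun X : {ffun 'I_n -> I} =>
    \prod_(ij in edges F) w (X ij.1) (X ij.2)) (@measurable_unit_cube R n)).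
rewrite /= /Ex; apply: eq_bigr => X _; rewrite mulrC; congr (_ * _).
rewrite fiber power_probability_box//.
rewrite (eq_bigr (fun l => (cell_weight pi (X l))%:E)).
  by rewrite prodEFin.
move=> l _; rewrite -cell_weightE /unit_lebesgue /B; congr (lebesgue_measure _).
by rewrite setIAC setIid setIC.
Qed.

End weights.

Section discrepancies.
Variables (W W' : R * R -> R) (I I' : finType) (pi : R -> I) (pi' : R -> I').
Variables (w : I -> I -> R) (w' : I' -> I' -> R) (C e e' : R).
Hypothesis gW : graphon W.
Hypothesis gW' : graphon W'.
Hypothesis WC : sup_norm W <= C.
Hypothesis W'C : sup_norm W' <= C.
Hypothesis C0 : 0 <= C.
Hypothesis wC : forall a b, `|w a b| <= C.
Hypothesis w'C : forall a b, `|w' a b| <= C.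
Hypothesis c : cells pi.
Hypothesis c' : cells pi'.
Hypothesis dW : (dist1 leb (restr W) (step2 pi w) <= e%:E)%E.
Hypothesis dW' : (dist1 leb (restr W') (step2 pi' w') <= e'%:E)%E.
Variable mu : probability (R * R)%type R.
Hypothesis cpl : coupling mu.

Definition joint_cell (x : R * R) : I * I' := (pi x.1, pi' x.2).

Lemma measurable_joint_cell z : measurable (joint_cell @^-1` [set z]).
Proof.
case: z => i i'; rewrite (_ : _ @^-1` _ = pi @^-1` [set i] `*` pi' @^-1` [set i']).
  by apply: measurableX; [exact: c|exact: c'].
by apply/seteqP; split => -[x y]; rewrite /joint_cell /= => -[-> ->].
Qed.

(** For step functions a set enters only through its mass in each joint cell, so sets become
    fractional sets of joint cells. *)
Definition cell_part (S : set (R * R)) (z : I * I') : R :=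
  fine (mu (S `&` joint_cell @^-1` [set z])).

Lemma integral_step_diff (S T : set (R * R)) : measurable S -> measurable T ->
  (\int[mu \x mu]_(p in S `*` T)
     (step2 pi w (p.1.1, p.2.1) - step2 pi' w' (p.1.2, p.2.2))%:E =
   (bform (fun z z' => w z.1 z'.1 - w' z.2 z'.2) (cell_part S) (cell_part T))%:E)%E.
Proof.
move=> mS mT.
pose rho (p : (R * R) * (R * R)) := (joint_cell p.1, joint_cell p.2).
have rhoE z z' : rho @^-1` [set (z, z')] =
    joint_cell @^-1` [set z] `*` joint_cell @^-1` [set z'].
  by apply/seteqP; split => -[x y]; rewrite /rho /= => -[-> ->].
have mrho zz : measurable (rho @^-1` [set zz]).
  by case: zz => z z'; rewrite rhoE; apply: measurableX; exact: measurable_joint_cell.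
have := integral_fin (mu \x mu)%E mrho
  (fun zz => w zz.1.1 zz.2.1 - w' zz.1.2 zz.2.2) (measurableX mS mT).
rewrite /step2 /= => ->; congr (_%:E).
rewrite /bform pair_bigA/=; apply: eq_bigr => -[z z'] _ /=; rewrite mulrC; congr (_ * _).
rewrite rhoE -setXI /cell_part -fineM; [|by apply: fin_num_measure; apply: measurableI => //; exact: measurable_joint_cell..].
by rewrite -product_measure1E//; apply: measurableI => //; exact: measurable_joint_cell.
Qed.

Let bounded_diff (V : R * R -> R) (V' : R * R -> R) (S : set ((R * R) * (R * R))) :
  measurable S -> measurable_fun setT V -> measurable_fun setT V' ->
  (forall z, `|V z| <= C) -> (forall z, `|V' z| <= C) ->
  (mu \x mu)%E.-integrable S (fun p => (V (p.1.1, p.2.1) - V' (p.1.2, p.2.2))%:E).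
Proof.
move=> mS mV mV' VC V'C; apply: measurable_bounded_integrable => //.
- by apply: (@le_lt_trans _ _ 1%E); [exact: probability_le1|exact: ltry].
- apply: measurable_funTS; apply: measurable_funB.
    apply: (measurableT_comp (f := V) (g := fun p : (R * R) * (R * R) => (p.1.1, p.2.1))) => //.
    by apply: measurable_fun_pair; apply: measurableT_comp.
  apply: (measurableT_comp (f := V') (g := fun p : (R * R) * (R * R) => (p.1.2, p.2.2))) => //.
  by apply: measurable_fun_pair; apply: measurableT_comp.
- exists (C + C); split; first exact: num_real.
  move=> M CM x _ /=; apply: (le_trans (ler_normB _ _)).
  by apply: le_trans (ltW CM); apply: lerD; [exact: VC|exact: V'C].
Qed.

Let law1 (f : R * R -> \bar R) : measurable_fun setT f -> (forall z, 0 <= f z)%E ->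
  (\int[mu \x mu]_p f (p.1.1, p.2.1) = \int[leb \x leb]_z f z)%E.
Proof.
move=> mf f0; apply: (pushforward_prod (mu := (mu \x mu)%E)
  (phi := fun p : (R * R) * (R * R) => (p.1.1, p.2.1))) => //.
  by apply: measurable_fun_pair; apply: measurableT_comp.
move=> A B mA mB; have [cA _] := cpl mA; have [cB _] := cpl mB.
rewrite (_ : _ @^-1` _ = (fst @^-1` A) `*` (fst @^-1` B)).
  have mfst (D : set R) : measurable D -> measurable ((fst : R * R -> R) @^-1` D).
    by move=> mD; rewrite -[X in measurable X]setTI; exact: measurable_fst.
  transitivity (mu (fst @^-1` A) * mu (fst @^-1` B))%E; last by rewrite cA cB.
  exact: (product_measure1E mu mu (mfst A mA) (mfst B mB)).
by apply/seteqP; split => -[[a b] [a' b']].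
Qed.

Let law2 (f : R * R -> \bar R) : measurable_fun setT f -> (forall z, 0 <= f z)%E ->
  (\int[mu \x mu]_p f (p.1.2, p.2.2) = \int[leb \x leb]_z f z)%E.
Proof.
move=> mf f0; apply: (pushforward_prod (mu := (mu \x mu)%E)
  (phi := fun p : (R * R) * (R * R) => (p.1.2, p.2.2))) => //.
  by apply: measurable_fun_pair; apply: measurableT_comp.
move=> A B mA mB; have [_ cA] := cpl mA; have [_ cB] := cpl mB.
rewrite (_ : _ @^-1` _ = (snd @^-1` A) `*` (snd @^-1` B)).
  have msnd (D : set R) : measurable D -> measurable ((snd : R * R -> R) @^-1` D).
    by move=> mD; rewrite -[X in measurable X]setTI; exact: measurable_snd.
  transitivity (mu (snd @^-1` A) * mu (snd @^-1` B))%E; last by rewrite cA cB.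
  exact: (product_measure1E mu mu (msnd A mA) (msnd B mB)).
by apply/seteqP; split => -[[a b] [a' b']].
Qed.

Let num_diff (S : set ((R * R) * (R * R))) : measurable S ->
  exists a b : R, [/\
    (\int[mu \x mu]_(p in S) (restr W (p.1.1, p.2.1) - restr W' (p.1.2, p.2.2))%:E = a%:E)%E,
    (\int[mu \x mu]_(p in S)
       (step2 pi w (p.1.1, p.2.1) - step2 pi' w' (p.1.2, p.2.2))%:E = b%:E)%E
    & `|a - b| <= e + e'].
Proof.
move=> mS; have mW := measurable_restr gW; have mW' := measurable_restr gW'.
have mw := measurable_step2 w c; have mw' := measurable_step2 w' c'.
have bW := restr_le gW WC C0; have bW' := restr_le gW' W'C C0.
have bw z : `|step2 pi w z| <= C by exact: wC.
have bw' z : `|step2 pi' w' z| <= C by exact: w'C.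
have i1 := bounded_diff mS mW mW' bW bW'; have i2 := bounded_diff mS mw mw' bw bw'.
have f1 := integrable_fin_num mS i1; have f2 := integrable_fin_num mS i2.
exists (fine (\int[mu \x mu]_(p in S) (restr W (p.1.1, p.2.1) - restr W' (p.1.2, p.2.2))%:E)%E),
  (fine (\int[mu \x mu]_(p in S)
       (step2 pi w (p.1.1, p.2.1) - step2 pi' w' (p.1.2, p.2.2))%:E)%E).
split; [by rewrite fineK|by rewrite fineK|].
rewrite -fineB// -integralB// -lee_fin -abse_EFin fineK; last first.
  by apply: integrable_fin_num => //; exact: integrableB.
pose D z := `|restr W z - step2 pi w z|%:E; pose D' z := `|restr W' z - step2 pi' w' z|%:E.
have mD : measurable_fun setT D.
  by apply/measurable_EFinP/measurableT_comp => //; exact: measurable_funB.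
have mD' : measurable_fun setT D'.
  by apply/measurable_EFinP/measurableT_comp => //; exact: measurable_funB.
have D0 z : (0 <= D z)%E by rewrite lee_fin.
have D'0 z : (0 <= D' z)%E by rewrite lee_fin.
have m1 : measurable_fun setT (fun p : (R * R) * (R * R) => D (p.1.1, p.2.1)).
  apply: (measurableT_comp (f := D) (g := fun p : (R * R) * (R * R) => (p.1.1, p.2.1))) => //.
  by apply: measurable_fun_pair; apply: measurableT_comp.
have m2 : measurable_fun setT (fun p : (R * R) * (R * R) => D' (p.1.2, p.2.2)).
  apply: (measurableT_comp (f := D') (g := fun p : (R * R) * (R * R) => (p.1.2, p.2.2))) => //.
  by apply: measurable_fun_pair; apply: measurableT_comp.
have mS1 := measurable_int _ (integrableB mS i1 i2).
apply: (le_trans (le_abse_integral _ mS mS1)).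
apply: (@le_trans _ _ (\int[mu \x mu]_(p in S) (D (p.1.1, p.2.1) + D' (p.1.2, p.2.2)))%E).
  apply: ge0_le_integral => //.
  - exact: measurableT_comp.
  - by apply: measurable_funTS; exact: emeasurable_funD.
  - move=> p _; rewrite /D /D' -EFinD /= lee_fin.
    by apply: le_trans (ler_normB _ _); rewrite le_eqVlt; apply/orP; left; apply/eqP; congr (`|_|); ring.
apply: (@le_trans _ _ (\int[mu \x mu]_p (D (p.1.1, p.2.1) + D' (p.1.2, p.2.2)))%E).
  apply: ge0_subset_integral => //; first exact: emeasurable_funD.
  by move=> p _; rewrite adde_ge0.
rewrite ge0_integralD// law1// law2//.
by rewrite EFinD; apply: leeD.
Qed.

(* Cutting W and W' down to the unit square leaves the integral over S x T
   unchanged, because S and T lie in the unit square. *)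
Lemma cut_discrepancy_step (S T : set (R * R)) : measurable S -> measurable T ->
  S `<=` unit_square R -> T `<=` unit_square R -> exists2 a : R,
    cut_discrepancy W W' mu S T = a%:E &
    `|a - `|bform (fun z z' => w z.1 z'.1 - w' z.2 z'.2) (cell_part S) (cell_part T)| |
      <= e + e'.
Proof.
move=> mS mT SI TI; have [a [b [aE bE ab]]] := num_diff (measurableX mS mT).
have := integral_step_diff mS mT; rewrite bE => -[<-].
exists `|a|; last by apply: le_trans ab; exact: ler_dist_dist.
rewrite /cut_discrepancy -abse_EFin -aE; congr (`|_|)%E.
apply: eq_integral => -[[x u] [y v]] /set_mem[/= Sxu Tyv].
have [x01 u01] := SI _ Sxu; have [y01 v01] := TI _ Tyv.
by rewrite !restrE.
Qed.

End discrepancies.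
End finite_weights.

Section cell_parts.
Context {R : realType}.
Variables (I I' : finType) (pi : R -> I) (pi' : R -> I') (mu : probability (R * R)%type R).
Hypothesis c : cells pi.
Hypothesis c' : cells pi'.

Lemma cell_part_ge0 S z : 0 <= cell_part pi pi' mu S z.
Proof. by rewrite fine_ge0. Qed.

Lemma push_cell_part_le (B : finType) (phi : I * I' -> B) S y : measurable S ->
  push phi (cell_part pi pi' mu S) y <=
  fine (mu [set x | phi (joint_cell pi pi' x) = y]).
Proof.
move=> mS; have mcell := measurable_joint_cell c c'.
have mE : measurable [set x | phi (joint_cell pi pi' x) = y].
  exact: (measurable_fin_preimage mcell [set z | phi z = y]).
have := integral_fin mu mcell (fun z => (phi z == y)%:R) mS.
rewrite (eq_integral (fun x => (\1_[set x | phi (joint_cell pi pi' x) = y] x)%:E)); last first.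
  move=> x _; rewrite indicE (_ : (x \in _) = (phi (joint_cell pi pi' x) == y))//.
  by apply/idP/eqP => [/set_mem//|xy]; exact: mem_set.
rewrite integral_indic// => muE.
have -> : push phi (cell_part pi pi' mu S) y =
    fine (mu ([set x | phi (joint_cell pi pi' x) = y] `&` S)).
  rewrite muE /= /push big_mkcond/=; apply: eq_bigr => z _.
  by case: eqP; rewrite ?mul1r ?mul0r.
have mES : measurable ([set x | phi (joint_cell pi pi' x) = y] `&` S) by exact: measurableI.
by apply: fine_le; [exact: fin_num_measure..|exact: measureIl].
Qed.

Hypothesis cpl : coupling mu.

Lemma push_fst_cell_part S i : measurable S ->
  push fst (cell_part pi pi' mu S) i <= cell_weight pi i.
Proof.
move=> mS; apply: (le_trans (push_cell_part_le fst i mS)).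
rewrite /cell_weight; have [<- _] := cpl (c i).
by rewrite le_eqVlt; apply/orP; left; apply/eqP.
Qed.

Lemma push_snd_cell_part S i : measurable S ->
  push snd (cell_part pi pi' mu S) i <= cell_weight pi' i.
Proof.
move=> mS; apply: (le_trans (push_cell_part_le snd i mS)).
rewrite /cell_weight; have [_ <-] := cpl (c' i).
by rewrite le_eqVlt; apply/orP; left; apply/eqP.
Qed.

End cell_parts.

Section coupling_of_weights.
Context {R : realType}.
Variables (J J' : finType) (pi : R -> J) (pi' : R -> J') (m : J -> J' -> R).
Hypothesis c : cells pi.
Hypothesis c' : cells pi'.
Hypothesis m0 : forall j j', 0 <= m j j'.
Hypothesis row : forall j, \sum_j' m j j' = cell_weight pi j.
Hypothesis col : forall j', \sum_j m j j' = cell_weight pi' j'.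

Local Notation leb := (unit_lebesgue R).

Let cell (z : J * J') : set (R * R) := joint_cell pi pi' @^-1` [set z].
Let mcell z : measurable (cell z) := measurable_joint_cell c c' z.

(** On each joint cell the coupling will be a multiple of the product measure, with total mass m(z).
    If the cell is null for the product measure, m(z) is 0 as well, being bounded by both marginals,
    and x / 0 = 0 is the right value. *)
Let dens (z : J * J') : R := m z.1 z.2 / (cell_weight pi z.1 * cell_weight pi' z.2).

Let dens_ge0 z : 0 <= dens z.
Proof. by rewrite divr_ge0 ?m0// mulr_ge0 ?cell_weight_ge0. Qed.

Let z0 : J * J' := (pi 0, pi' 0).
Let zi (i : nat) : J * J' := nth z0 (index_enum {: J * J'}) i.

Let piece (i : nat) : {measure set (R * R) -> \bar R} :=
  mscale (NngNum (dens_ge0 (zi i))) (mrestr (leb \x leb)%E (mcell (zi i))).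

Let weighted : {measure set (R * R) -> \bar R} := msum piece (size (index_enum {: J * J'})).

Let weightedE A : weighted A =
  (\sum_(z : J * J') (dens z)%:E * (leb \x leb) (A `&` cell z))%E.
Proof.
by rewrite /weighted/= /msum [RHS](big_nth z0) big_mkord.
Qed.

Let leb2E A B a b : measurable A -> measurable B -> leb A = a%:E -> leb B = b%:E ->
  (leb \x leb)%E (A `*` B) = (a * b)%:E.
Proof.
move=> mA mB hA hB; transitivity (leb A * leb B)%E; last by rewrite hA hB EFinM.
exact: product_measure1E.
Qed.

Let cellE j j' : cell (j, j') = (pi @^-1` [set j]) `*` (pi' @^-1` [set j']).
Proof. by apply/seteqP; split => -[x y]; rewrite /cell /joint_cell /= => -[-> ->]. Qed.

Let m_le_row j j' : m j j' <= cell_weight pi j.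
Proof. by rewrite -row (bigD1 j')//= lerDl sumr_ge0. Qed.

Let m_le_col j j' : m j j' <= cell_weight pi' j'.
Proof. by rewrite -col (bigD1 j)//= lerDl sumr_ge0. Qed.

Let densK j j' : dens (j, j') * (cell_weight pi j * cell_weight pi' j') = m j j'.
Proof.
rewrite /dens/=; have [/eqP|?] := eqVneq (cell_weight pi j * cell_weight pi' j') 0; last by rewrite divfK.
rewrite mulf_eq0 => /orP[] /eqP p0; apply/eqP; rewrite p0 ?mulr0 ?mul0r ?mulr0 eq_le m0 -{1}p0.
  by rewrite m_le_row.
by rewrite m_le_col.
Qed.

Let weighted_cell j j' : weighted (cell (j, j')) = (m j j')%:E.
Proof.
rewrite weightedE (bigD1 (j, j'))//= setIid big1 ?adde0.
  rewrite cellE (leb2E (c j) (c' j') (cell_weightE c j) (cell_weightE c' j')).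
  by rewrite -EFinM densK.
move=> z zj; rewrite (_ : _ `&` _ = set0) ?measure0 ?mule0//.
by apply/seteqP; split => // x [/= xj xz]; move/eqP: zj; apply; rewrite -xj -xz.
Qed.

Let weighted_fst A : measurable A -> weighted (fst @^-1` A) = leb A.
Proof.
move=> mA; pose a j := fine (leb (A `&` pi @^-1` [set j])).
have mAj j : measurable (A `&` pi @^-1` [set j]) by apply: measurableI => //; exact: c.
have aE j : leb (A `&` pi @^-1` [set j]) = (a j)%:E by rewrite fineK// fin_num_measure.
have a_le j : a j <= cell_weight pi j.
  by apply: fine_le; [apply: fin_num_measure => //; exact: c..|apply: measureIr => //; exact: c].
have a_ge0 j : 0 <= a j by rewrite fine_ge0.
have -> : leb A = (\sum_j a j)%:E.
  have := integral_fin leb c (fun=> 1) mA.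
  rewrite integral_cst// mul1e => ->; congr (_%:E); apply: eq_bigr => j _.
  by rewrite mul1r.
rewrite weightedE -sumEFin.
rewrite [LHS](_ : _ = \sum_j \sum_j' (dens (j, j'))%:E *
    (leb \x leb) (fst @^-1` A `&` cell (j, j')))%E; last first.
  by rewrite pair_bigA/=; apply: eq_bigr => -[].
apply: eq_bigr => j _.
have pieceE j' : ((dens (j, j'))%:E * (leb \x leb) (fst @^-1` A `&` cell (j, j')))%E =
    (dens (j, j') * (a j * cell_weight pi' j'))%:E.
  rewrite (_ : _ `&` _ = (A `&` pi @^-1` [set j]) `*` (pi' @^-1` [set j'])).
    by rewrite (leb2E (mAj j) (c' j') (aE j) (cell_weightE c' j')) -EFinM.
  by rewrite cellE; apply/seteqP; split => -[x y] /= => [[? []]|[[]]].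
under eq_bigr do rewrite pieceE.
rewrite sumEFin; congr (_%:E).
have [p0|p0] := eqVneq (cell_weight pi j) 0.
  have aj0 : a j = 0 by apply/eqP; rewrite eq_le a_ge0 -{1}p0 a_le.
  by rewrite aj0 big1// => j' _; rewrite mul0r mulr0.
rewrite (eq_bigr (fun j' => a j / cell_weight pi j * m j j')).
  by rewrite -big_distrr/= row divfK.
by move=> j' _; rewrite -densK; field.
Qed.

Let weighted_snd A : measurable A -> weighted (snd @^-1` A) = leb A.
Proof.
move=> mA; pose a j := fine (leb (A `&` pi' @^-1` [set j])).
have mAj j : measurable (A `&` pi' @^-1` [set j]) by apply: measurableI => //; exact: c'.
have aE j : leb (A `&` pi' @^-1` [set j]) = (a j)%:E by rewrite fineK// fin_num_measure.
have a_le j : a j <= cell_weight pi' j.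
  by apply: fine_le; [apply: fin_num_measure => //; exact: c'..|apply: measureIr => //; exact: c'].
have a_ge0 j : 0 <= a j by rewrite fine_ge0.
have -> : leb A = (\sum_j a j)%:E.
  have := integral_fin leb c' (fun=> 1) mA.
  rewrite integral_cst// mul1e => ->; congr (_%:E); apply: eq_bigr => j _.
  by rewrite mul1r.
rewrite weightedE -sumEFin.
rewrite [LHS](_ : _ = \sum_j \sum_j' (dens (j, j'))%:E *
    (leb \x leb) (snd @^-1` A `&` cell (j, j')))%E; last first.
  by rewrite pair_bigA/=; apply: eq_bigr => -[].
rewrite exchange_big/=; apply: eq_bigr => j' _.
have pieceE j : ((dens (j, j'))%:E * (leb \x leb) (snd @^-1` A `&` cell (j, j')))%E =
    (dens (j, j') * (cell_weight pi j * a j'))%:E.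
  rewrite (_ : _ `&` _ = (pi @^-1` [set j]) `*` (A `&` pi' @^-1` [set j'])).
    by rewrite (leb2E (c j) (mAj j') (cell_weightE c j) (aE j')) -EFinM.
  by rewrite cellE; apply/seteqP; split => -[x y] /= => [[? []]|[? []]].
under eq_bigr do rewrite pieceE.
rewrite sumEFin; congr (_%:E).
have [p0|p0] := eqVneq (cell_weight pi' j') 0.
  have aj0 : a j' = 0 by apply/eqP; rewrite eq_le a_ge0 -{1}p0 a_le.
  by rewrite aj0 big1// => j _; rewrite mulr0 mulr0.
rewrite (eq_bigr (fun j => a j' / cell_weight pi' j' * m j j')).
  by rewrite -big_distrr/= col divfK.
by move=> j _; rewrite -densK; field.
Qed.

Let weighted1 : weighted setT = 1%E.
Proof. by rewrite -(preimage_setT fst) weighted_fst// probability_setT. Qed.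

Lemma coupling_of_weights : exists mu : probability (R * R)%type R, coupling mu /\
  forall j j', mu [set x | joint_cell pi pi' x = (j, j')] = (m j j')%:E.
Proof.
(* Normalising supplies the probability structure and changes no value, since [weighted] has mass
   1. *)
pose mu : probability (R * R)%type R := mnormalize weighted (leb \x leb)%E.
have muE A : mu A = weighted A.
  by rewrite /mu/= /mnormalize weighted1 onee_eq0/= invr1 mule1.
exists mu; split => [A mA|j j']; last by rewrite muE; exact: weighted_cell.
by rewrite !muE; split; [exact: weighted_fst|exact: weighted_snd].
Qed.

End coupling_of_weights.

(** * Both statements for graphons *)

Lemma Ex_push {R : realType} (V K I : finType) (f : K -> I) (q : K -> R)
    (Phi : (V -> I) -> R) :
  Ex (fun=> push f q) Phi = Ex (fun=> q) (fun Y => Phi (fun i => f (Y i))).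
Proof.
rewrite /Ex [RHS](partition_big (fun Y : {ffun V -> K} => [ffun i => f (Y i)]) predT)//=.
apply: eq_bigr => X _; rewrite /push (bigA_distr_big_dep (fun i z => f z == X i)).
rewrite big_distrl/=; apply: eq_big => Y.
  apply/familyP/eqP => [fY|<- i]; last by rewrite unfold_in ffunE.
  by apply/ffunP => i; rewrite ffunE; apply/eqP; exact: fY i.
move=> /familyP fY; congr (_ * Phi _).
by apply/funext => i; apply/esym/eqP; exact: fY i.
Qed.

Section counting.
Context {R : realType}.
Variables (W W' : R * R -> R) (C : R).
Hypothesis gW : graphon W.
Hypothesis gW' : graphon W'.
Hypothesis WC : sup_norm W <= C.
Hypothesis W'C : sup_norm W' <= C.
Hypothesis C0 : 0 <= C.
Local Notation leb := (unit_lebesgue R).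

Lemma coupling_unit_square (mu : probability (R * R)%type R) : coupling mu ->
  mu (unit_square R) = 1%E.
Proof.
move=> cpl.
have mI : measurable (~` `[0, 1] : set R) by exact: measurableC.
have leb0 : leb (~` `[0, 1]) = 0%E by rewrite /unit_lebesgue setICl measure0.
have [mu1 _] := cpl _ mI; have [_ mu2] := cpl _ mI.
have msq := @measurable_unit_square R.
have m1 : measurable ((fst : R * R -> R) @^-1` ~` `[0, 1]).
  by rewrite -[X in measurable X]setTI; exact: measurable_fst.
have m2 : measurable ((snd : R * R -> R) @^-1` ~` `[0, 1]).
  by rewrite -[X in measurable X]setTI; exact: measurable_snd.
have mu0 : mu (~` unit_square R) = 0%E.
  apply/eqP; rewrite eq_le measure_ge0 andbT.
  apply: (@le_trans _ _ (mu ((fst @^-1` ~` `[0, 1]) `|` (snd @^-1` ~` `[0, 1])))).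
    apply: le_measure; rewrite ?inE; [exact: measurableC|exact: measurableU|].
    move=> [x y] /= nxy; apply: contrapT => /not_orP[/contrapT x01 /contrapT y01].
    exact: nxy.
  pose N : set R := ~` `[0, 1].
  have l1 : (mu (fst @^-1` N) <= 0)%E by rewrite mu1 leb0.
  have l2 : (mu (snd @^-1` N) <= 0)%E by rewrite mu2 leb0.
  apply: (le_trans (measureU2 _ m1 m2)); rewrite -[leRHS]adde0.
  exact: (leeD l1 l2).
have := probability_setC mu msq; rewrite mu0 => /eqP; rewrite eq_sym sube_eq//.
by rewrite add0e => /eqP.
Qed.

(** The weights [q] of the joint cells have the cell weights as marginals, so the two step functions
    become matrices [a] and [b] on one finite set, with the same densities, and [finite_counting]
    applies. *)
Lemma counting_coupling n (F : simple_graph n) (mu : probability (R * R)%type R) (D : R) :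
  coupling mu ->
  (forall S T, measurable S -> measurable T -> S `<=` unit_square R -> T `<=` unit_square R ->
    (cut_discrepancy W W' mu S T <= D%:E)%E) ->
  `|hom_density F W - hom_density F W'| <=
    4 * #|edges F|%:R * C ^+ (#|edges F| - 1) * D.
Proof.
move=> cpl discD; set k := #|edges F|.
have K0 : 0 <= k%:R * C ^+ (k - 1) by rewrite mulr_ge0 ?exprn_ge0.
apply/ler_addgt0Pr => eps eps0.
(* Up to powers of C, approximating W and W' costs one [e] each per edge in the densities, and 2e in
   the cut norm, which counts four times: 10 in all. The 1 keeps the denominator positive. *)
pose e := eps / (10 * (k%:R * C ^+ (k - 1)) + 1).
have den0 : 0 < 10 * (k%:R * C ^+ (k - 1)) + 1 by lra.
have e0 : 0 < e by rewrite divr_gt0.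
have [I [pi [w [c w_sym wC dW]]]] := graphon_step gW WC C0 e0.
have [I' [pi' [w' [c' w'_sym w'C dW']]]] := graphon_step gW' W'C C0 e0.
have t1 := hom_density_dist F gW WC C0 c wC (ltW e0) dW.
have t2 := hom_density_dist F gW' W'C C0 c' w'C (ltW e0) dW'.
pose part := cell_part pi pi' mu; pose q := part (unit_square R).
have q0 z : 0 <= q z by exact: cell_part_ge0.
have msq := @measurable_unit_square R.
have q1 : \sum_z q z = 1.
  have := integral_fin mu (measurable_joint_cell c c') (fun=> 1) msq.
  rewrite integral_cst// [X in (_ * X)%E](_ : _ = 1%E); last exact: coupling_unit_square.
  rewrite mule1 => -[->].
  by apply: eq_bigr => z _; rewrite mul1r.
(* Domination together with equal total mass forces equality. *)
have push_eq (B : finType) (phi : I * I' -> B) (P : B -> R) : \sum_b P b = 1 ->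
    (forall b, push phi q b <= P b) -> push phi q = P.
  move=> P1 le; apply/funext => b; apply/eqP; rewrite eq_le le /= leNgt; apply/negP => lt.
  have : \sum_b push phi q b < \sum_b P b.
    by rewrite (bigD1 b)//= [ltRHS](bigD1 b)//= ltr_leD// ler_sum.
  by rewrite push_sum q1 P1 ltxx.
have pfst : push fst q = cell_weight pi.
  by apply: push_eq; [exact: cell_weight_sum1|move=> i; exact: push_fst_cell_part].
have psnd : push snd q = cell_weight pi'.
  by apply: push_eq; [exact: cell_weight_sum1|move=> i; exact: push_snd_cell_part].
pose a (z z' : I * I') := w z.1 z'.1; pose b (z z' : I * I') := w' z.2 z'.2.
pose L := enum (edges F).
have h1 : hom_density F (step2 pi w) = wdensity q L a.
  rewrite hom_density_step// -pfst Ex_push; apply: Ex_eq => Y.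
  by rewrite -big_enum.
have h2 : hom_density F (step2 pi' w') = wdensity q L b.
  rewrite hom_density_step// -psnd Ex_push; apply: Ex_eq => Y.
  by rewrite -big_enum.
have cut : wcut_le q (fun x y => a x y - b x y) (D + (e + e)).
  move=> S T.
  pose Sq (S : pred (I * I')) := unit_square R `&` [set x | S (joint_cell pi pi' x)].
  have mSq S' : measurable (Sq S').
    apply: measurableI => //.
    exact: (measurable_fin_preimage (measurable_joint_cell c c') [set z | S' z]).
  have partE S' z : part (Sq S') z = q z * (S' z)%:R.
    rewrite /q /part /cell_part /Sq; case: (boolP (S' z)) => Sz.
      rewrite mulr1; congr (fine (mu _)); apply/seteqP; split => x [].
        by move=> [xI _] xz.
      by move=> xI /= xz; split => //; split => //=; rewrite xz.
    rewrite mulr0 (_ : _ `&` _ = set0) ?measure0//.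
    by apply/seteqP; split => // x [[_ /= Sx] /= xz]; rewrite -xz Sx in Sz.
  have [v vE] := cut_discrepancy_step gW gW' WC W'C C0 wC w'C c c' dW dW' cpl
    (mSq S) (mSq T) (@subIsetl _ _ _) (@subIsetl _ _ _).
  have := discD _ _ (mSq S) (mSq T) (@subIsetl _ _ _) (@subIsetl _ _ _).
  rewrite vE lee_fin => vD.
  have -> : bform (fun z z' => w z.1 z'.1 - w' z.2 z'.2)
      (cell_part pi pi' mu (Sq S)) (cell_part pi pi' mu (Sq T)) =
      bform (fun x y => q x * q y * (a x y - b x y))
       (fun x => (S x)%:R) (fun x => (T x)%:R).
    apply: eq_bigr => z _; apply: eq_bigr => z' _.
    by rewrite -!/(part _ _) !partE /a /b; ring.
  by rewrite ler_norml => /andP[? ?]; lra.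
have main := finite_counting q0 q1 C0 cut (fun x y => wC x.1 y.1) (fun x y => w'C x.2 y.2)
  (enum_uniq _ : uniq L).
have : `|wdensity q L a - wdensity q L b| <= 4 * k%:R * C ^+ (k - 1) * (D + (e + e)).
  rewrite /k cardE; apply: main.
    move=> ij; rewrite mem_enum inE => /andP[lt _]; apply/eqP => e12.
    by rewrite e12 ltnn in lt.
  move=> [i j] [i' j']; rewrite !mem_enum !inE /= => /andP[ij _] /andP[ij' _].
  rewrite /touches /= => /orP[] /eqP ei /orP[] /eqP ej; subst => //.
  - by rewrite ltnn in ij.
  - by have := ltn_trans ij ij'; rewrite ltnn.
  - by rewrite ltnn in ij.
rewrite -h1 -h2 => t3.
have eE : 10 * (k%:R * C ^+ (k - 1)) * e <= eps.
  rewrite /e mulrCA ler_piMr ?(ltW eps0)// ler_pdivrMr// mul1r; lra.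
move: t1 t2 t3; rewrite -/k !ler_norml => /andP[? ?] /andP[? ?] /andP[? ?].
apply/andP; split; nra.
Qed.

Lemma counting_lemma n (F : simple_graph n) : 0 < C ->
  (`|hom_density F W - hom_density F W'|%:E <=
   (4 * #|edges F|%:R * C ^+ (#|edges F| - 1))%:E * cut_distance W W')%E.
Proof.
(* Without edges the factor of the cut distance is 0 and could not be divided out below. *)
move=> C_gt0; have [E0|E_gt0] := posnP #|edges F|.
  rewrite E0 mulr0 mul0r mul0e (_ : hom_density F W = hom_density F W') ?subrr ?normr0//.
  have /eqP F0 : edges F == finset.set0 by rewrite -cards_eq0 E0.
  by apply: eq_Rintegral => x _; rewrite F0 !big_set0.
have K_gt0 : 0 < 4 * #|edges F|%:R * C ^+ (#|edges F| - 1).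
  by rewrite !mulr_gt0// ?ltr0n// exprn_gt0.
rewrite -lee_pdivrMl//; apply: le_ereal_inf_tmp => _ [mu cpl <-].
set discs := [set cut_discrepancy _ _ _ _ _ | _ in _].
have discD S T : measurable S -> measurable T -> S `<=` unit_square R ->
    T `<=` unit_square R -> (cut_discrepancy W W' mu S T <= ereal_sup discs)%E.
  by move=> mS mT SI TI; apply: ereal_sup_ubound; exists (S, T).
(* The supremum is finite, or +oo, where the bound is trivial, or -oo, which empty sets exclude. *)
case: (ereal_sup discs) discD => [D| |] discD; last first.
- have := discD set0 set0 measurable0 measurable0 (@sub0set _ _) (@sub0set _ _).
  by rewrite leeNy_eq /cut_discrepancy => /eqP; case: (integral _ _ _).
- by rewrite leey.
rewrite lee_pdivrMl// -EFinM lee_fin.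
exact: counting_coupling cpl discD.
Qed.

End counting.

Section inverse_counting.
Context {R : realType}.
Variables (W W' : R * R -> R) (C : R) (k : nat).
Hypothesis gW : graphon W.
Hypothesis gW' : graphon W'.
Hypothesis WC : sup_norm W <= C.
Hypothesis W'C : sup_norm W' <= C.
Hypothesis C1 : 1 <= C.

Let C0 : 0 <= C. Proof. exact: le_trans C1. Qed.

(* The bounds on bform are those satisfied by the cell weights of all subsets
   S, T of the unit square, for a suitable coupling. *)
Lemma cut_distance_le_step (b : R) :
  (exists2 e0 : R, 0 < e0 & forall e (I I' : finType) (pi : R -> I) (pi' : R -> I')
     (w : I -> I -> R) (w' : I' -> I' -> R), 0 < e <= e0 -> cells pi -> cells pi' ->
     (forall x y, w x y = w y x) -> (forall x y, w' x y = w' y x) ->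
     (forall x y, `|w x y| <= C) -> (forall x y, `|w' x y| <= C) ->
     (dist1 (unit_lebesgue R) (restr W) (step2 pi w) <= e%:E)%E ->
     (dist1 (unit_lebesgue R) (restr W') (step2 pi' w') <= e%:E)%E ->
     exists2 mu : probability (R * R)%type R, coupling mu &
       forall S T, measurable S -> measurable T ->
       `|bform (fun z z' => w z.1 z'.1 - w' z.2 z'.2)
          (cell_part pi pi' mu S) (cell_part pi pi' mu T)| <= b) ->
  (cut_distance W W' <= b%:E)%E.
Proof.
move=> [e0 e0_gt0 H]; apply/lee_addgt0Pr => eps eps0.
pose e := Num.min e0 (eps / 2).
have e_gt0 : 0 < e by rewrite lt_min e0_gt0 divr_gt0.
have e_le : e <= eps / 2 by rewrite ge_min lexx orbT.
have [I [pi [w [c w_sym wC dW]]]] := graphon_step gW WC C0 e_gt0.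
have [I' [pi' [w' [c' w'_sym w'C dW']]]] := graphon_step gW' W'C C0 e_gt0.
have ee0 : 0 < e <= e0 by rewrite e_gt0 ge_min lexx.
have [mu cpl muH] := H e I I' pi pi' w w' ee0 c c' w_sym w'_sym wC w'C dW dW'.
apply: (@le_trans _ _ (ereal_sup [set cut_discrepancy W W' mu ST.1 ST.2 | ST in
      [set ST : set (R * R) * set (R * R) |
        [/\ measurable ST.1, measurable ST.2,
            ST.1 `<=` unit_square R & ST.2 `<=` unit_square R]]])).
  by apply: ereal_inf_lbound; exists mu.
apply: ge_ereal_sup => _ [[S T] [/= mS mT SI TI] <-].
have [a aE aB] := cut_discrepancy_step gW gW' WC W'C C0 wC w'C c c' dW dW' cpl mS mT SI TI.
rewrite aE -EFinD lee_fin; have := muH S T mS mT.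
move: aB; rewrite ler_norml => /andP[_ ?] ?.
by have := splitr eps; lra.
Qed.

Lemma cut_distance_le_trivial : (cut_distance W W' <= (2 * C)%:E)%E.
Proof.
apply: cut_distance_le_step; exists 1 => // e I I' pi pi' w w' _ c c' _ _ wC w'C _ _.
pose m i i' := cell_weight pi i * cell_weight pi' i'.
have m0 i i' : 0 <= m i i' by rewrite mulr_ge0 ?cell_weight_ge0.
have row i : \sum_i' m i i' = cell_weight pi i.
  by rewrite -big_distrr/= (cell_weight_sum1 c') mulr1.
have col i' : \sum_i m i i' = cell_weight pi' i'.
  by rewrite -big_distrl/= (cell_weight_sum1 c) mul1r.
have [mu [cpl _]] := coupling_of_weights c c' m0 row col.
exists mu => // S T mS mT.
have sum_le U : measurable U -> \sum_z cell_part pi pi' mu U z <= 1.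
  move=> mU; rewrite -(push_sum fst) -(cell_weight_sum1 c); apply: ler_sum => i _.
  exact: push_fst_cell_part.
have d2 (z z' : I * I') : `|w z.1 z'.1 - w' z.2 z'.2| <= 2 * C.
  by apply: (le_trans (ler_normB _ _)); have := wC z.1 z'.1; have := w'C z.2 z'.2; lra.
have CC : 0 <= 2 * C by rewrite mulr_ge0.
apply: (le_trans (bform_norm_le CC d2 _ _)); try by move=> z; exact: cell_part_ge0.
rewrite -mulrA ler_piMr// mulr_ile1 ?sum_le// sumr_ge0// => z _; exact: cell_part_ge0.
Qed.

End inverse_counting.

Section graphs_of_sets.
Context {R : realType} {k : nat}.

Section graph_of_set.
Variable D : {set 'I_k * 'I_k}.
Hypothesis D_lt : [forall e in D, (e.1 < e.2)%N].

Let adjD : rel 'I_k := fun i j => ((i, j) \in D) || ((j, i) \in D).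

Let adjD_sym : symmetric adjD. Proof. by move=> i j; rewrite /adjD orbC. Qed.

Let adjD_irr : irreflexive adjD.
Proof.
move=> i; rewrite /adjD orbb; apply/negP => iD.
by have /forall_inP /(_ _ iD) := D_lt; rewrite ltnn.
Qed.

Lemma graph_of_set : exists F : simple_graph k, edges F = D.
Proof.
exists (SimpleGraph adjD_sym adjD_irr); apply/setP => -[i j]; rewrite inE /= /adjD.
have Dlt u v : (u, v) \in D -> (u < v)%N by move=> uvD; exact: (forall_inP D_lt _ uvD).
apply/andP/idP => [[ij /orP[//|/Dlt ji]]|ijD].
  by have := ltn_trans ij ji; rewrite ltnn.
by rewrite ijD; split => //; exact: Dlt.
Qed.

End graph_of_set.

Lemma set_densityZ (I : finType) (p : I -> R) (w : I -> I -> R) (a : R)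
    (D : {set 'I_k * 'I_k}) :
  set_density p (fun x y => a * w x y) D = a ^+ #|D| * set_density p w D.
Proof.
rewrite /set_density -ExZ; apply: Ex_eq => X.
by rewrite big_split/= prodr_const.
Qed.

(** The total variation bound that the hypothesis yields: 2^n patterns, and 3^-n doubled by the step
    approximation. From n = 6 on, (2/3)^n <= 1/8. *)
Lemma pow3_gt2 (n : nat) : (6 <= n)%N -> 2 ^+ n * (2 * 3 ^- n) <= 4^-1 :> R.
Proof.
move=> /subnK <-; elim: (n - 6)%N => [|m IHm]; last first.
  apply: le_trans IHm; rewrite addSn !exprS invfM.
  have : 0 <= 2 ^+ (m + 6) * (2 * 3 ^- (m + 6)) :> R by rewrite !mulr_ge0// ?invr_ge0 exprn_ge0.
  lra.
by rewrite add0n; lra.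
Qed.

Lemma mass_cell_weight (I J : finType) (pi : R -> I) (c : I -> J) (j : J) : cells pi ->
  mass (cell_weight pi) c j = cell_weight (c \o pi) j.
Proof.
move=> cpi; have mE : measurable ((c \o pi) @^-1` [set j]).
  exact: (measurable_fin_preimage cpi [set i | c i = j]).
have := integral_fin (unit_lebesgue R) cpi (fun i => (c i == j)%:R) measurableT.
rewrite (eq_integral (fun x => (\1_((c \o pi) @^-1` [set j]) x)%:E)); last first.
  move=> x _; rewrite indicE (_ : (x \in _) = (c (pi x) == j))//.
  by apply/idP/eqP => [/set_mem//|xj]; exact: mem_set.
rewrite integral_indic// setIT /cell_weight => -> /=.
rewrite /mass big_mkcond/=; apply: eq_bigr => i _; rewrite setTI.
by case: eqP; rewrite ?mul1r ?mul0r.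
Qed.

End graphs_of_sets.

Section inverse_counting_large.
Context {R : realType}.
Variables (W W' : R * R -> R) (C : R) (k q : nat).
Hypothesis gW : graphon W.
Hypothesis gW' : graphon W'.
Hypothesis WC : sup_norm W <= C.
Hypothesis W'C : sup_norm W' <= C.
Hypothesis C1 : 1 <= C.
Hypothesis q40 : (40 <= q)%N.
Hypothesis k8q : (8 ^ q <= k)%N.
Hypothesis close : forall F : simple_graph k,
  `|hom_density F W - hom_density F W'| <= 3 ^- (k ^ 2).

Let C0 : 0 <= C. Proof. exact: le_trans C1. Qed.
Let C_gt0 : 0 < C. Proof. exact: lt_le_trans C1. Qed.

Lemma cut_distance_le_large :
  (cut_distance W W' <= (25 / 2 * C / Num.sqrt q%:R)%:E)%E.
Proof.
have Cgt0 := C_gt0; have Cge0 := C0.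
have q_gt0 : 0 < q%:R :> R by rewrite ltr0n (leq_trans _ q40).
have k40 : (40 <= k)%N.
  by apply: leq_trans k8q; apply: (leq_trans q40); exact: ltnW (ltn_expl q _).
pose y : R := (Num.sqrt q%:R)^-1.
have y_gt0 : 0 < y by rewrite invr_gt0 sqrtr_gt0.
have qy : q%:R * y ^+ 2 = 1.
  by rewrite /y exprVn sqr_sqrtr ?(ltW q_gt0)// divff ?gt_eqF.
have := close; set K := (k ^ 2)%N => closeK; have KE : (k * k)%N = K by rewrite /K expnS expn1.
have den0 : 0 < 2 * (C ^+ K * K%:R) + 1.
  by rewrite ltr_wpDl// !mulr_ge0// exprn_ge0.
have t0 : 0 < 3 ^- K :> R by rewrite invr_gt0 exprn_gt0.
(* For [e] up to this bound, passing to step functions changes a difference of densities by at most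
   3^-K; this is the factor 2 in [vclose]. *)
apply: (cut_distance_le_step gW gW' WC W'C C1); exists (3 ^- K / (2 * (C ^+ K * K%:R) + 1)).
  by rewrite divr_gt0.
move=> e I I' pi pi' w w' /andP[e0 eK] c c' w_sym w'_sym wC w'C dW dW'.
pose v x z := C^-1 * w x z; pose v' x z := C^-1 * w' x z.
have v1 x z : `|v x z| <= 1.
  by rewrite /v normrM gtr0_norm ?invr_gt0// ler_pdivrMl// mulr1.
have v'1 x z : `|v' x z| <= 1.
  by rewrite /v' normrM gtr0_norm ?invr_gt0// ler_pdivrMl// mulr1.
have v_sym x z : v x z = v z x by rewrite /v w_sym.
have v'_sym x z : v' x z = v' z x by rewrite /v' w'_sym.
have vclose (D : {set 'I_k * 'I_k}) : [forall e in D, (e.1 < e.2)%N] ->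
    `|set_density (cell_weight pi) v D - set_density (cell_weight pi') v' D| <= 2 * 3 ^- K.
  move=> /graph_of_set[F FD]; rewrite !set_densityZ -mulrBr normrM.
  have F_le : (#|edges F| <= K)%N.
    by apply: (leq_trans (max_card _)); rewrite card_prod !card_ord KE.
  have errE : C ^+ (#|edges F| - 1) * (#|edges F|%:R * e) <= C ^+ K * K%:R * e.
    rewrite mulrA ler_wpM2r ?(ltW e0)//; apply: ler_pM => //; first exact: exprn_ge0.
      by rewrite ler_weXn2l// (leq_trans (leq_subr _ _)).
    by rewrite ler_nat.
  have eKE : (2 * (C ^+ K * K%:R) + 1) * e <= 3 ^- K by rewrite mulrC -ler_pdivlMr.
  have d1 := hom_density_dist F gW WC C0 c wC (ltW e0) dW.
  have d2 := hom_density_dist F gW' W'C C0 c' w'C (ltW e0) dW'.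
  have sE : set_density (cell_weight pi) w D = hom_density F (step2 pi w).
    by rewrite hom_density_step// FD.
  have s'E : set_density (cell_weight pi') w' D = hom_density F (step2 pi' w').
    by rewrite hom_density_step// FD.
  have d3 := closeK F.
  have d : `|set_density (cell_weight pi) w D - set_density (cell_weight pi') w' D| <=
      2 * 3 ^- K.
    rewrite sE s'E; move: d1 d2 d3; rewrite !ler_norml => /andP[? ?] /andP[? ?] /andP[? ?].
    by apply/andP; split; lra.
  (* Rescaling multiplies a density by a power of 1/C, which is at most 1. *)
  apply: le_trans d; rewrite ler_piMl// normrX gtr0_norm ?invr_gt0//.
  by rewrite exprn_ile1 ?invr_ge0// invf_le1.
have dK : 2 ^+ (k * k) * (2 * 3 ^- K) <= 4^-1 :> R.
  rewrite KE; apply: pow3_gt2; rewrite -KE; apply: (@leq_trans (40 * 40)) => //.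
  exact: leq_mul.
have [J [J' [f [f' [m [m0 row col cut]]]]]] := finite_inverse_counting
  (cell_weight_ge0 pi) (cell_weight_sum1 c) (cell_weight_ge0 pi') (cell_weight_sum1 c')
  v_sym v'_sym v1 v'1 q40 k8q y_gt0 qy vclose dK.
have cf : cells (f \o pi) by move=> j; exact: (measurable_fin_preimage c [set i | f i = j]).
have cf' : cells (f' \o pi').
  by move=> j; exact: (measurable_fin_preimage c' [set i | f' i = j]).
have [mu [cpl muE]] := coupling_of_weights cf cf' m0
  (fun j => etrans (row j) (mass_cell_weight f j c))
  (fun j => etrans (col j) (mass_cell_weight f' j c')).
exists mu => // S T mS mT.
have part_le U z : measurable U ->
    push (fun y => (f y.1, f' y.2)) (cell_part pi pi' mu U) z <= m z.1 z.2.
  move=> mU; have le := @push_cell_part_le R I I' pi pi' mu c c' (J * J')%type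
    (fun y => (f y.1, f' y.2)) U z mU.
  rewrite -[leRHS]/(fine (m z.1 z.2)%:E) -muE -surjective_pairing.
  exact: le.
have := cut (cell_part pi pi' mu S) (cell_part pi pi' mu T)
  (cell_part_ge0 _ _ _ _) (cell_part_ge0 _ _ _ _)
  (fun x => push_fst_cell_part c c' cpl x mS) (fun x => push_fst_cell_part c c' cpl x mT)
  (fun x => push_snd_cell_part c c' cpl x mS) (fun x => push_snd_cell_part c c' cpl x mT)
  (fun z => part_le S z mS) (fun z => part_le T z mT).
have -> : bform (fun z z' => w z.1 z'.1 - w' z.2 z'.2)
    (cell_part pi pi' mu S) (cell_part pi pi' mu T) =
    C * bform (fun z z' => v z.1 z'.1 - v' z.2 z'.2)
    (cell_part pi pi' mu S) (cell_part pi pi' mu T).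
  rewrite /bform big_distrr/=; apply: eq_bigr => z _; rewrite big_distrr/=.
  by apply: eq_bigr => z' _; rewrite /v /v'; field; rewrite gt_eqF.
rewrite normrM gtr0_norm// => le.
rewrite (_ : 25 / 2 * C / Num.sqrt q%:R = C * (25 / 2 * y)); last by rewrite /y; ring.
by rewrite ler_wpM2l.
Qed.

End inverse_counting_large.

Lemma log2_le (R : realType) (n k : nat) : (0 < k)%N -> (k < 8 ^ n)%N ->
  log2 k%:R <= 3 * n%:R :> R.
Proof.
move=> k0 kn; have ln20 : 0 < ln 2 :> R by rewrite ln_gt0// ltr1n.
rewrite /log2 ler_pdivrMr// (_ : 3 * n%:R = (3 * n)%:R); last by rewrite natrM.
rewrite mulr_natl -lnXn// ler_ln ?posrE ?ltr0n// ?exprn_gt0//.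
by rewrite exprM -[2 ^+ 3]/(2 ^+ 3 : R) (_ : 2 ^+ 3 = 8%:R :> R) -?natrX ?ler_nat ?(ltnW kn)//; ring.
Qed.

Lemma log2_gt0 (R : realType) (k : nat) : (1 < k)%N -> 0 < log2 k%:R :> R.
Proof. by move=> k1; rewrite divr_gt0// ln_gt0 ?ltr1n. Qed.

Lemma inverse_counting_lemma (R : realType) (W W' : R * R -> R) (C : R) (k : nat) :
  graphon W -> graphon W' -> sup_norm W <= C -> sup_norm W' <= C -> 1 <= C -> (1 < k)%N ->
  (forall F : simple_graph k, `|hom_density F W - hom_density F W'| <= 3 ^- (k ^ 2)) ->
  (cut_distance W W' <= (22 * C / Num.sqrt (log2 k%:R))%:E)%E.
Proof.
move=> gW gW' WC W'C C1 k1 close; have k0 := ltnW k1.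
have L0 := log2_gt0 R k1; have C0 : 0 <= C by exact: le_trans C1.
have sL0 : 0 < Num.sqrt (log2 k%:R : R) by rewrite sqrtr_gt0.
(* n keeps 8 ^ 40 from being computed in unary. *)
have [n n40] : exists n, n = 40%N by exists 40%N.
have [ksmall|klarge] := ltnP k (8 ^ n).
  apply: (le_trans (cut_distance_le_trivial gW gW' WC W'C C1)); rewrite lee_fin.
  rewrite ler_pdivlMr// mulrAC ler_wpM2r//.
  (* log2 k <= 3 * 40 = 120 < 11^2, and 22 / 11 = 2: the constant 22 is what the trivial bound
     demands up to this threshold. *)
  have : Num.sqrt (log2 k%:R : R) <= Num.sqrt (11 ^+ 2).
    by rewrite ler_wsqrtr//; have := log2_le R k0 ksmall; rewrite n40; lra.
  by rewrite sqrtr_sqr ger0_norm//; lra.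
pose q := trunc_log 8 k.
have /andP[k8q k8q1] : (8 ^ q <= k < 8 ^ q.+1)%N by exact: trunc_log_bounds.
have q40 : (40 <= q)%N by rewrite -n40; exact: trunc_log_max.
apply: (le_trans (cut_distance_le_large gW gW' WC W'C C1 q40 k8q close)); rewrite lee_fin.
have q40R : 40 <= q%:R :> R by rewrite ler_nat.
have sq0 : 0 < Num.sqrt q%:R :> R by rewrite sqrtr_gt0; lra.
rewrite ler_pdivlMr// mulrAC ler_pdivrMr//.
rewrite [leLHS]mulrAC [leRHS]mulrAC ler_wpM2r//.
have L3 := log2_le R k0 k8q1.
(* Squared, the claim is (25/2)^2 log2 k <= 22^2 q; with log2 k <= 3 (q + 1) it follows from 468.75
   (q + 1) <= 484 q, which holds for q >= 40. *)
rewrite -(@ler_pXn2r _ 2)// ?nnegrE ?mulr_ge0 ?sqrtr_ge0//.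
rewrite !exprMn !sqr_sqrtr ?(ltW L0)//; lra.
Qed.

Theorem theorem3p7 (R : realType) (W W' : R * R -> R) (k : nat)
    (hW : graphon W) (hW' : graphon W') (hk : (1 <= k)%N) :
  let C := Num.max 1 (Num.max (sup_norm W) (sup_norm W')) in
  (forall (n : nat) (F : simple_graph n) (m : nat), #|edges F| = m ->
     (`|hom_density F W - hom_density F W'|%:E <=
      (4 * m%:R * C ^+ (m - 1))%:E * cut_distance W W')%E) /\
  ((forall F : simple_graph k,
      `|hom_density F W - hom_density F W'| <= 3 ^- (k ^ 2)) ->
   (cut_distance W W' <=
      if (k == 1)%N then +oo else (22 * C / Num.sqrt (log2 k%:R))%:E)%E).
Proof.
move=> C; have C1 : 1 <= C by rewrite le_max lexx.
have WC : sup_norm W <= C by rewrite !le_max lexx orbT.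
have W'C : sup_norm W' <= C by rewrite !le_max lexx !orbT.
have C0 : 0 < C by exact: lt_le_trans C1.
split => [n F m <-|close].
  exact: (counting_lemma hW hW' WC W'C (ltW C0) F C0).
have [_|k1] := eqVneq k 1%N; first exact: leey.
apply: inverse_counting_lemma => //.
by rewrite ltn_neqAle eq_sym k1.
Qed.
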